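(* Let $n\ge2$, let $\Omega\subset\mathbb{R}^n$ be a bounded domain, $T\in(0,\infty)$, $\Omega_T=\Omega\times(0,T)$, $\delta_1,\dots,\delta_n\ge0$, $\mathcal{C}>0$, and let $\mathbf{p}=(p_1,\ldots,p_n)$ satisfy $$1<p_i<\overline p\Big(1+\frac2n\Big)\ \text{ for all } i,\qquad \overline p<n,\qquad \overline p>\frac{2n}{n+2}.$$ There is a constant $C>0$, depending only on $n$, $\mathcal{C}$, $\mathbf{p}$ and $\max\{\delta_1,\ldots,\delta_n\}$, such that the following holds. If $u\in\mathcal{DG}^+(\mathbf{p},\{\delta_i\},\Omega_T,\mathcal{C})$, then $u$ is locally bounded from above and, for every cylinder $Q_\rho(x_0,t_0)\Subset\Omega_T$ and every $\sigma\in(0,1)$, $$\operatorname*{ess\,sup}_{Q_{\sigma\rho}(x_0,t_0)}u\le\max\left\{1,\ \rho^{1/P},\ C\left[(1-\sigma)^{-\frac{\mathcal{P}(n+\overline p)}{\overline p}}\,\frac{1}{|Q_\rho(x_0,t_0)|}\iint_{Q_\rho(x_0,t_0)}u_+^P\,dx\,dt\right]^{\frac{\overline p}{\overline p(n+2)-nP}}\right\}.$$ Similarly, if $u\in\mathcal{DG}^-(\mathbf{p},\{\delta_i\},\Omega_T,\mathcal{C})$, then $u$ is locally bounded from below and, for every $Q_\rho(x_0,t_0)\Subset\Omega_T$ and every $\sigma\in(0,1)$, $$\operatorname*{ess\,inf}_{Q_{\sigma\rho}(x_0,t_0)}u\ge-\max\left\{1,\ \rho^{1/P},\ C\left[(1-\sigma)^{-\frac{\mathcal{P}(n+\overline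 p)}{\overline p}}\,\frac{1}{|Q_\rho(x_0,t_0)|}\iint_{Q_\rho(x_0,t_0)}u_-^P\,dx\,dt\right]^{\frac{\overline p}{\overline p(n+2)-nP}}\right\}.$$
   Context: Notation. $v_+=\max\{v,0\}$, $v_-=\max\{-v,0\}$. $\overline p:=\big(\frac1n\sum_{i=1}^n\frac1{p_i}\big)^{-1}$, $\mathcal{P}:=\max\{p_1,\ldots,p_n\}$, $P:=\max\{2,\mathcal{P}\}$. $K_\rho(x_0):=\prod_{i=1}^n(x_{0,i}-\rho^{1/p_i},x_{0,i}+\rho^{1/p_i})$, $Q_\rho(x_0,t_0):=K_\rho(x_0)\times(t_0-\rho,t_0)$. $A\Subset\Omega_T$ means that the closure of $A$ is a compact subset of $\Omega_T$. Function space. $L^{\mathbf p}_{loc}(0,T;W^{1,\mathbf p}_{loc}(\Omega)):=\{v\in L^1_{loc}(0,T;W^{1,1}_{loc}(\Omega)):\partial_{x_i}v\in L^{p_i}_{loc}(\Omega_T)\text{ for all }i\}$. Admissible cut-off function for $Q_\rho(x_0,t_0)$: a function $\zeta\in C^\infty(\mathbb{R}^{n+1})$ of the form $\zeta(x,t)=\psi(t)\prod_{i=1}^n\zeta_i^{p_i}(x_i)$, where $\psi\in C^\infty(\mathbb{R};[0,1])$ is non-decreasing and for some $\epsilon\in(0,\rho)$ satisfies $\psi\equiv0$ on $(-\infty,t_0-\rho+\epsilon/2]$ and $\psi\equiv1$ on $[t_0-\rho+\epsilon,\infty)$, and $\zeta_i\in C_0^\infty(\mathbb{R};[0,1])$ with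 $\operatorname{supp}\zeta_i\subset(x_{0,i}-\rho^{1/p_i},x_{0,i}+\rho^{1/p_i})$. De Giorgi classes. A measurable $u:\Omega_T\to\mathbb{R}$ belongs to $\mathcal{DG}^+(\mathbf p,\{\delta_i\},\Omega_T,\mathcal{C})$ if $u\in L^{\mathbf p}_{loc}(0,T;W^{1,\mathbf p}_{loc}(\Omega))\cap L^P_{loc}(\Omega_T)$ and, for all $(x_0,t_0)\in\Omega_T$, $\rho>0$ with $Q_\rho(x_0,t_0)\Subset\Omega_T$, all $k\in\mathbb{R}$ and all admissible cut-off functions $\zeta$ for $Q_\rho(x_0,t_0)$, $$\operatorname*{ess\,sup}_{t_0-\rho<\tau<t_0}\int_{K_\rho(x_0)}(u-k)_+^2(x,\tau)\,\zeta(x,\tau)\,dx+\sum_{i=1}^n\iint_{Q_\rho(x_0,t_0)}(|\partial_{x_i}u|-\delta_i)_+^{p_i}\,\zeta\,\mathbf{1}_{\{u>k\}}\,dx\,dt$$ $$\le\mathcal{C}\iint_{Q_\rho(x_0,t_0)}(u-k)_+^2\,\partial_t\zeta\,dx\,dt+\mathcal{C}\sum_{i=1}^n\iint_{Q_\rho(x_0,t_0)}(u-k)_+^{p_i}\,|\partial_{x_i}\zeta^{1/p_i}|^{p_i}\,dx\,dt.$$ The class $\mathcal{DG}^-(\mathbf p,\{\delta_i\},\Omega_T,\mathcal{C})$ is defined in the same way with $(u-k)_+$ replaced everywhere by $(u-k)_-$ and $\mathbf{1}_{\{u>k\}}$ replaced by $\mathbf{1}_{\{u<k\}}$. *)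

(* Defs.v *)
From HB Require Import structures.
From mathcomp Require Import all_boot all_order all_algebra.
From mathcomp Require Import all_classical all_reals all_analysis.
From mathcomp Require Import ess_sup_inf.
Set Implicit Arguments.
Unset Strict Implicit.
Unset Printing Implicit Defensive.
Import Order.TTheory GRing.Theory Num.Theory numFieldNormedType.Exports.
Local Open Scope classical_set_scope.
Local Open Scope ring_scope.

(* 'rV[T]_n carries the product sigma-algebra, generated by the coordinates
   (the analogue for row vectors of the library instance on n.-tuple T). *)
Section measurable_rV.
Context {d} {T : measurableType d}.
Variable n : nat.

Let coord (i : 'I_n) (x : 'rV[T]_n) : T := x ord0 i.

Let rV_set0 : g_sigma_preimage coord set0.
Proof. exact: sigma_algebra0. Qed.

Let rV_setC A : g_sigma_preimage coord A -> g_sigma_preimage coord (~` A).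
Proof. exact: sigma_algebraC. Qed.

Let rV_bigcup (F : (set 'rV[T]_n)^nat) :
  (forall i, g_sigma_preimage coord (F i)) ->
  g_sigma_preimage coord (\bigcup_i (F i)).
Proof. exact: sigma_algebra_bigcup. Qed.

HB.instance Definition _ := @isMeasurable.Build (measure_tuple_display d)
  'rV[T]_n (g_sigma_preimage coord) rV_set0 rV_setC rV_bigcup.

Lemma measurable_coord (i : 'I_n) : measurable_fun [set: 'rV[T]_n] (coord i).
Proof.
move=> _ Y mY; rewrite setTI; apply: sub_sigma_algebra => /=.
rewrite -bigcup_seq/=; exists i => /=; first by rewrite mem_index_enum.
by exists Y => //; rewrite setTI.
Qed.

Lemma measurable_fun_rVP d1 (T1 : measurableType d1) (f : T1 -> 'rV[T]_n) :
  (forall i, measurable_fun [set: T1] (fun x => f x ord0 i)) ->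
  measurable_fun [set: T1] f.
Proof.
move=> mf.
have sub : g_sigma_preimage (fun i => coord i \o f) `<=` measurable.
  apply: smallest_sub; first exact: sigma_algebra_measurable.
  rewrite -bigcup_seq => A [i _] [B mB <-].
  exact: mf.
move=> _ A mA; apply: sub.
by rewrite g_sigma_preimage_comp; exists A.
Qed.

End measurable_rV.

Section lebesgue_rV.
Context {R : realType}.

Definition cons_rV n (z : measurableTypeR R * 'rV[R]_n) : 'rV[R]_n.+1 :=
  \row_i oapp (z.2 ord0) z.1 (unlift ord0 i).

Definition uncons_rV n (x : 'rV[R]_n.+1) : measurableTypeR R * 'rV[R]_n :=
  (x ord0 ord0, \row_i x ord0 (lift ord0 i)).

Lemma uncons_rVK n : cancel (@uncons_rV n) (@cons_rV n).
Proof.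
move=> x; apply/rowP => i; rewrite mxE /=.
by case: unliftP => [j|] -> //=; rewrite mxE.
Qed.

Lemma cons_rVK n : cancel (@cons_rV n) (@uncons_rV n).
Proof.
move=> [a y]; rewrite /uncons_rV mxE unlift_none /=; congr pair.
by apply/rowP => i; rewrite !mxE liftK.
Qed.

Let measurable_id_R : measurable_fun [set: measurableTypeR R] (idfun : _ -> R).
Proof. by move=> _ A mA; rewrite setTI. Qed.

Lemma measurable_cons_rV n : measurable_fun [set: _] (@cons_rV n).
Proof.
apply: measurable_fun_rVP => i; rewrite /cons_rV.
case: (unliftP ord0 i) => [j ->|->].
  rewrite (_ : (fun _ => _) = fun z : measurableTypeR R * 'rV[R]_n => z.2 ord0 j).
    apply: (@measurableT_comp _ _ _ _ _ _ (fun x : 'rV[R]_n => x ord0 j)) => //.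
    exact: measurable_coord.
  by apply/funext => z; rewrite mxE liftK.
rewrite (_ : (fun _ => _) = idfun \o fst).
  exact: measurableT_comp.
by apply/funext => z; rewrite mxE unlift_none.
Qed.

Lemma measurable_uncons_rV n : measurable_fun [set: _] (@uncons_rV n).
Proof.
apply: measurable_fun_pair; first exact: (measurable_coord ord0).
apply: measurable_fun_rVP => i.
rewrite (_ : (fun _ => _) = fun x : 'rV[R]_n.+1 => x ord0 (lift ord0 i)).
  exact: (measurable_coord (lift ord0 i)).
by apply/funext => x; rewrite mxE.
Qed.

Section step.
Local Open Scope ereal_scope.
Variables (n : nat) (m : {sigma_finite_measure set 'rV[R]_n -> \bar R}).

Definition lebesgue_cons (A : set 'rV[R]_n.+1) : \bar R :=
  (@lebesgue_measure R \x m) (@cons_rV n @^-1` A).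

Let mpre A : measurable A -> measurable (@cons_rV n @^-1` A).
Proof. by move=> mA; rewrite -[X in measurable X]setTI; exact: measurable_cons_rV. Qed.

Let lc0 : lebesgue_cons set0 = 0.
Proof. by rewrite /lebesgue_cons preimage_set0 measure0. Qed.

Let lc_ge0 A : 0 <= lebesgue_cons A.
Proof. exact: measure_ge0. Qed.

Let lc_sigma_additive : semi_sigma_additive lebesgue_cons.
Proof.
move=> F mF tF mUF; rewrite /lebesgue_cons preimage_bigcup.
apply: measure_semi_sigma_additive.
- by move=> k; exact: mpre.
- apply/trivIsetP => /= i j _ _ ij; rewrite -preimage_setI.
  by move/trivIsetP : tF => /(_ _ _ _ _ ij) ->//; rewrite preimage_set0.
- by rewrite -preimage_bigcup; exact: mpre.
Qed.

HB.instance Definition _ :=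
  isMeasure.Build _ _ _ lebesgue_cons lc0 lc_ge0 lc_sigma_additive.

Let lc_sigma_finite : sigma_finite setT lebesgue_cons.
Proof.
have /sigma_finiteP[F [TF ndF Foo]] := sigma_finiteT (@lebesgue_measure R).
have /sigma_finiteP[G [TG ndG Goo]] := sigma_finiteT m.
exists (fun k => @uncons_rV n @^-1` (F k `*` G k)).
  rewrite -preimage_bigcup -[LHS](preimage_setT (@uncons_rV n)); congr (_ @^-1` _).
  rewrite -setXTT TF TG predeqE => -[x y]; split.
    move=> [/= [i _ Fix] [k _ Gky]]; exists (maxn i k) => //; split.
    - by move: x Fix; exact/subsetPset/ndF/leq_maxl.
    - by move: y Gky; exact/subsetPset/ndG/leq_maxr.
  by move=> [i _ []/= ? ?]; split; exists i.
move=> k; have [mF Fk] := Foo k; have [mG Gk] := Goo k; split.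
  rewrite -[X in measurable X]setTI; apply: measurable_uncons_rV => //.
  exact: measurableX.
rewrite /lebesgue_cons (_ : _ @^-1` _ = F k `*` G k); last first.
  rewrite -comp_preimage (_ : _ \o _ = id) ?preimage_id//.
  by apply/funext => z; exact: cons_rVK.
by rewrite product_measure1E// lte_mul_pinfty// ge0_fin_numE.
Qed.

HB.instance Definition _ :=
  Measure_isSigmaFinite.Build _ _ _ lebesgue_cons lc_sigma_finite.

End step.

Let dirac_sigma_finite : sigma_finite setT (@dirac _ 'rV[R]_0 0%R R).
Proof. by apply: fin_num_fun_sigma_finite; [rewrite measure0|exact: fin_num_measure]. Qed.

(* n-dimensional Lebesgue measure as an iterated product measure; its
   normalization is lebesgue_rV_box. *)
Fixpoint lebesgue_rV n : {sigma_finite_measure set 'rV[R]_n -> \bar R} :=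
  if n is n'.+1 then lebesgue_cons (lebesgue_rV n') else (@dirac _ 'rV[R]_0 0%R R).

Lemma lebesgue_rV_box n (A : 'I_n -> set R) :
  (forall i, measurable (A i)) ->
  lebesgue_rV n [set x | forall i, A i (x ord0 i)] =
  (\prod_(i < n) @lebesgue_measure R (A i))%E.
Proof.
elim: n A => [|n IH] A mA.
  by rewrite big_ord0 /= diracE mem_set // => -[].
have mB : measurable [set x : 'rV[R]_n | forall i, A (lift ord0 i) (x ord0 i)].
  rewrite (_ : [set _ | _] = \big[setI/setT]_(i < n)
    ((fun x : 'rV[R]_n => x ord0 i) @^-1` A (lift ord0 i))).
    apply: bigsetI_measurable => i _; rewrite -[X in measurable X]setTI.
    exact: (measurable_coord i).
  rewrite -bigcap_seq; apply/seteqP; split => x /= Ax i; first by move=> _; exact: Ax.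
  by apply: Ax; rewrite /= mem_index_enum.
rewrite big_ord_recl -IH => [|i]; last exact: mA.
rewrite -[RHS](product_measure1E (@lebesgue_measure R) (lebesgue_rV n))//; last exact: mA.
congr ((_ \x _)%E _); apply/seteqP; split => -[a x] /=.
  move=> Az; split; first by have := Az ord0; rewrite mxE unlift_none.
  by move=> i; have := Az (lift ord0 i); rewrite mxE liftK.
by case=> Aa Ax i; rewrite mxE /=; case: (unliftP ord0 i) => [j|] ->.
Qed.

End lebesgue_rV.

Section smooth_functions.
Context {R : realType} {V : normedModType R}.
Implicit Types (f : V -> R) (D : set V).

Definition iter_derive f (vs : seq V) : V -> R := foldr (fun v g => 'D_v g) f vs.

(* Used only for V = R, R^n and R^n x R. In finite dimension, existence and
   continuity of all iterated directional derivatives is C^oo smoothness. *)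
Definition smooth f := forall vs,
  continuous (iter_derive f vs) /\ forall x v, derivable (iter_derive f vs) x v.

Definition compactly_contained (A B : set V) := compact (closure A) /\ closure A `<=` B.

Definition test_function D f := smooth f /\ compactly_contained [set x | f x != 0] D.

Definition domain D := [/\ open D, connected D & D !=set0].

End smooth_functions.

Section measurable_ess_bounds.
Context d (T : measurableType d) (R : realType).
Variable mu : {measure set T -> \bar R}.

(* In the library measurable sets are Borel sets; a function is Lebesgue
   measurable iff it coincides almost everywhere with a Borel function. *)
Definition ae_measurable (D : set T) (f : T -> R) :=
  exists2 g : T -> R, measurable_fun D g & \forall x \ae mu, D x -> f x = g x.

Local Open Scope ereal_scope.

Definition ess_sup_on (D : set T) (f : T -> \bar R) : \bar R :=
  ess_sup mu (fun x => if x \in D then f x else -oo).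

Definition ess_inf_on (D : set T) (f : T -> \bar R) : \bar R :=
  ess_inf mu (fun x => if x \in D then f x else +oo).

End measurable_ess_bounds.

Section exponents.
Context {R : realType} {n : nat}.
Variable p : 'I_n -> R.

Definition mean_exponent : R := (n%:R^-1 * \sum_(i < n) (p i)^-1)^-1.

(* The maximum of a nonnegative family, 0 being a harmless default. *)
Definition family_max (a : 'I_n -> R) : R := \big[Num.max/0]_(i < n) a i.

Definition integrability_exponent : R := Num.max 2 (family_max p).

End exponents.

Section anisotropic.
Context {R : realType} {n : nat}.
Variable p : 'I_n -> R.

Local Notation space := 'rV[R]_n.
Local Notation spacetime := ('rV[R]_n * R)%type.
Local Notation mu_x := (lebesgue_rV n).
Local Notation mu_t := (@lebesgue_measure R).
Local Notation e_ i := (delta_mx ord0 i : 'rV[R]_n).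
Local Notation P := (integrability_exponent p).

Definition lebesgue_xt : {measure set (space * measurableTypeR R) -> \bar R} :=
  (mu_x \x mu_t)%E.
Local Notation mu_xt := lebesgue_xt.

Definition time_cylinder (Omega : set space) (T : R) : set spacetime :=
  Omega `*` `]0, T[%classic.

Definition cuboid (rho : R) (x0 : space) : set space :=
  [set x | forall i, x0 ord0 i - rho `^ (p i)^-1 < x ord0 i < x0 ord0 i + rho `^ (p i)^-1].

Definition time_interval (rho t0 : R) : set R := `]t0 - rho, t0[%classic.

Definition cylinder (rho : R) (x0 : space) (t0 : R) : set spacetime :=
  cuboid rho x0 `*` time_interval rho t0.

Section function_spaces.
Local Open Scope ereal_scope.

Definition L1loc_x (D : set space) (f : space -> R) :=
  ae_measurable mu_x D f /\
  forall K : set space, compact K -> K `<=` D -> \int[mu_x]_(x in K) (`|f x|)%:E < +oo.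

Definition Lqloc_xt (q : R) (D : set spacetime) (f : spacetime -> R) :=
  ae_measurable mu_xt D f /\
  forall K : set spacetime, compact K -> K `<=` D -> \int[mu_xt]_(z in K) (`|f z| `^ q)%:E < +oo.

(* g is the weak i-th partial derivative of f on Omega, with f and g locally
   integrable. *)
Definition weak_partial (Omega : set space) (i : 'I_n) (f g : space -> R) :=
  [/\ L1loc_x Omega f, L1loc_x Omega g &
  forall phi : space -> R, test_function Omega phi ->
    \int[mu_x]_(x in Omega) (f x * 'D_(e_ i) phi x)%:E =
    - \int[mu_x]_(x in Omega) (g x * phi x)%:E].

(* v belongs to L^1_loc(0, T; W^{1,1}_loc(Omega)) with spatial weak gradient Dv. *)
Definition L1loc_W11loc (Omega : set space) (T : R) (v : spacetime -> R)
    (Dv : 'I_n -> spacetime -> R) :=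
  [/\ Lqloc_xt 1 (time_cylinder Omega T) v,
      forall i, Lqloc_xt 1 (time_cylinder Omega T) (Dv i) &
      \forall t \ae mu_t, (0 < t < T)%R ->
        forall i, weak_partial Omega i (fun x => v (x, t)) (fun x => Dv i (x, t))].

Definition Lploc_W1ploc (Omega : set space) (T : R) (v : spacetime -> R)
    (Dv : 'I_n -> spacetime -> R) :=
  L1loc_W11loc Omega T v Dv /\
  forall i, Lqloc_xt (p i) (time_cylinder Omega T) (Dv i).

End function_spaces.

Definition admissible_time (rho t0 : R) (psi : R -> R) :=
  [/\ smooth psi, forall t, 0 <= psi t <= 1, {homo psi : s t / s <= t} &
  exists2 eps, 0 < eps < rho &
    (forall t, t <= t0 - rho + eps / 2 -> psi t = 0) /\
    (forall t, t0 - rho + eps <= t -> psi t = 1)].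

Definition admissible_space (rho : R) (x0 : space) (i : 'I_n) (zeta : R -> R) :=
  test_function `]x0 ord0 i - rho `^ (p i)^-1, x0 ord0 i + rho `^ (p i)^-1[%classic zeta /\
  forall s, 0 <= zeta s <= 1.

(* Smoothness of zeta itself is a separate condition: the powers p i need not
   be integers. *)
Definition admissible_cutoff (rho : R) (x0 : space) (t0 : R) (zeta : spacetime -> R) :=
  smooth zeta /\
  exists psi : R -> R, exists zeta_ : 'I_n -> R -> R,
    [/\ forall x t, zeta (x, t) = psi t * \prod_(i < n) zeta_ i (x ord0 i) `^ p i,
        admissible_time rho t0 psi &
        forall i, admissible_space rho x0 i (zeta_ i)].

Section energy.
Local Open Scope ereal_scope.

(* The energy inequality on one cylinder; w stands for (u - k)_+ or (u - k)_-
   and A for the corresponding level set. *)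
Definition energy_estimate (delta : 'I_n -> R) (C rho : R) (x0 : space) (t0 : R)
    (zeta : spacetime -> R) (Du : 'I_n -> spacetime -> R)
    (w : spacetime -> R) (A : set spacetime) :=
  let K := cuboid rho x0 in let Q := cylinder rho x0 t0 in
  ess_sup_on mu_t (time_interval rho t0)
    (fun tau => \int[mu_x]_(x in K) (w (x, tau) ^+ 2 * zeta (x, tau))%:E) +
  \sum_(i < n) \int[mu_xt]_(z in Q)
    ((Num.max (`|Du i z| - delta i) 0) `^ p i * zeta z * \1_A z)%:E
  <=
  C%:E * \int[mu_xt]_(z in Q) (w z ^+ 2 * 'D_((0 : space), (1 : R)) zeta z)%:E +
  C%:E * \sum_(i < n) \int[mu_xt]_(z in Q)
    (w z `^ p i * `|'D_(e_ i, (0 : R)) (fun y => zeta y `^ (p i)^-1) z| `^ p i)%:E.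

End energy.

Section de_giorgi.
Variables (delta : 'I_n -> R) (Omega : set space) (T C : R) (u : spacetime -> R).

Let Omega_T := time_cylinder Omega T.

Definition DG_plus :=
  ae_measurable mu_xt Omega_T u /\
  exists Du : 'I_n -> spacetime -> R,
  [/\ Lploc_W1ploc Omega T u Du, Lqloc_xt P Omega_T u &
  forall (x0 : space) (t0 rho : R), Omega_T (x0, t0) -> 0 < rho ->
    compactly_contained (cylinder rho x0 t0) Omega_T ->
  forall (k : R) (zeta : spacetime -> R), admissible_cutoff rho x0 t0 zeta ->
  energy_estimate delta C rho x0 t0 zeta Du
    (fun z => Num.max (u z - k) 0) [set z | k < u z]].

Definition DG_minus :=
  ae_measurable mu_xt Omega_T u /\
  exists Du : 'I_n -> spacetime -> R,
  [/\ Lploc_W1ploc Omega T u Du, Lqloc_xt P Omega_T u &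
  forall (x0 : space) (t0 rho : R), Omega_T (x0, t0) -> 0 < rho ->
    compactly_contained (cylinder rho x0 t0) Omega_T ->
  forall (k : R) (zeta : spacetime -> R), admissible_cutoff rho x0 t0 zeta ->
  energy_estimate delta C rho x0 t0 zeta Du
    (fun z => Num.max (- (u z - k)) 0) [set z | u z < k]].

End de_giorgi.

Section bounds.
Local Open Scope ereal_scope.

Definition locally_bounded_above (D : set spacetime) (u : spacetime -> R) :=
  forall K : set spacetime, compact K -> K `<=` D -> ess_sup_on mu_xt K (EFin \o u) < +oo.

Definition locally_bounded_below (D : set spacetime) (u : spacetime -> R) :=
  forall K : set spacetime, compact K -> K `<=` D -> -oo < ess_inf_on mu_xt K (EFin \o u).

(* v stands for u_+ or u_-. *)
Definition sup_bound (C rho sigma : R) (x0 : space) (t0 : R) (v : spacetime -> R) : \bar R :=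
  let Q := cylinder rho x0 t0 in
  let pbar := mean_exponent p in
  maxe 1 (maxe (rho `^ P^-1)%:E
    (C%:E * (((1 - sigma) `^ (- (family_max p * (n%:R + pbar) / pbar)))%:E *
             ((fine (mu_xt Q))^-1%:E * \int[mu_xt]_(z in Q) (v z `^ P)%:E))
            `^ (pbar / (pbar * (n%:R + 2) - n%:R * P)))).

End bounds.

End anisotropic.

(* Main.v *)
Require Import Defs.
From HB Require Import structures.
From mathcomp Require Import all_boot all_order all_algebra.
From mathcomp Require Import all_classical all_reals all_analysis.
From mathcomp Require Import ring lra measurable_realfun ess_sup_inf.
Import Order.TTheory GRing.Theory Num.Theory numFieldNormedType.Exports.
Local Open Scope classical_set_scope.
Local Open Scope ring_scope.
Set Implicit Arguments.
Unset Strict Implicit.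
Unset Printing Implicit Defensive.

(** The proof is De Giorgi's iteration, in which three facts are combined.

    The energy inequality of the class, applied with a cut-off function between
    two concentric cylinders, bounds the supremum in time of the L^2 norm of
    (u - k)_+ and the integrals of (|d_i u| - delta_i)_+^p_i over {u > k} by
    lower-order integrals of (u - k)_+ on the larger cylinder ([caccioppoli]).
    The powers p_i are arbitrary real numbers, so the cut-off functions are built
    from exp (- 1 / y), whose real powers are smooth ([cutoff_exists]).

    The anisotropic Sobolev inequality of Troisi controls the power
    q = n pb / (n - pb) of a function by its n partial derivatives with their own
    exponents ([troisi_inequality]); pb denotes the harmonic mean of the p_i. It
    follows from the Loomis-Whitney inequality once the one-dimensional
    estimate of m^s by the integral of s m^(s - 1) (m / length + |d_i m|) along
    lines is known ([line_gagliardo]). The term m / length is the mean value over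
    the segment, and stands in for a boundary condition. A weakly differentiable
    function is absolutely continuous on almost every line by du Bois-Reymond's
    argument ([line_identity]), and truncations are handled by the convexity of the
    power function, without a chain rule ([slice_gagliardo]). Interpolating with
    the L^2 bound and integrating in time gives the power l = pb (1 + 2 / n) over
    the cylinder ([parabolic_embedding]).

    Raising the level gains a power: where u exceeds a higher level, (u - k)_+ at
    the lower level is bounded below, so every power below P and the measure of the
    superlevel set are bounded by the integral of (u - k)_+^P ([level_power]). Since
    P < l, Hoelder's inequality yields X_{j+1} <= A b^j X_j^(1 + P / (n + 2)) for the
    integrals X_j of (u - k_j)_+^P over shrinking cylinders, with k_j increasing to k
    ([degiorgi_step]). Such a sequence tends to 0 when X_0 is small relative to k,
    and u <= k follows on the limiting cylinder ([degiorgi_bound]). The smallness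
    condition, solved for k, is the stated bound ([level_choice]); the numbers 1 and
    rho^(1/P) in it come from trading lower powers of k for higher ones and from
    absorbing the constants delta_i.

    Local boundedness follows by covering a compact set with small cylinders, and
    the class with (u - k)_- is the image of the other one under u |-> - u
    ([DG_plus_opp]). *)

(** * Integrals of nonnegative functions and Hoelder's inequality *)

Section integral_ae.
Context d (T : measurableType d) (R : realType).
Variable mu : {measure set T -> \bar R}.
Local Open Scope ereal_scope.
Import HBNNSimple.

(** The integral of a nonnegative function is a supremum over simple functions
    below it, so it is monotone for any functions; a null set is removed by
    multiplying the simple function by the indicator of its complement. This
    matters below, where integrands contain u itself, which is Borel only up to
    a null set. *)
Lemma ge0_ae_le_integral_nm (D E : set T) (f g : T -> \bar R) :
  (forall x, D x -> 0 <= f x) -> (forall x, E x -> 0 <= g x) ->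
  (\forall x \ae mu, (f \_ D) x <= (g \_ E) x) ->
  \int[mu]_(x in D) f x <= \int[mu]_(x in E) g x.
Proof.
move=> f0 g0 [N [mN N0 fgN]]; rewrite !ge0_integralE//.
apply: ge_ereal_sup => _ [h /= hf <-].
have mNc : measurable (~` N) by exact: measurableC.
pose k : {nnsfun T >-> R} := proj_nnsfun h mNc.
apply: (@le_trans _ _ (sintegral mu k)); last first.
  apply: ereal_sup_ubound; exists k => // x /=.
  have [Nx|Nx] := boolP (x \in N).
    rewrite mindicE in_setC Nx mulr0.
    by apply: erestrict_ge0.
  rewrite mindicE in_setC Nx mulr1.
  apply: le_trans (hf x) _; apply: contrapT => /negP H.
  by move/negP: Nx; apply; rewrite inE; apply: fgN => /=; exact/negP.
have -> : sintegral mu h = \int[mu]_x (h x)%:E by rewrite integral_nnsfun// patch_setT.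
have -> : sintegral mu k = \int[mu]_x (k x)%:E by rewrite integral_nnsfun// patch_setT.
rewrite le_eqVlt; apply/orP; left; apply/eqP; apply: ge0_ae_eq_integral.
- by [].
- by apply/measurable_EFinP.
- by apply/measurable_EFinP.
- by move=> x _; rewrite lee_fin.
- by move=> x _; rewrite lee_fin.
- exists N; split => // x /=; apply: contra_notP => Nx _.
  by rewrite mindicE in_setC memNset// mulr1.
Qed.

Lemma ge0_le_integral_nm (D : set T) (f g : T -> \bar R) :
  (forall x, D x -> 0 <= f x) -> (forall x, D x -> f x <= g x) ->
  \int[mu]_(x in D) f x <= \int[mu]_(x in D) g x.
Proof.
move=> f0 fg; apply: ge0_ae_le_integral_nm => //.
  by move=> x Dx; apply: le_trans (f0 _ Dx) (fg _ Dx).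
by apply: aeW => x; apply: lee_restrict.
Qed.

Lemma ge0_subset_integral_nm (D E : set T) (f : T -> \bar R) :
  D `<=` E -> (forall x, E x -> 0 <= f x) ->
  \int[mu]_(x in D) f x <= \int[mu]_(x in E) f x.
Proof.
move=> DE f0; apply: ge0_ae_le_integral_nm => //; first by move=> x /DE /f0.
apply: aeW => x; rewrite !patchE; case: ifPn => [/set_mem Dx|_].
  by rewrite mem_set//; exact: DE.
by case: ifPn => // /set_mem /f0.
Qed.

Lemma ae_eq_integral_nm (D E : set T) (f g : T -> \bar R) :
  (\forall x \ae mu, (f \_ D) x = (g \_ E) x) ->
  \int[mu]_(x in D) f x = \int[mu]_(x in E) g x.
Proof.
have H (u v : T -> \bar R) : (forall x, 0 <= u x) -> (forall x, 0 <= v x) ->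
    (\forall x \ae mu, u x = v x) -> \int[mu]_x u x = \int[mu]_x v x.
  move=> u0 v0 uv; apply/eqP; rewrite eq_le !ge0_ae_le_integral_nm//;
    by apply: filterS uv => x; rewrite !patch_setT => ->.
move=> fg; rewrite integral_mkcond [RHS]integral_mkcond integralE [RHS]integralE.
by congr (_ - _); apply: H => //; apply: filterS fg => x;
  rewrite ?funeposE ?funenegE => ->.
Qed.

End integral_ae.

Lemma integral_mul_indic d (T : measurableType d) (R : realType)
    (mu : {measure set T -> \bar R}) (D : set T) (f : T -> R) :
  (\int[mu]_(x in D) (f x)%:E = \int[mu]_x (f x * \1_D x)%:E)%E.
Proof.
rewrite integral_mkcond; apply: eq_integral => x _.
by rewrite patchE indicE; case: ifPn => _; rewrite ?mulr1 ?mulr0.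
Qed.

Section hoelder_ereal.
Context d (T : measurableType d) (R : realType).
Variable mu : {measure set T -> \bar R}.
Local Open Scope ereal_scope.

(** The pointwise input of Hoelder's inequality; the infinite values need a case
    analysis of their own. *)
Lemma young_ereal (a b : R) (x y : \bar R) : (0 < a)%R -> (0 < b)%R -> (a + b = 1)%R ->
  0 <= x -> 0 <= y -> x `^ a * y `^ b <= a%:E * x + b%:E * y.
Proof.
move=> a0 b0 ab.
have inf z c e : (0 < c)%R -> (0 < e)%R -> 0 <= z ->
    +oo `^ c * z `^ e <= c%:E * +oo + e%:E * z.
  move=> c0 e0 z0; rewrite [c%:E * _]gt0_muley ?lte_fin// addye ?leey//.
  by rewrite gt_eqF// (lt_le_trans ltNy0)// mule_ge0// lee_fin ltW.
case: x => [x| |//]; last by move=> _ y0; exact: inf.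
case: y => [y| |//]; last first.
  by move=> x0 _; rewrite addeC muleC; exact: inf.
rewrite !lee_fin => x0 y0.
have := @conjugate_powR R (x `^ a)%R (y `^ b)%R (a^-1)%R (b^-1)%R.
rewrite !invrK -!powRrM !mulfV ?gt_eqF// !powRr1// (mulrC x) (mulrC y).
by apply; rewrite ?powR_ge0 ?invr_gt0.
Qed.

Lemma hoelder_ereal (f g : T -> \bar R) (a b : R) :
  (forall x, 0 <= f x) -> (forall x, 0 <= g x) ->
  measurable_fun setT f -> measurable_fun setT g ->
  (0 < a)%R -> (0 < b)%R -> (a + b = 1)%R ->
  \int[mu]_x (f x `^ a * g x `^ b) <= (\int[mu]_x f x) `^ a * (\int[mu]_x g x) `^ b.
Proof.
move=> f0 g0 mf mg a0 b0 ab.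
have zero (u v : T -> \bar R) c e : (forall x, 0 <= u x) -> measurable_fun setT u ->
    (0 < c)%R -> \int[mu]_x u x = 0 -> \int[mu]_x (u x `^ c * v x `^ e) = 0.
  move=> u0 mu_ c0 iu.
  rewrite (ae_eq_integral_nm (g := cst 0) (E := setT)) ?integral0//.
  have : \int[mu]_x `|u x| = 0.
    by rewrite -iu; apply: eq_integral => x _; rewrite gee0_abs.
  move/(ae_eq_integral_abs _ measurableT mu_); apply: filterS => x /(_ I) ux.
  by rewrite !patch_setT ux poweR0r ?gt_eqF// mul0e.
have [F0|F0] := eqVneq (\int[mu]_x f x) 0.
  by rewrite (zero f)// F0 poweR0r ?gt_eqF// mul0e.
have [G0|G0] := eqVneq (\int[mu]_x g x) 0.
  under eq_integral do rewrite muleC.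
  by rewrite (zero g)// G0 poweR0r ?gt_eqF// mule0.
have Fge : 0 <= \int[mu]_x f x by apply: integral_ge0.
have Gge : 0 <= \int[mu]_x g x by apply: integral_ge0.
have Fp : 0 < \int[mu]_x f x by rewrite lt0e F0.
have Gp : 0 < \int[mu]_x g x by rewrite lt0e G0.
have [Fy|Fy] := eqVneq (\int[mu]_x f x) +oo.
  by rewrite Fy poweRyr ?gt_eqF// gt0_mulye ?leey// poweR_gt0.
have [Gy|Gy] := eqVneq (\int[mu]_x g x) +oo.
  by rewrite Gy poweRyr ?gt_eqF// gt0_muley ?leey// poweR_gt0.
have [F FE] : exists F, \int[mu]_x f x = F%:E.
  by exists (fine (\int[mu]_x f x)); rewrite fineK// ge0_fin_numE// ltey.
have [G GE] : exists G, \int[mu]_x g x = G%:E.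
  by exists (fine (\int[mu]_x g x)); rewrite fineK// ge0_fin_numE// ltey.
rewrite FE GE; rewrite FE GE !lte_fin in Fp Gp.
have Fa : (0 < F `^ a)%R by exact: powR_gt0.
have Gb : (0 < G `^ b)%R by exact: powR_gt0.
rewrite !poweR_EFin -EFinM.
apply: (@le_trans _ _ (\int[mu]_x ((F `^ a * G `^ b)%:E *
    (a%:E * (F^-1%:E * f x) + b%:E * (G^-1%:E * g x))))).
  apply: ge0_le_integral_nm => x _; first by rewrite mule_ge0// poweR_ge0.
  have h (u : \bar R) (U c : R) : (0 < U)%R -> 0 <= u ->
      u `^ c = (U `^ c)%:E * (U^-1%:E * u) `^ c.
    move=> U0 u0; rewrite -poweR_EFin -poweRM ?mule_ge0 ?lee_fin ?invr_ge0 ?(ltW U0)//.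
    by rewrite muleA -EFinM mulfV ?gt_eqF// mul1e.
  rewrite (h _ _ a Fp (f0 x)) (h _ _ b Gp (g0 x)) muleACA EFinM.
  apply: lee_pmul => //; rewrite ?mule_ge0 ?lee_fin ?(ltW Fa) ?(ltW Gb) ?poweR_ge0//.
  apply: young_ereal; rewrite // ?mule_ge0 ?lee_fin ?invr_ge0 ?(ltW Fp) ?(ltW Gp)//.
have mcf : measurable_fun [set: T] (fun x => a%:E * (F^-1%:E * f x)).
  by apply: measurable_funeM; apply: measurable_funeM.
have mcg : measurable_fun [set: T] (fun x => b%:E * (G^-1%:E * g x)).
  by apply: measurable_funeM; apply: measurable_funeM.
have cf0 x : 0 <= a%:E * (F^-1%:E * f x).
  by rewrite !mule_ge0 ?lee_fin ?invr_ge0 ?(ltW Fp) ?(ltW a0).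
have cg0 x : 0 <= b%:E * (G^-1%:E * g x).
  by rewrite !mule_ge0 ?lee_fin ?invr_ge0 ?(ltW Gp) ?(ltW b0).
rewrite ge0_integralZl//=; last 3 first.
- exact: emeasurable_funD.
- by move=> x _; exact: adde_ge0.
- by rewrite lee_fin mulr_ge0 ?ltW.
rewrite ge0_integralD//.
do 2 (rewrite ge0_integralZl//=; [|by apply: measurable_funeM|
  by move=> x _; rewrite mule_ge0 ?lee_fin ?invr_ge0 ?(ltW Fp) ?(ltW Gp)|by rewrite lee_fin ltW]).
rewrite ge0_integralZl//=; last by rewrite lee_fin invr_ge0 ltW.
rewrite ge0_integralZl//=; last by rewrite lee_fin invr_ge0 ltW.
by rewrite FE GE -!EFinM !mulVf ?gt_eqF// !mulr1 ab mulr1.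
Qed.

(** Induction on the number of factors: the last n factors are grouped with the
    exponent 1 - a ord0 and the induction hypothesis is applied to the exponents
    divided by it. *)
Lemma hoelder_prod n (f : 'I_n.+1 -> T -> \bar R) (a : 'I_n.+1 -> R) :
  (forall i x, 0 <= f i x) -> (forall i, measurable_fun setT (f i)) ->
  (forall i, (0 < a i)%R) -> (\sum_(i < n.+1) a i = 1)%R ->
  \int[mu]_x (\prod_(i < n.+1) f i x `^ a i) <=
  \prod_(i < n.+1) (\int[mu]_x f i x) `^ a i.
Proof.
elim: n f a => [|n IH] f a f0 mf a0 suma.
  move: suma; rewrite !big_ord_recl !big_ord0 addr0 => a1.
  under eq_integral do rewrite big_ord_recl big_ord0 mule1 a1 poweRe1//.
  by rewrite mule1 a1 poweRe1// integral_ge0.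
pose b : R := (\sum_(i < n.+1) a (lift ord0 i))%R.
have b0 : (0 < b)%R.
  rewrite /b big_ord_recl; apply: ltr_wpDr => //.
  by apply: sumr_ge0 => i _; exact: ltW.
have ab : (a ord0 + b = 1)%R by rewrite -suma big_ord_recl.
pose a' i := (a (lift ord0 i) / b)%R.
have a'b i : (a' i * b = a (lift ord0 i))%R by rewrite /a' divfK ?gt_eqF.
have a'0 i : (0 < a' i)%R by rewrite divr_gt0.
have prodX (h : 'I_n.+1 -> \bar R) : (forall i, 0 <= h i) ->
    \prod_(i < n.+1) h i `^ a (lift ord0 i) = (\prod_(i < n.+1) h i `^ a' i) `^ b.
  move=> h0; have : 0 <= \prod_(i < n.+1) h i `^ a' i /\
     \prod_(i < n.+1) h i `^ a (lift ord0 i) = (\prod_(i < n.+1) h i `^ a' i) `^ b.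
    apply: (big_ind2 (fun u v : \bar R => 0 <= v /\ u = v `^ b)).
    - by rewrite poweR1r.
    - by move=> u1 v1 u2 v2 [? ->] [? ->]; rewrite mule_ge0// poweRM.
    - by move=> i _; rewrite poweR_ge0 -poweRrM a'b.
  by case.
under eq_integral => x _ do rewrite big_ord_recl prodX//.
have prod0 : forall x, 0 <= \prod_(i < n.+1) f (lift ord0 i) x `^ a' i.
  by move=> x; apply: prode_ge0 => i _; exact: poweR_ge0.
have mprod : measurable_fun [set: T] (fun x => \prod_(i < n.+1) f (lift ord0 i) x `^ a' i).
  have : forall s : seq 'I_n.+1, measurable_fun [set: T]
      (fun x => \prod_(i <- s) f (lift ord0 i) x `^ a' i).
    elim=> [|i s IHs]; first by under eq_fun do rewrite big_nil; exact: measurable_cst.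
    under eq_fun do rewrite big_cons; apply: emeasurable_funM => //.
    by apply: (@measurableT_comp _ _ _ _ _ _ (fun x => x `^ a' i)) => //; exact: measurable_poweR.
  by apply.
apply: le_trans (hoelder_ereal (f0 ord0) prod0 (mf ord0) mprod (a0 ord0) b0 ab) _.
rewrite big_ord_recl prodX; last by move=> i; exact: integral_ge0.
apply: lee_pmul; rewrite ?poweR_ge0//.
apply: gt0_ler_poweR; first exact: ltW.
- by rewrite in_itv/= leey andbT integral_ge0.
- by rewrite in_itv/= leey andbT prode_ge0// => i _; rewrite poweR_ge0.
apply: IH => //; rewrite /a' -mulr_suml.
by rewrite mulfV ?gt_eqF.
Qed.

End hoelder_ereal.

(** * Fubini for the coordinates of a row vector *)

Section integral_rV.
Context {R : realType}.
Local Open Scope ereal_scope.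
Local Notation lam := (@lebesgue_measure R).

Definition update n (x : 'rV[R]_n) (i : 'I_n) (r : R) : 'rV[R]_n :=
  \row_j (if j == i then r else x ord0 j).

Lemma measurable_coordR n (i : 'I_n) :
  measurable_fun [set: 'rV[R]_n] (fun x : 'rV[R]_n => x ord0 i : R).
Proof. exact: (measurable_coord (T := measurableTypeR R) i). Qed.

Lemma measurable_update n (i : 'I_n) :
  measurable_fun [set: 'rV[R]_n * measurableTypeR R] (fun z => update z.1 i z.2).
Proof.
apply: measurable_fun_rVP => j /=.
rewrite [X in measurable_fun _ X](_ : _ = if j == i then snd else
   (fun z : 'rV[R]_n * measurableTypeR R => z.1 ord0 j)); last first.
  by apply/funext => z; rewrite mxE; case: eqP.
case: eqP => _; first exact: measurable_snd.
apply: (@measurableT_comp _ _ _ _ _ _ (fun x : 'rV[R]_n => x ord0 j)).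
  exact: measurable_coordR.
exact: measurable_fst.
Qed.

Lemma ge0_integral_rVS n (f : 'rV[R]_n.+1 -> \bar R) :
  measurable_fun setT f -> (forall x, 0 <= f x) ->
  \int[lebesgue_rV n.+1]_x f x =
  \int[lam]_a \int[lebesgue_rV n]_y f (cons_rV (a, y)).
Proof.
move=> mf f0.
have mc := @measurable_cons_rV R n.
rewrite (eq_measure_integral (pushforward (lam \x lebesgue_rV n) (@cons_rV R n)))//.
rewrite ge0_integral_pushforward// preimage_setT fubini_tonelli1//=.
exact: measurableT_comp.
Qed.

Lemma ge0_integral_rVS_swap n (f : 'rV[R]_n.+1 -> \bar R) :
  measurable_fun setT f -> (forall x, 0 <= f x) ->
  \int[lebesgue_rV n.+1]_x f x =
  \int[lebesgue_rV n]_y \int[lam]_a f (cons_rV (a, y)).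
Proof.
move=> mf f0; rewrite ge0_integral_rVS//.
rewrite (fubini_tonelli (m1 := lam) (m2 := lebesgue_rV n) (fun z => f (cons_rV z)))//.
exact: measurableT_comp (@measurable_cons_rV R n).
Qed.

Lemma update_cons0 n (a : R) (y : 'rV[R]_n) r :
  update (cons_rV (a, y)) ord0 r = cons_rV (r, y).
Proof.
apply/rowP => j; rewrite !mxE; case: eqP => [->|]; first by rewrite unlift_none.
by case: unliftP => // ->.
Qed.

Lemma update_consS n (a : R) (y : 'rV[R]_n) i r :
  update (cons_rV (a, y)) (lift ord0 i) r = cons_rV (a, update y i r).
Proof.
apply/rowP => j; rewrite !mxE; case: (unliftP ord0 j) => [k ->|->]/=.
  by rewrite (inj_eq lift_inj) mxE.
by rewrite ?unlift_none.
Qed.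

Lemma cons_rV0 n (a : R) (y : 'rV[R]_n) : cons_rV (a, y) ord0 ord0 = a.
Proof. by rewrite mxE unlift_none. Qed.

Lemma cons_rVS n (a : R) (y : 'rV[R]_n) i : cons_rV (a, y) ord0 (lift ord0 i) = y ord0 i.
Proof. by rewrite mxE liftK. Qed.

Lemma measurable_cons_rV_r n (a : R) :
  measurable_fun setT (fun y : 'rV[R]_n => cons_rV (a, y)).
Proof.
apply: (@measurableT_comp _ _ _ _ _ _ (@cons_rV R n)); first exact: measurable_cons_rV.
exact: measurable_pair1.
Qed.

(** Exchanging the value r with the i-th coordinate of x preserves the measure
    dx dr. Induction on the dimension: the recursive definition of the measure
    singles out coordinate 0, for which this is Tonelli's theorem. *)
Lemma ge0_integral_update n (i : 'I_n) (h : 'rV[R]_n * measurableTypeR R -> \bar R) :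
  measurable_fun setT h -> (forall z, 0 <= h z) ->
  \int[lebesgue_rV n]_x \int[lam]_r h (x, r) =
  \int[lebesgue_rV n]_x \int[lam]_r h (update x i r, x ord0 i).
Proof.
elim: n i h => [|n IH] i h mh h0; first by case: i mh h0.
have mu1 (g : 'rV[R]_n.+1 * measurableTypeR R -> \bar R) : measurable_fun setT g ->
    (forall z, 0 <= g z) ->
    measurable_fun setT (fun x : 'rV[R]_n.+1 => \int[lam]_r g (x, r)).
  by move=> mg g0; exact: measurable_fun_fubini_tonelli_F.
have mh2 : measurable_fun setT (fun z : 'rV[R]_n.+1 * measurableTypeR R =>
    h (update z.1 i z.2, z.1 ord0 i)).
  apply: (measurableT_comp mh); apply: measurable_fun_pair; first exact: measurable_update.
  apply: (@measurableT_comp _ _ _ _ _ _ (fun x : 'rV[R]_n.+1 => x ord0 i)) => //.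
  exact: measurable_coordR.
rewrite ge0_integral_rVS//; [|exact: mu1|by move=> x; exact: integral_ge0].
have mu2 := mu1 (fun z => h (update z.1 i z.2, z.1 ord0 i)) mh2 (fun z => h0 _).
rewrite (ge0_integral_rVS (f := fun x => \int[lam]_r h (update x i r, x ord0 i)));
  [|exact: mu2|by move=> x; exact: integral_ge0].
clear mu1 mu2 mh2.
have mcons d' (T' : measurableType d') (f : T' -> measurableTypeR R) (g : T' -> 'rV[R]_n) :
    measurable_fun setT f -> measurable_fun setT g ->
    measurable_fun setT (fun z => cons_rV (f z, g z)).
  by move=> mf mg; apply: (measurableT_comp (@measurable_cons_rV R n)); exact: measurable_fun_pair.
case: (unliftP ord0 i) => [j|] ->.
  apply: eq_integral => a _.
  rewrite (IH j (fun z => h (cons_rV (a, z.1), z.2))); last by move=> z; exact: h0.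
    apply: eq_integral => y _; apply: eq_integral => r _.
    by rewrite update_consS cons_rVS.
  apply: (measurableT_comp mh); apply: measurable_fun_pair => //.
  by apply: mcons => //; exact: measurable_cst.
under [in RHS]eq_integral do under eq_integral do under eq_integral
  do rewrite update_cons0 cons_rV0.
pose k (z : (measurableTypeR R) * 'rV[R]_n) := \int[lam]_r h (cons_rV z, r).
have mk : measurable_fun setT k.
  rewrite /k; apply: (measurable_fun_fubini_tonelli_F
    (fun w : ((measurableTypeR R) * 'rV[R]_n) * measurableTypeR R => h (cons_rV w.1, w.2))) => //.
  apply: (measurableT_comp mh); apply: measurable_fun_pair => //.
  by apply: (measurableT_comp (@measurable_cons_rV R n)).
have k0 z : 0 <= k z by exact: integral_ge0.
have El := fubini_tonelli (m1 := lam) (m2 := lebesgue_rV n) k mk k0.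
pose k' (z : (measurableTypeR R) * 'rV[R]_n) := \int[lam]_r h (cons_rV (r, z.2), z.1).
have mk' : measurable_fun setT k'.
  apply: (measurable_fun_fubini_tonelli_F
    (fun w : ((measurableTypeR R) * 'rV[R]_n) * measurableTypeR R => h (cons_rV (w.2, w.1.2), w.1.1))) => //.
  apply: (measurableT_comp mh); apply: measurable_fun_pair.
    by apply: mcons => //; exact: measurableT_comp.
  exact: measurableT_comp.
have k'0 z : 0 <= k' z by exact: integral_ge0.
have Er := fubini_tonelli (m1 := lam) (m2 := lebesgue_rV n) k' mk' k'0.
apply: (etrans El); apply: (etrans _ (esym Er)).
apply: eq_integral => y _.
apply: (fubini_tonelli (m1 := lam) (m2 := lam)
  (fun z : measurableTypeR R * measurableTypeR R => h (cons_rV (z.1, y), z.2))) => //.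
apply: (measurableT_comp mh); apply: measurable_fun_pair => //.
by apply: mcons => //; exact: measurable_cst.
Qed.

End integral_rV.

(** * The Loomis-Whitney inequality *)

Section loomis_whitney.
Context {R : realType}.
Local Open Scope ereal_scope.
Local Notation lam := (@lebesgue_measure R).

Definition line_integral n (i : 'I_n) (h : 'rV[R]_n -> \bar R) (x : 'rV[R]_n) : \bar R :=
  \int[lam]_r h (update x i r).

Lemma line_integral_ge0 n i (h : 'rV[R]_n -> \bar R) x :
  (forall x, 0 <= h x) -> 0 <= line_integral i h x.
Proof. by move=> h0; exact: integral_ge0. Qed.

Lemma measurable_line_integral n i (h : 'rV[R]_n -> \bar R) :
  measurable_fun setT h -> (forall x, 0 <= h x) ->
  measurable_fun setT (line_integral i h).
Proof.
move=> mh h0; apply: (measurable_fun_fubini_tonelli_F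
  (fun z : 'rV[R]_n * measurableTypeR R => h (update z.1 i z.2))) => //.
by apply: (measurableT_comp mh); exact: measurable_update.
Qed.

Lemma measurable_prode d (T : measurableType d) n (f : 'I_n -> T -> \bar R) :
  (forall i, measurable_fun setT (f i)) -> measurable_fun setT (fun x => \prod_(i < n) f i x).
Proof.
move=> mf; have : forall s : seq 'I_n, measurable_fun [set: T] (fun x => \prod_(i <- s) f i x).
  elim=> [|i s IHs]; first by under eq_fun do rewrite big_nil; exact: measurable_cst.
  by under eq_fun do rewrite big_cons; apply: emeasurable_funM.
by apply.
Qed.

Lemma emeasurable_funX d (T : measurableType d) (f : T -> \bar R) (a : R) :
  measurable_fun setT f -> measurable_fun setT (fun x => f x `^ a).
Proof.
by move=> mf; apply: (@measurableT_comp _ _ _ _ _ _ (fun x => x `^ a)) => //; exact: measurable_poweR.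
Qed.

Lemma poweR_prod n (f : 'I_n -> \bar R) (a : R) : (forall i, 0 <= f i) ->
  \prod_(i < n) f i `^ a = (\prod_(i < n) f i) `^ a.
Proof.
move=> f0; suff [] : 0 <= \prod_(i < n) f i /\
  \prod_(i < n) f i `^ a = (\prod_(i < n) f i) `^ a by [].
apply: (big_ind2 (fun u v : \bar R => 0 <= v /\ u = v `^ a)).
- by rewrite poweR1r.
- by move=> u1 v1 u2 v2 [? ->] [? ->]; rewrite mule_ge0// poweRM.
- by [].
Qed.

Lemma lee_poweR2r (a : R) (x y : \bar R) : (0 <= a)%R -> 0 <= x -> x <= y -> x `^ a <= y `^ a.
Proof.
move=> a0 x0 xy; apply: gt0_ler_poweR => //; rewrite in_itv/= leey andbT//.
exact: le_trans xy.
Qed.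

(** The form of the inequality used by Gagliardo. Freezing coordinate 0 leaves
    one factor that does not depend on it; Hoelder in the other coordinates
    separates that factor and the induction hypothesis treats the rest, after
    which the generalized Hoelder inequality is applied in coordinate 0. *)
Lemma loomis_whitney n (h : 'I_n.+2 -> 'rV[R]_n.+2 -> \bar R) :
  (forall i, measurable_fun setT (h i)) -> (forall i x, 0 <= h i x) ->
  \int[lebesgue_rV n.+2]_x (\prod_(i < n.+2) line_integral i (h i) x `^ (n.+1%:R^-1)) <=
  \prod_(i < n.+2) (\int[lebesgue_rV n.+2]_x h i x) `^ (n.+1%:R^-1).
Proof.
elim: n h => [|n IH] h mh h0.
  rewrite !big_ord_recl !big_ord0 !mule1 invr1.
  under eq_integral do rewrite !big_ord_recl !big_ord0 !mule1 !poweRe1 ?line_integral_ge0//.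
  rewrite !poweRe1 ?integral_ge0//.
  rewrite [X in X <= _]ge0_integral_rVS; last 2 first.
  - by apply: emeasurable_funM; exact: measurable_line_integral.
  - by move=> x; rewrite mule_ge0 ?line_integral_ge0.
  have L0 a (y : 'rV_1) : line_integral ord0 (h ord0) (cons_rV (a, y)) =
      \int[lam]_r h ord0 (cons_rV (r, y)).
    by apply: eq_integral => r _; rewrite update_cons0.
  have L1 a (y : 'rV_1) : line_integral (lift ord0 ord0) (h (lift ord0 ord0)) (cons_rV (a, y)) =
      \int[lebesgue_rV 1]_z h (lift ord0 ord0) (cons_rV (a, z)).
    rewrite ge0_integral_rVS//; last first.
      by apply: (measurableT_comp (mh _)); exact: measurable_cons_rV_r.
    apply: eq_integral => r _; rewrite update_consS.
    rewrite integral_dirac//; last first.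
      apply: (measurableT_comp (mh _)).
      apply: (measurableT_comp (@measurable_cons_rV_r R 1 a)).
      exact: measurable_cons_rV_r.
    rewrite diracE mem_set// mul1e; congr (h _ (cons_rV (a, _))).
    by apply/rowP => j; rewrite !mxE !ord1 unlift_none.
  under eq_integral do under eq_integral do rewrite L0 L1.
  have mH : measurable_fun setT (fun y : 'rV[R]_1 => \int[lam]_r h ord0 (cons_rV (r, y))).
    apply: (measurable_fun_fubini_tonelli_F
      (fun z : 'rV[R]_1 * measurableTypeR R => h ord0 (cons_rV (z.2, z.1)))) => //.
    apply: (measurableT_comp (mh _)); apply: (measurableT_comp (@measurable_cons_rV R 1)).
    exact: measurable_fun_pair.
  have H0 (y : 'rV[R]_1) : 0 <= \int[lam]_r h ord0 (cons_rV (r, y)) by exact: integral_ge0.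
  have mK : measurable_fun setT (fun a : measurableTypeR R =>
      \int[lebesgue_rV 1]_z h (lift ord0 ord0) (cons_rV (a, z))).
    apply: (measurable_fun_fubini_tonelli_F
       (fun z : measurableTypeR R * 'rV[R]_1 => h (lift ord0 ord0) (cons_rV z))) => //.
    by apply: (measurableT_comp (mh _)); exact: measurable_cons_rV.
  have K0 a : 0 <= \int[lebesgue_rV 1]_z h (lift ord0 ord0) (cons_rV (a, z)).
    exact: integral_ge0.
  have E a : \int[lebesgue_rV 1]_y ((\int[lam]_r h ord0 (cons_rV (r, y))) *
      \int[lebesgue_rV 1]_z h (lift ord0 ord0) (cons_rV (a, z))) =
      (\int[lebesgue_rV 1]_y (\int[lam]_r h ord0 (cons_rV (r, y)))) *
      \int[lebesgue_rV 1]_z h (lift ord0 ord0) (cons_rV (a, z)).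
    exact: ge0_integralZr.
  under eq_integral do rewrite E.
  rewrite ge0_integralZl//; last by apply: integral_ge0 => y _; exact: H0.
  by rewrite -ge0_integral_rVS_swap// -ge0_integral_rVS.
pose t : R := (n.+2%:R^-1)%R.
have t0 : (0 < t)%R by rewrite invr_gt0.
pose e : R := (1 - t)%R.
have e0 : (0 < e)%R by rewrite subr_gt0 invf_lt1// ltr1n.
have te : (n.+1%:R^-1 * e = t)%R.
  have : (0 < n.+1%:R :> R)%R by [].
  rewrite /e /t -(natr1 n.+1); move: (n.+1%:R) => N N0; field.
  by rewrite !gt_eqF ?addr_gt0.
pose H0 (y : 'rV[R]_n.+2) := \int[lam]_r h ord0 (cons_rV (r, y)).
pose g (a : R) (i : 'I_n.+2) (y : 'rV[R]_n.+2) := h (lift ord0 i) (cons_rV (a, y)).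
have mg a i : measurable_fun setT (g a i).
  by apply: (measurableT_comp (mh _)); exact: measurable_cons_rV_r.
have g0 a i y : 0 <= g a i y by exact: h0.
have mH0 : measurable_fun setT H0.
  apply: (measurable_fun_fubini_tonelli_F
        (fun z : 'rV[R]_n.+2 * measurableTypeR R => h ord0 (cons_rV (z.2, z.1)))) => //.
  apply: (measurableT_comp (mh _)); apply: (measurableT_comp (@measurable_cons_rV R n.+2)).
  exact: measurable_fun_pair.
have H00 y : 0 <= H0 y by exact: integral_ge0.
rewrite [X in X <= _]ge0_integral_rVS; last 2 first.
- by apply: measurable_prode => i; apply: emeasurable_funX; exact: measurable_line_integral.
- by move=> x; apply: prode_ge0 => i _; exact: poweR_ge0.
apply: (@le_trans _ _ (\int[lam]_a ((\int[lebesgue_rV n.+2]_y H0 y) `^ t *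
    \prod_(i < n.+2) (\int[lebesgue_rV n.+2]_y g a i y) `^ t))).
  apply: ge0_le_integral_nm => a _.
    by apply: integral_ge0 => y _; apply: prode_ge0 => i _; exact: poweR_ge0.
  have E y : \prod_(i < n.+3) line_integral i (h i) (cons_rV (a, y)) `^ t =
      H0 y `^ t * (\prod_(i < n.+2) line_integral i (g a i) y `^ n.+1%:R^-1) `^ e.
    rewrite big_ord_recl; congr (_ `^ _ * _).
      by apply: eq_integral => r _; rewrite update_cons0.
    rewrite -poweR_prod; last by move=> i; exact: poweR_ge0.
    apply: eq_bigr => i _; rewrite -poweRrM te; congr (_ `^ _).
    by apply: eq_integral => r _; rewrite update_consS.
  under eq_integral do rewrite E.
  apply: (le_trans (hoelder_ereal _ _ _ _ _ _ _ _)) => //.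
  - by move=> y; apply: prode_ge0 => i _; exact: poweR_ge0.
  - by apply: measurable_prode => i; apply: emeasurable_funX; exact: measurable_line_integral.
  - by rewrite /e addrC subrK.
  apply: lee_pmul; rewrite ?poweR_ge0//.
  apply: (@le_trans _ _ ((\prod_(i < n.+2) (\int[lebesgue_rV n.+2]_y g a i y) `^ n.+1%:R^-1) `^ e)).
    apply: lee_poweR2r; first exact: ltW.
      by apply: integral_ge0 => y _; apply: prode_ge0 => i _; exact: poweR_ge0.
    exact: IH.
  rewrite -poweR_prod; last by move=> i; exact: poweR_ge0.
  by under eq_bigr do rewrite -poweRrM te.
have mG i : measurable_fun setT (fun a => \int[lebesgue_rV n.+2]_y g a i y).
  apply: (measurable_fun_fubini_tonelli_F
       (fun z : measurableTypeR R * 'rV[R]_n.+2 => h (lift ord0 i) (cons_rV z))) => //.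
  by apply: (measurableT_comp (mh _)); exact: measurable_cons_rV.
rewrite ge0_integralZl//; last 3 first.
- by apply: measurable_prode => i; apply: emeasurable_funX; exact: mG.
- by move=> a _; apply: prode_ge0 => i _; exact: poweR_ge0.
- exact: poweR_ge0.
rewrite [leRHS]big_ord_recl; apply: lee_pmul; rewrite ?poweR_ge0//.
- by apply: integral_ge0 => a _; apply: prode_ge0 => i _; exact: poweR_ge0.
- by rewrite /H0 -ge0_integral_rVS_swap.
apply: (le_trans (hoelder_prod _ _ _ _ _)) => //.
- by move=> i a; exact: integral_ge0.
- by rewrite sumr_const card_ord -mulr_natr mulVf ?pnatr_eq0.
have E' i : \int[lam]_a \int[lebesgue_rV n.+2]_y g a i y = \int[lebesgue_rV n.+3]_x h (lift ord0 i) x.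
  by rewrite [RHS]ge0_integral_rVS.
by under eq_bigr do rewrite E'.
Qed.

End loomis_whitney.

(** * Troisi's anisotropic Sobolev inequality *)

Lemma powR_prodD (R : realType) n (x : R) (a : 'I_n.+1 -> R) :
  (forall i, 0 < a i) -> \prod_(i < n.+1) x `^ a i = x `^ (\sum_(i < n.+1) a i).
Proof.
move=> a0; elim: n a a0 => [|n IH] a a0; first by rewrite !big_ord_recl !big_ord0 mulr1 addr0.
rewrite big_ord_recl IH// [in RHS]big_ord_recl -powRD//.
rewrite gt_eqF//; apply: ltr_pwDl => //.
by apply: sumr_ge0 => i _; exact: ltW.
Qed.

Lemma powR_prod (R : realType) n (f : 'I_n -> R) (a : R) : (forall i, 0 <= f i) ->
  \prod_(i < n) f i `^ a = (\prod_(i < n) f i) `^ a.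
Proof.
move=> f0; suff [] : 0 <= \prod_(i < n) f i /\
  \prod_(i < n) f i `^ a = (\prod_(i < n) f i) `^ a by [].
apply: (big_ind2 (fun u v : R => 0 <= v /\ u = v `^ a)).
- by rewrite powR1.
- by move=> u1 v1 u2 v2 [? ->] [? ->]; rewrite mulr_ge0// powRM.
- by [].
Qed.

Lemma lee_prode n (R : realType) (f g : 'I_n -> \bar R) :
  (forall i, 0 <= f i)%E -> (forall i, f i <= g i)%E ->
  (\prod_(i < n) f i <= \prod_(i < n) g i)%E.
Proof.
move=> f0 fg; suff [] : (0 <= \prod_(i < n) f i /\ \prod_(i < n) f i <= \prod_(i < n) g i)%E by [].
apply: (big_ind2 (fun u v : \bar R => 0 <= u /\ u <= v)%E) => //.
by move=> u1 v1 u2 v2 [? ?] [? ?]; rewrite mule_ge0// lee_pmul.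
Qed.

Section troisi.
Context {R : realType} {n : nat}.
Variable p : 'I_n.+2 -> R.
Hypothesis p1 : forall i, 1 < p i.
Let N : R := n.+2%:R.
Let pb : R := mean_exponent p.
Hypothesis pbN : pb < N.

Lemma sum_inv_exponent : \sum_(i < n.+2) (p i)^-1 = N / pb.
Proof. by rewrite /pb /mean_exponent invrK mulrA mulfV ?mul1r// /N pnatr_eq0. Qed.

Lemma mean_exponent_gt0 : 0 < pb.
Proof.
rewrite /pb /mean_exponent invr_gt0 mulr_gt0 ?invr_gt0//.
rewrite big_ord_recl; apply: ltr_wpDr; last by rewrite invr_gt0 (lt_trans _ (p1 _)).
by apply: sumr_ge0 => i _; rewrite invr_ge0 ltW// (lt_trans _ (p1 _)).
Qed.

Definition sobolev_conjugate : R := N * pb / (N - pb).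
Local Notation q := sobolev_conjugate.

Lemma sobolev_conjugate_gt0 : 0 < q.
Proof.
have pb0 := mean_exponent_gt0.
by rewrite /q divr_gt0 ?subr_gt0// mulr_gt0// /N.
Qed.

(** The power of m that is followed along lines in direction i, chosen so that
    m `^ (s i - 1), raised to the conjugate exponent of p i, is m `^ q. *)
Definition gagliardo_exponent (i : 'I_n.+2) : R := 1 + q * (1 - (p i)^-1).
Local Notation s := gagliardo_exponent.

Let pi0 i : 0 < p i. Proof. exact: lt_trans (p1 i). Qed.
Let e0 i : 0 < 1 - (p i)^-1. Proof. by rewrite subr_gt0 invf_lt1. Qed.

Lemma gagliardo_exponent_gt1 i : 1 < s i.
Proof. by rewrite /s ltrDl mulr_gt0// sobolev_conjugate_gt0. Qed.

(** This is what turns the product of the n one-dimensional estimates, each to the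
    power 1 / (n - 1), into the single power q of m. *)
Lemma sum_gagliardo_exponent : \sum_(i < n.+2) s i = n.+1%:R * q.
Proof.
rewrite /s big_split/= -mulr_sumr sumrB sum_inv_exponent !sumr_const card_ord.
have pb0 := mean_exponent_gt0.
have NE : n.+1%:R = N - 1 :> R by rewrite /N -(natr1 n.+1) addrK.
rewrite NE -/N /q.
have d0 : N - pb != 0 by rewrite gt_eqF// subr_gt0.
have d1 : pb != 0 by rewrite gt_eqF.
by field; rewrite -natrD d1 andbT; exact: d0.
Qed.

Definition troisi_constant : R := (\prod_(i < n.+2) s i) `^ (pb / N).

Lemma troisi_constant_gt0 : 0 < troisi_constant.
Proof.
apply: powR_gt0; apply: prodr_gt0 => i _.
exact: lt_trans (gagliardo_exponent_gt1 i).
Qed.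

Local Open Scope ereal_scope.

(** The hypothesis is the one-dimensional estimate of m `^ s i by an integral
    along almost every line in direction i, so neither a derivative nor a boundary
    condition appears. Multiplying the n estimates, Loomis-Whitney bounds the
    integral X of m `^ q by the integrals of m `^ (s i - 1) w i, which Hoelder
    splits into a power of X and the integral of w i `^ p i; the power of X is
    absorbed on the left, X being finite because m and the measure of B are. *)
Lemma troisi_inequality (B : set 'rV[R]_n.+2) (m : 'rV[R]_n.+2 -> R)
    (w : 'I_n.+2 -> 'rV[R]_n.+2 -> R) :
  measurable B -> lebesgue_rV n.+2 B < +oo ->
  measurable_fun setT m -> (forall i, measurable_fun setT (w i)) ->
  (forall x, (0 <= m x)%R) -> (forall i x, (0 <= w i x)%R) ->
  (exists M, forall x, (m x <= M)%R) ->
  (forall i, \forall x \ae lebesgue_rV n.+2, B x -> (m x `^ s i)%:E <=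
     line_integral i (fun y => (s i * (m y `^ (s i - 1) * w i y) * \1_B y)%:E) x) ->
  (\int[lebesgue_rV n.+2]_(x in B) (m x `^ q)%:E) `^ ((N - pb) / N) <=
  troisi_constant%:E * \prod_(i < n.+2)
    (\int[lebesgue_rV n.+2]_(x in B) (w i x `^ p i)%:E) `^ (pb / (N * p i)).
Proof.
move=> mB Bfin mm mw m0 w0 [M mM] hyp.
have pb0 := mean_exponent_gt0. have q0 := sobolev_conjugate_gt0.
have s1 := gagliardo_exponent_gt1.
have N0 : (0 < N)%R by [].
have mXr (f : 'rV[R]_n.+2 -> R) a : measurable_fun setT f ->
    measurable_fun setT (fun x => f x `^ a)%R.
  by move=> mf; exact: (@measurableT_comp _ _ _ _ _ _ (@powR R ^~ a)).
have mI : measurable_fun [set: 'rV[R]_n.+2] (\1_B : _ -> R) by exact: measurable_indic.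
pose h i (y : 'rV[R]_n.+2) := (s i * (m y `^ (s i - 1) * w i y) * \1_B y)%:E.
have mh i : measurable_fun setT (h i).
  apply/measurable_EFinP; apply: measurable_funM => //.
  apply: measurable_funM; first exact: measurable_cst.
  by apply: measurable_funM => //; exact: mXr.
have h0 i y : 0 <= h i y.
  rewrite lee_fin mulr_ge0// mulr_ge0//; first by rewrite ltW// (lt_trans _ (s1 i)).
  by rewrite mulr_ge0// powR_ge0.
pose X := \int[lebesgue_rV n.+2]_(x in B) (m x `^ q)%:E.
pose A i := \int[lebesgue_rV n.+2]_(x in B) (w i x `^ p i)%:E.
rewrite -/X.
have X0 : 0 <= X by apply: integral_ge0 => x _; rewrite lee_fin powR_ge0.
have A0 i : 0 <= A i by apply: integral_ge0 => x _; rewrite lee_fin powR_ge0.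
have Xfin : X < +oo.
  apply: (@le_lt_trans _ _ (\int[lebesgue_rV n.+2]_(x in B) (cst (`|M| `^ q)%:E x))).
    apply: ge0_le_integral_nm => x _; rewrite lee_fin ?powR_ge0//.
    apply: ge0_ler_powR; rewrite ?nnegrE//; first exact: ltW.
    exact: le_trans (mM x) (ler_norm _).
  by rewrite integral_cst// lte_mul_pinfty// ?lee_fin ?powR_ge0// ltry.
pose th : R := (n.+1%:R^-1)%R.
have th0 : (0 < th)%R by rewrite invr_gt0.
(* Loomis-Whitney applied to the line estimates *)
have LW : X <= \prod_(i < n.+2) (\int[lebesgue_rV n.+2]_x h i x) `^ th.
  apply: le_trans (loomis_whitney mh h0).
  apply: ge0_ae_le_integral_nm.
  - by move=> x _; rewrite lee_fin powR_ge0.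
  - by move=> x _; apply: prode_ge0 => i _; exact: poweR_ge0.
  apply: filterS (filter_forall _ hyp) => x Hx.
  rewrite patch_setT patchE; case: ifPn => [/set_mem Bx|_]; last first.
    by apply: prode_ge0 => i _; exact: poweR_ge0.
  have -> : (m x `^ q)%:E = \prod_(i < n.+2) ((m x `^ s i)%:E `^ th).
    have -> : q = (\sum_(i < n.+2) s i * th)%R.
      by rewrite -mulr_suml sum_gagliardo_exponent mulrAC mulfV ?mul1r ?pnatr_eq0.
    rewrite -powR_prodD; last by move=> i; rewrite mulr_gt0// (lt_trans _ (s1 i)).
    rewrite -prodEFin; apply: eq_bigr => i _.
    by rewrite poweR_EFin powRrM.
  apply: lee_prode => i; first exact: poweR_ge0.
  apply: lee_poweR2r; [exact: ltW|by rewrite lee_fin powR_ge0|exact: Hx].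
have H i : \int[lebesgue_rV n.+2]_x h i x <=
    (s i)%:E * (X `^ (1 - (p i)^-1) * A i `^ (p i)^-1).
  rewrite /X /A (integral_mul_indic _ B (fun x => m x `^ q)%R).
  rewrite (integral_mul_indic _ B (fun x => w i x `^ p i)%R).
  pose f x := (m x `^ q * \1_B x)%:E; pose g x := (w i x `^ p i * \1_B x)%:E.
  have mf : measurable_fun setT f.
    by apply/measurable_EFinP; apply: measurable_funM => //; exact: mXr.
  have mg : measurable_fun setT g.
    by apply/measurable_EFinP; apply: measurable_funM => //; exact: mXr.
  have f0 x : 0 <= f x by rewrite lee_fin mulr_ge0 ?powR_ge0.
  have g0 x : 0 <= g x by rewrite lee_fin mulr_ge0 ?powR_ge0.
  have -> : h i = fun x => (s i)%:E * (f x `^ (1 - (p i)^-1) * g x `^ (p i)^-1).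
    apply/funext => x; rewrite /h /f /g indicE; case: (x \in B); last first.
      by rewrite !mulr0 poweR0r ?gt_eqF// mul0e mule0.
    rewrite !mulr1 !poweR_EFin -!powRrM -!EFinM mulfV ?gt_eqF// powRr1//.
    by rewrite /s addrAC subrr add0r.
  have mfg : measurable_fun setT (fun x => f x `^ (1 - (p i)^-1) * g x `^ (p i)^-1).
    by apply: emeasurable_funM; [exact: (emeasurable_funX _ mf)|exact: (emeasurable_funX _ mg)].
  rewrite ge0_integralZl//; last 2 first.
  - by move=> x _; rewrite mule_ge0 ?poweR_ge0.
  - by rewrite lee_fin ltW// (lt_trans _ (s1 i)).
  apply: lee_pmul => //.
  - by rewrite lee_fin ltW// (lt_trans _ (s1 i)).
  - by apply: integral_ge0 => x _; rewrite mule_ge0 ?poweR_ge0.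
  - by apply: hoelder_ereal => //; rewrite ?invr_gt0// subrK.
have {H} LW2 : X <= \prod_(i < n.+2) ((s i)%:E * (X `^ (1 - (p i)^-1) * A i `^ (p i)^-1)) `^ th.
  apply: (le_trans LW); apply: lee_prode => i; first exact: poweR_ge0.
  by apply: lee_poweR2r; [exact: ltW|exact: integral_ge0|exact: H].
have [XE|X_neq0] := eqVneq X 0.
  rewrite XE poweR0r; last by rewrite mulf_neq0 ?invr_eq0 ?gt_eqF// subr_gt0.
  apply: mule_ge0; first by rewrite lee_fin ltW// troisi_constant_gt0.
  by apply: prode_ge0 => i _; exact: poweR_ge0.
have [x XE] : exists x, X = x%:E.
  by exists (fine X); rewrite fineK// ge0_fin_numE.
have x0 : (0 < x)%R by rewrite -lte_fin -XE lt0e X_neq0.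
rewrite XE in LW2 *.
pose c : R := (\prod_(i < n.+2) (s i * x `^ (1 - (p i)^-1)) `^ th)%R.
have si0 i : (0 < s i)%R by rewrite (lt_trans _ (s1 i)).
have c0 : (0 < c)%R.
  by apply: prodr_gt0 => i _; apply: powR_gt0; rewrite mulr_gt0// powR_gt0.
have LW3 : x%:E <= c%:E * \prod_(i < n.+2) (A i `^ (p i)^-1) `^ th.
  apply: (le_trans LW2); rewrite /c -prodEFin -big_split/=.
  apply: lee_prode => i; first exact: poweR_ge0.
  by rewrite muleA ?poweR_EFin -EFinM poweRM ?poweR_ge0// lee_fin mulr_ge0// ?powR_ge0// ltW.
(* the exponent that turns the weights th / p i into pb / (N p i) *)
pose be : R := (pb / (N * th))%R.
have be0 : (0 < be)%R by rewrite divr_gt0// mulr_gt0.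
have P0 : 0 <= \prod_(i < n.+2) (A i `^ (p i)^-1) `^ th.
  by apply: prode_ge0 => i _; exact: poweR_ge0.
have LW4 : (x / c)%:E `^ be <= \prod_(i < n.+2) A i `^ (pb / (N * p i)).
  have -> : \prod_(i < n.+2) A i `^ (pb / (N * p i)) =
      (\prod_(i < n.+2) (A i `^ (p i)^-1) `^ th) `^ be.
    rewrite -poweR_prod; last by move=> i; exact: poweR_ge0.
    apply: eq_bigr => i _; rewrite -!poweRrM; congr (_ `^ _).
    by rewrite /be; field; rewrite !gt_eqF//.
  apply: lee_poweR2r; [exact: ltW|by rewrite lee_fin divr_ge0 ?ltW|].
  by rewrite mulrC EFinM lee_pdivrMl.
apply: (@le_trans _ _ (troisi_constant%:E * (x / c)%:E `^ be)); last first.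
  apply: lee_pmul => //; first by rewrite lee_fin ltW// troisi_constant_gt0.
  exact: poweR_ge0.
rewrite !poweR_EFin -EFinM lee_fin /troisi_constant -/N -/pb.
pose S := (\prod_(i < n.+2) s i)%R.
have S0 : (0 < S)%R by apply: prodr_gt0.
have -> : c = (S `^ th * x `^ (th * (N - N / pb)))%R.
  rewrite /c; under eq_bigr do rewrite powRM ?powR_ge0 ?(ltW (si0 _))// -powRrM.
  rewrite big_split/=; congr (_ * _)%R.
    by rewrite powR_prod// => i; exact: ltW.
  rewrite powR_prodD; last by move=> i; rewrite mulr_gt0.
  congr (_ `^ _)%R; rewrite -mulr_suml mulrC; congr (_ * _)%R.
  by rewrite sumrB sum_inv_exponent sumr_const card_ord.
have xe0 e : (0 < x `^ e)%R by exact: powR_gt0.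
have Se0 e : (0 < S `^ e)%R by exact: powR_gt0.
pose e : R := (th * (N - N / pb))%R.
have -> : (x / (S `^ th * x `^ e) = S `^ (- th) * x `^ (1 - e))%R.
  rewrite powRB; last by rewrite (gt_eqF x0) implybT.
  rewrite powRr1 ?(ltW x0)// powRN invfM.
  by rewrite mulrCA.
rewrite powRM ?powR_ge0// -!powRrM mulrA -powRD; last by rewrite (gt_eqF S0) implybT.
have -> : (pb / N + - th * be = 0)%R.
  by rewrite /be; field; rewrite !gt_eqF.
rewrite powRr0 mul1r.
have -> // : ((1 - e) * be = (N - pb) / N)%R.
have NE : (n.+1%:R = N - 1 :> R)%R by rewrite /N -(natr1 n.+1) addrK.
have N1 : (N - 1 != 0)%R by rewrite -NE pnatr_eq0.
rewrite /e /be /th NE; move: (N) N0 N1 => M' M0 M1.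
by field; rewrite M1 !gt_eqF.
Qed.

End troisi.

(** * The one-dimensional estimate on a line *)

Section powR_estimates.
Context {R : realType}.
Implicit Types a b s y : R.

(** Convexity of the power function, in the form given by Young's inequality for
    a `^ (s - 1) * b; it replaces the chain rule. *)
Lemma powR_sub_le a b s : 1 < s -> 0 <= a -> 0 <= b ->
  a `^ s - b `^ s <= s * a `^ (s - 1) * (a - b).
Proof.
move=> s1 a0 b0; have s0 : 0 < s by exact: lt_trans s1.
have sp : 0 < 1 - s^-1 by rewrite subr_gt0 invf_lt1.
have := @conjugate_powR R (a `^ (s - 1)) b (1 - s^-1)^-1 s (powR_ge0 _ _) b0.
rewrite invr_gt0 sp s0 invrK subrK => /(_ isT isT erefl).
rewrite -powRrM (_ : (s - 1) * (1 - s^-1)^-1 = s); last first.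
  by field; rewrite !gt_eqF//; lra.
have -> : a `^ s = a `^ (s - 1) * a by rewrite mulrC mulr_powRB1.
set A := a `^ (s - 1) => H.
rewrite -[leRHS]mulrA -ler_pdivrMl//.
have -> : s^-1 * (A * a - b `^ s) = A * (a - b) + (A * b - (A * a * (1 - s^-1) + b `^ s / s)).
  by ring.
by rewrite gerDl subr_le0.
Qed.

(** Subadditivity of the power when th <= 1, the mean value bound when th > 1. *)
Lemma powR_uniform_cont th M e : 0 < th -> 0 <= M -> 0 < e ->
  exists2 h, 0 < h & forall y, 0 <= y <= M -> (y + h) `^ th <= y `^ th + e.
Proof.
move=> th0 M0 e0; have [th1|th1] := ltP 1 th; last first.
  exists (e `^ th^-1); first exact: powR_gt0.
  set h := e `^ _ => y /andP[y0 _].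
  have h0 : 0 < h by exact: powR_gt0.
  have he : h `^ th = e by rewrite /h -powRrM mulVf ?gt_eqF// powRr1 // ltW.
  have yh0 : 0 < y + h by rewrite ltr_wpDl.
  have key z : 0 <= z -> z <= y + h -> (y + h) `^ th * (z / (y + h)) <= z `^ th.
    move=> z0 zyh.
    have [->|zn0] := eqVneq z 0; first by rewrite mul0r mulr0 powR_ge0.
    have zp : 0 < z by rewrite lt0r zn0.
    rewrite -[in leRHS](divfK (lt0r_neq0 yh0) z) [in leRHS]powRM ?divr_ge0 ?(ltW yh0)// mulrC.
    apply: ler_wpM2r; first exact: powR_ge0.
    by apply: ger1_powR => //; rewrite divr_gt0//= ler_pdivrMr// mul1r.
  have H1 := key y y0 (ler_wpDr (ltW h0) (lexx y)).
  have H2 := key h (ltW h0) (ler_wpDl y0 (lexx h)).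
  rewrite -he; apply: le_trans (lerD H1 H2).
  by rewrite -mulrDr -mulrDl mulfV ?mulr1// gt_eqF.
pose K := th * (M + 1) `^ (th - 1).
have K0 : 0 < K by rewrite mulr_gt0// powR_gt0// ltr_wpDl.
exists (Num.min 1 (e / K)).
  by rewrite lt_min ltr01 divr_gt0.
move=> y /andP[y0 yM]; set h := Num.min _ _.
have h1 : h <= 1 by rewrite ge_min lexx.
have hK : h <= e / K by rewrite ge_min lexx orbT.
have h0 : 0 <= h by rewrite le_min ler01 divr_ge0// ltW.
rewrite -lerBlDl.
apply: le_trans (powR_sub_le th1 (addr_ge0 y0 h0) y0) _.
rewrite addrAC subrr add0r.
apply: (@le_trans _ _ (K * h)).
  rewrite /K; apply: ler_wpM2r => //; apply: ler_wpM2l; first exact: ltW.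
  apply: ge0_ler_powR; rewrite ?nnegrE ?subr_ge0 ?(ltW th1) ?addr_ge0//.
  exact: lerD.
by rewrite mulrC -ler_pdivlMr.
Qed.

End powR_estimates.

Section line.
Context {R : realType}.
Local Notation lam := (@lebesgue_measure R).
Local Open Scope ereal_scope.
Variables (a b s M : R) (m g : R -> R).
Hypotheses (ab : (a < b)%R) (s1 : (1 < s)%R).
Hypotheses (mm : measurable_fun setT m) (mg : measurable_fun setT g).
Hypotheses (m0 : forall x, (0 <= m x)%R) (mM : forall x, (m x <= M)%R).
Hypothesis (g0 : forall x, (0 <= g x)%R).
Hypothesis gfin : \int[lam]_(x in `]a, b[) (g x)%:E < +oo.
Hypothesis growth : forall x y, (a < x)%R -> (x <= y)%R -> (y < b)%R ->
  (`|m y - m x|%R)%:E <= \int[lam]_(z in `]x, y]) (g z)%:E.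

Let s0 : (0 < s)%R. Proof. exact: lt_trans s1. Qed.

Let mpow h th : measurable_fun setT (fun x => (m x + h) `^ th)%R.
Proof.
apply: (@measurableT_comp _ _ _ _ _ _ (@powR R ^~ th)) => //.
exact: measurable_funD.
Qed.

(** Absolute continuity of the integral of g makes m uniformly continuous. *)
Let uniform (h : R) : (0 < h)%R -> exists2 d : R, (0 < d)%R &
  forall x y, (a < x)%R -> (x <= y)%R -> (y < b)%R -> (y - x < d)%R ->
  (`|m y - m x| <= h)%R.
Proof.
move=> h0; pose f x := (g x * \1_(`]a, b[%classic : set R) x)%R.
have intf : lam.-integrable setT (EFin \o f).
  apply/integrableP; split.
    by apply/measurable_EFinP; apply: measurable_funM => //; exact: measurable_indic.
  have E := integral_mul_indic lam `]a, b[%classic g.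
  apply: (@le_lt_trans _ _ (\int[lam]_(x in `]a, b[) (g x)%:E)) => //.
  apply: (@le_trans _ _ (\int[lam]_x (g x * \1_(`]a, b[%classic : set R) x)%:E)); last by rewrite -E.
  rewrite le_eqVlt; apply/orP; left; apply/eqP.
  by apply: eq_integral => x _; rewrite /= ger0_norm// mulr_ge0.
have [d [d0 Hd]] := integral_normr_continuous intf h0.
exists d => // x y ax xy yb yxd.
have {}Hd : (\int[lam]_(z in `]x, y]) `|f z| < h)%R.
  apply: Hd; first exact: measurable_itv.
  rewrite /= lebesgue_measure_itv/=; case: ifP => _; last by rewrite lte_fin.
  by rewrite -EFinD lte_fin.
have E : \int[lam]_(z in `]x, y]) (g z)%:E = \int[lam]_(z in `]x, y]) (`|f z|)%:E.
  apply: eq_integral => z; rewrite inE/= in_itv/= => /andP[xz zy].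
  rewrite /f indicE mem_set ?mulr1 ?ger0_norm//= in_itv/=.
  by rewrite (lt_trans ax xz) (le_lt_trans zy yb).
apply: ltW; rewrite -lte_fin; apply: (le_lt_trans (growth ax xy yb)).
rewrite E -[ltLHS]fineK ?lte_fin//.
rewrite ge0_fin_numE; last by apply: integral_ge0 => z _; rewrite lee_fin.
rewrite -E; apply: le_lt_trans gfin; apply: ge0_subset_integral_nm.
  by move=> z/=; rewrite !in_itv/= => /andP[xz zy]; rewrite (lt_trans ax xz) (le_lt_trans zy yb).
by move=> z _; rewrite lee_fin.
Qed.

Let integrand h z := (s * ((m z + h) `^ (s - 1) * g z))%:E.

Let integrand0 h z : 0 <= integrand h z.
Proof. by rewrite lee_fin mulr_ge0 ?(ltW s0)// mulr_ge0 ?powR_ge0. Qed.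

Let mintegrand h D : measurable_fun D (integrand h).
Proof.
apply/measurable_EFinP; apply: measurable_funTS; apply: measurable_funM => //.
by apply: measurable_funM => //; exact: mpow.
Qed.

Let itv_add h x y z : (x <= y)%R -> (y <= z)%R ->
  \int[lam]_(w in `]x, z]) integrand h w =
  \int[lam]_(w in `]x, y]) integrand h w + \int[lam]_(w in `]y, z]) integrand h w.
Proof.
move=> xy yz; rewrite -ge0_integral_setU//; last 2 first.
- exact: mintegrand.
- apply/disj_setPS => w/=; rewrite !in_itv/= => -[/andP[_ wy] /andP[yw _]].
  by move: (lt_le_trans yw wy); rewrite ltxx.
by rewrite -itv_bndbnd_setU//= bnd_simp.
Qed.

(** Where m oscillates by at most h, the larger endpoint value of m is at most
    m z + h for every z, so the convexity bound can be moved under the integral. *)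
Let local_step (h : R) x y : (0 < h)%R -> (a < x)%R -> (x <= y)%R -> (y < b)%R ->
  (forall z w, (x <= z <= y)%R -> (x <= w <= y)%R -> (m z <= m w + h)%R) ->
  (`|m y `^ s - m x `^ s|%R)%:E <= \int[lam]_(z in `]x, y]) integrand h z.
Proof.
move=> h0 ax xy yb osc; pose c := Num.max (m x) (m y).
have c0 : (0 <= c)%R by rewrite le_max m0.
have H1 : (`|m y `^ s - m x `^ s| <= s * c `^ (s - 1) * `|m y - m x|)%R.
  have aux u v : (0 <= u -> 0 <= v -> v <= u ->
      `|u `^ s - v `^ s| <= s * (Num.max v u) `^ (s - 1) * `|u - v|)%R.
    move=> u0 v0 vu; rewrite max_r// !ger0_norm ?subr_ge0//.
      exact: powR_sub_le.
    by apply: ge0_ler_powR; rewrite ?nnegrE// ltW.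
  have [xy'|xy'] := leP (m x) (m y); first exact: aux.
  by rewrite distrC (distrC (m y)) /c maxC; apply: aux => //; exact: ltW.
apply: (@le_trans _ _ ((s * c `^ (s - 1))%:E * (`|m y - m x|%R)%:E)).
  by rewrite -EFinM lee_fin.
have k0 : (0 <= s * c `^ (s - 1))%R by rewrite mulr_ge0 ?powR_ge0// ltW.
apply: (@le_trans _ _ ((s * c `^ (s - 1))%:E * \int[lam]_(z in `]x, y]) (g z)%:E)).
  by apply: lee_pmul => //; exact: growth.
rewrite -ge0_integralZl//; last 2 first.
- by apply/measurable_EFinP; exact: measurable_funTS.
- by move=> z _; rewrite lee_fin.
apply: ge0_le_integral_nm => z; first by rewrite -EFinM lee_fin mulr_ge0.
rewrite /= in_itv/= => /andP[xz zy].
rewrite -EFinM lee_fin -mulrA; apply: ler_wpM2l; first exact: ltW.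
apply: ler_wpM2r => //; apply: ge0_ler_powR; rewrite ?nnegrE ?subr_ge0 ?(ltW s1) ?addr_ge0 ?(ltW h0)//.
by rewrite ge_max !osc// ?lexx ?xy ?(ltW xz)//.
Qed.

(** Uniform continuity cuts the segment into pieces on which [local_step] applies;
    the pieces add up. *)
Let chain (h : R) x y : (0 < h)%R -> (a < x)%R -> (x <= y)%R -> (y < b)%R ->
  (`|m y `^ s - m x `^ s|%R)%:E <= \int[lam]_(z in `]x, y]) integrand h z.
Proof.
move=> h0 ax xy yb; have [d d0 Hd] := uniform h0.
have step k : forall u v, (a < u)%R -> (u <= v)%R -> (v < b)%R -> (v - u < k.+1%:R * d)%R ->
    (`|m v `^ s - m u `^ s|%R)%:E <= \int[lam]_(z in `]u, v]) integrand h z.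
  elim: k => [|k IH] u v au uv vb uvd.
    rewrite mul1r in uvd; apply: local_step => // z w /andP[uz zv] /andP[uw wv].
    have [zw|zw] := leP z w.
      have := Hd z w (lt_le_trans au uz) zw (le_lt_trans wv vb).
      have -> : (w - z < d)%R by apply: le_lt_trans uvd; lra.
      move=> /(_ isT); rewrite ler_norml => /andP[H _]; lra.
    have := Hd w z (lt_le_trans au uw) (ltW zw) (le_lt_trans zv vb).
    have -> : (z - w < d)%R by apply: le_lt_trans uvd; lra.
    move=> /(_ isT); rewrite ler_norml => /andP[_ H]; lra.
  pose t : R := (k.+1%:R / k.+2%:R)%R.
  have K2 : (0 < k.+2%:R :> R)%R by [].
  have KE : (k.+2%:R = k.+1%:R + 1 :> R)%R by rewrite natr1.
  have K1 : (0 < k.+1%:R :> R)%R by [].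
  have tE : (t * k.+2%:R = k.+1%:R)%R by rewrite /t divfK// gt_eqF.
  have t0 : (0 < t)%R by rewrite divr_gt0.
  have t1 : (t < 1)%R by rewrite ltr_pdivrMr// mul1r ltr_nat.
  pose c := (u + t * (v - u))%R.
  have uc : (u <= c)%R by rewrite lerDl mulr_ge0 ?(ltW t0)// subr_ge0.
  have cv : (c <= v)%R.
    have : (0 <= (1 - t) * (v - u))%R by rewrite mulr_ge0 ?subr_ge0 ?(ltW t1).
    rewrite /c; lra.
  have H1 := IH u c au uc (le_lt_trans cv vb).
  have H2 := IH c v (lt_le_trans au uc) cv vb.
  rewrite (itv_add h uc cv).
  apply: (@le_trans _ _ ((`|m v `^ s - m c `^ s|%R)%:E + (`|m c `^ s - m u `^ s|%R)%:E)).
    by rewrite -EFinD lee_fin; exact: ler_distD.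
  rewrite [leLHS]addeC; apply: leeD.
    apply: H1; rewrite /c addrAC subrr add0r -tE -mulrA.
    by rewrite ltr_pM2l.
  apply: H2; have vc : (v - c = (1 - t) * (v - u))%R by rewrite /c; ring.
  rewrite vc; apply: (@lt_le_trans _ _ ((1 - t) * (k.+2%:R * d))%R).
    by rewrite ltr_pM2l// subr_gt0.
  rewrite mulrA mulrBl mul1r tE KE addrAC subrr add0r mul1r.
  by rewrite ler_peMl ?(ltW d0)// ler1n.
pose k := Num.trunc ((y - x) / d).
apply: (step k) => //; rewrite -ltr_pdivrMr//.
exact: truncnS_gt.
Qed.

(** The error h in [chain] is let to zero, uniformly because m is bounded. *)
Lemma line_pow_growth x y : x \in `]a, b[ -> y \in `]a, b[ ->
  (m y `^ s)%:E <= (m x `^ s)%:E + \int[lam]_(z in `]a, b[) (s * (m z `^ (s - 1) * g z))%:E.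
Proof.
rewrite !in_itv/= => /andP[ax xb] /andP[ay yb].
have M0 : (0 <= M)%R := le_trans (m0 x) (mM x).
pose G : \bar R := \int[lam]_(x in `]a, b[) (g x)%:E.
have G0 : 0 <= G by apply: integral_ge0 => z _; rewrite lee_fin.
have Gfin : G \is a fin_num by rewrite ge0_fin_numE.
apply/lee_addgt0Pr => e e0.
have G1 : (0 < s * (fine G + 1))%R by rewrite mulr_gt0// ltr_wpDl// fine_ge0.
have s10 : (0 < s - 1)%R by rewrite subr_gt0.
have [h h0 Hh] := powR_uniform_cont s10 M0 (divr_gt0 e0 G1).
have {}Hh z : ((m z + h) `^ (s - 1) <= m z `^ (s - 1) + e / (s * (fine G + 1)))%R.
  by apply: Hh; rewrite m0 mM.
set J := \int[lam]_(z in `]a, b[) _.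
suff HJ : (`|m y `^ s - m x `^ s|%R)%:E <= J + e%:E.
  rewrite -addeA; apply: le_trans (leeD (lexx _) HJ); rewrite -EFinD lee_fin.
  have := ler_norm (m y `^ s - m x `^ s)%R; lra.
apply: (@le_trans _ _ (\int[lam]_(z in `]a, b[) integrand h z)).
  have [xy|xy] := leP x y.
    apply: (le_trans (chain h0 ax xy yb)); apply: ge0_subset_integral_nm => // z/=.
    by rewrite !in_itv/= => /andP[xz zy]; rewrite (lt_trans ax xz) (le_lt_trans zy yb).
  rewrite distrC.
  apply: (le_trans (chain h0 ay (ltW xy) xb)); apply: ge0_subset_integral_nm => // z/=.
  by rewrite !in_itv/= => /andP[xz zy]; rewrite (lt_trans ay xz) (le_lt_trans zy xb).
have mJ : measurable_fun `]a, b[%classic (fun z => (s * (m z `^ (s - 1) * g z))%:E).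
  apply: measurable_funTS; apply/measurable_EFinP; apply: measurable_funM => //.
  apply: measurable_funM => //.
  exact: (@measurableT_comp _ _ _ _ _ _ (@powR R ^~ (s - 1)%R)).
apply: (@le_trans _ _ (\int[lam]_(z in `]a, b[)
    ((s * (m z `^ (s - 1) * g z))%:E + (e / (fine G + 1))%:E * (g z)%:E))).
  apply: ge0_le_integral_nm => // z _; rewrite -EFinM -EFinD lee_fin.
  have := ler_wpM2r (g0 z) (Hh z); rewrite mulrDl => /(ler_wpM2l (ltW s0)).
  move/le_trans; apply; rewrite mulrDr lerD2l le_eqVlt; apply/orP; left; apply/eqP.
  by field; rewrite !gt_eqF// ltr_wpDl// fine_ge0.
have G2 : (0 < fine G + 1)%R by rewrite ltr_wpDl// fine_ge0.
rewrite ge0_integralD//; last 3 first.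
- by move=> z _; rewrite lee_fin mulr_ge0 ?(ltW s0)// mulr_ge0 ?powR_ge0.
- by move=> z _; rewrite -EFinM lee_fin mulr_ge0// divr_ge0// ltW.
- by apply: measurable_funeM; apply/measurable_EFinP; exact: measurable_funTS.
rewrite leeD2l// ge0_integralZl//; last 3 first.
- by apply/measurable_EFinP; exact: measurable_funTS.
- by move=> z _; rewrite lee_fin.
- by rewrite lee_fin divr_ge0// ltW.
rewrite -/G -(fineK Gfin) -EFinM lee_fin -mulrA ler_piMr ?(ltW e0)//.
by rewrite mulrC ler_pdivrMr// mul1r lerDl.
Qed.

(** The function m need not vanish at the end points: [line_pow_growth] is averaged
    over its starting point, and the mean value of m `^ s over the interval is the
    term m / (b - a). This is why no cut-off is needed in the Sobolev inequality. *)
Lemma line_gagliardo y : y \in `]a, b[ ->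
  (m y `^ s)%:E <= \int[lam]_(z in `]a, b[)
     (s * (m z `^ (s - 1) * (m z / (b - a) + g z)))%:E.
Proof.
move=> yab.
pose J := \int[lam]_(z in `]a, b[) (s * (m z `^ (s - 1) * g z))%:E.
have J0 : 0 <= J.
  by apply: integral_ge0 => z _; rewrite lee_fin mulr_ge0 ?(ltW s0)// mulr_ge0 ?powR_ge0.
have ba : (0 < b - a)%R by rewrite subr_gt0.
have muI : lam `]a, b[%classic = (b - a)%:E.
  by rewrite lebesgue_measure_itv/= lte_fin ab -EFinD.
have mms : measurable_fun setT (fun z => m z `^ s)%R.
  exact: (@measurableT_comp _ _ _ _ _ _ (@powR R ^~ s)).
have mJ : measurable_fun setT (fun z => (s * (m z `^ (s - 1) * g z))%:E).
  apply/measurable_EFinP; apply: measurable_funM => //.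
  apply: measurable_funM => //.
  exact: (@measurableT_comp _ _ _ _ _ _ (@powR R ^~ (s - 1)%R)).
have H : (m y `^ s)%:E * (b - a)%:E <= \int[lam]_(x in `]a, b[) (m x `^ s)%:E + J * (b - a)%:E.
  rewrite -muI -!integral_cst// -ge0_integralD//; last 2 first.
  - by move=> z _; rewrite lee_fin powR_ge0.
  - by apply/measurable_EFinP; exact: measurable_funTS.
  apply: ge0_le_integral_nm => z zab; first by rewrite lee_fin powR_ge0.
  exact: line_pow_growth.
have {}H : (m y `^ s)%:E <= ((b - a)^-1)%:E * (\int[lam]_(x in `]a, b[) (m x `^ s)%:E) + J.
  rewrite -lee_pdivlMr// in H; apply: (le_trans H).
  rewrite muleC ge0_muleDr//; last 2 first.
  - by apply: integral_ge0 => z _; rewrite lee_fin powR_ge0.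
  - by rewrite mule_ge0// lee_fin ltW.
  by rewrite (muleC J) muleA -EFinM mulVf ?gt_eqF// mul1e.
apply: (le_trans H).
rewrite -ge0_integralZl//; last 3 first.
- by apply/measurable_EFinP; exact: measurable_funTS.
- by move=> z _; rewrite lee_fin powR_ge0.
- by rewrite lee_fin invr_ge0 ltW.
rewrite /J -ge0_integralD//; last 4 first.
- by move=> z _; rewrite -EFinM lee_fin mulr_ge0 ?powR_ge0// invr_ge0 ltW.
- by apply: measurable_funeM; apply/measurable_EFinP; exact: measurable_funTS.
- by move=> z _; rewrite lee_fin mulr_ge0 ?(ltW s0)// mulr_ge0 ?powR_ge0.
- exact: measurable_funTS.
apply: ge0_le_integral_nm => z _.
  rewrite -EFinM -EFinD lee_fin addr_ge0// mulr_ge0 ?powR_ge0 ?invr_ge0 ?(ltW ba)// ?(ltW s0)//.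
  by rewrite mulr_ge0 ?powR_ge0.
rewrite -EFinM -EFinD lee_fin !mulrDr lerD2r.
rewrite -[in leLHS](mulr_powRB1 (m0 z) s0).
have -> : ((b - a)^-1 * (m z * m z `^ (s - 1)) = 1 * (m z `^ (s - 1) * (m z / (b - a))))%R by ring.
apply: ler_wpM2r; last exact: ltW.
by rewrite mulr_ge0 ?powR_ge0// divr_ge0// ltW.
Qed.

End line.

(** * Explicit smooth functions *)

Section flat_functions.
Context {R : realType}.
Implicit Types c x y : R.

(** For k = 0 this is the classical function exp (- c / y), extended by 0. The
    factors y^-k make the family closed under derivation. *)
Definition flat c k y : R := if 0 < y then y^-1 ^+ k * expR (- c * y^-1) else 0.

Lemma flat_ge0 c k y : 0 <= flat c k y.
Proof.
rewrite /flat; case: ifP => // y0.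
by rewrite mulr_ge0 ?expR_ge0// exprn_ge0// invr_ge0 ltW.
Qed.

Lemma flat_le0 c k y : y <= 0 -> flat c k y = 0.
Proof. by rewrite /flat => y0; rewrite ltNge y0. Qed.

Lemma flat_le c k y : 0 < c -> flat c k y <= (k%:R / c) ^+ k.
Proof.
move=> c0; have C0 : 0 <= (k%:R / c) ^+ k by rewrite exprn_ge0// divr_ge0// ltW.
rewrite /flat; case: ifP => // y0; set z := y^-1.
have z0 : 0 < z by rewrite invr_gt0.
case: k C0 => [|k] _; first by rewrite !expr0 mul1r -expR0 ler_expR mulNr oppr_le0 mulr_ge0 ?ltW.
have K0 : 0 < k.+1%:R :> R by [].
rewrite mulNr expRN ler_pdivrMr ?expR_gt0//.
have -> : c * z = k.+1%:R * (c * z / k.+1%:R) by rewrite [RHS]mulrC divfK// gt_eqF.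
rewrite expRM_natl -exprMn.
apply: lerXn2r; rewrite ?nnegrE ?mulr_ge0 ?invr_ge0 ?expR_ge0 ?(ltW c0) ?(ltW y0)//.
have := expR_ge1Dx (c * z / k.+1%:R) => H.
have {}H : c * z / k.+1%:R <= expR (c * z / k.+1%:R) by apply: le_trans H; rewrite lerDr.
have kc : 0 <= k.+1%:R / c by rewrite divr_ge0// ltW.
apply: le_trans (ler_wpM2l kc H); rewrite le_eqVlt; apply/orP; left; apply/eqP.
move: (k.+1%:R) K0 => K K0; by field; rewrite !gt_eqF.
Qed.

Lemma flatS c k y : 0 < y -> flat c k.+1 y = y^-1 * flat c k y.
Proof. by move=> y0; rewrite /flat y0 exprS mulrA. Qed.

Global Instance is_derive_flat c k x : 0 < c ->
  is_derive x 1 (flat c k) (c * flat c k.+2 x - k%:R * flat c k.+1 x).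
Proof.
move=> c0; have [x0|x0|->] := ltgtP x 0.
- rewrite !flat_le0 ?(ltW x0)// !mulr0 subr0.
  apply: (@near_eq_is_derive _ _ _ (cst 0)).
  by near=> y; rewrite flat_le0//; apply: ltW; near: y; exact: lt_nbhsl.
- have near_flat : \near x, ((fun y => y^-1) ^+ k * (expR \o (fun y => - c * y^-1))) x = flat c k x.
    near=> y; have y0 : 0 < y by near: y; exact: lt_nbhsr.
    by rewrite /flat y0 /= exprfctE.
  have x_neq0 : x != 0 by rewrite gt_eqF.
  have dV : is_derive x 1 (fun y : R => y^-1) (- x ^- 2 *: 1) by apply: is_deriveV.
  have dE : is_derive x 1 (expR \o (fun y => - c * y^-1)) (expR (- c * x^-1) * (- c * (- x ^- 2))).
    apply: is_derive1_comp.
    have := is_deriveM (is_derive_cst (- c) x 1) dV.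
    by move=> /is_derive_eq; apply; rewrite scaler0 addr0 /cst /= !scalerAl mulr1.
  apply: (near_eq_is_derive near_flat).
  have := is_deriveM (is_deriveX k dV) dE.
  move=> /is_derive_eq; apply.
  rewrite /flat x0 /= exprfctE /GRing.scale/=.
  case: k {near_flat} => [|k]; first by rewrite !mul0r !expr0; field.
  by rewrite !exprS/=; field.
- rewrite !flat_le0// !mulr0 subr0.
  pose C : R := (k.+2%:R / c) ^+ k.+2 + 1.
  have C0 : 0 < C by rewrite ltr_wpDl// exprn_ge0// divr_ge0// ltW.
  have H : h^-1 *: (flat c k (h *: 1 + 0) - flat c k 0) @[h --> 0^'] --> 0.
    apply/cvgr0Pnorm_le => e e0; near=> h.
    rewrite addr0 [flat c k 0]flat_le0// subr0 [h *: 1]mulr1.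
    have [h0|h0] := leP h 0; first by rewrite flat_le0// scaler0 normr0 ltW.
    rewrite -[_ *: _]/(h^-1 * flat c k h) -flatS// ger0_norm ?flat_ge0//.
    have -> : flat c k.+1 h = h * flat c k.+2 h by rewrite (flatS _ k.+1 h0) mulrA mulfV ?mul1r// gt_eqF.
    apply: (@le_trans _ _ (e / C * C)); last by rewrite divfK// gt_eqF.
    apply: ler_pM; rewrite ?flat_ge0 ?(ltW h0)//.
      rewrite -(gtr0_norm h0); apply: ltW; near: h.
      by apply: dnbhs0_lt; rewrite divr_gt0.
    by apply: (le_trans (flat_le _ _ c0)); rewrite lerDl.
  apply: DeriveDef; first by apply/cvg_ex; exists 0.
  exact: cvg_lim H.
Unshelve. all: by end_near. Qed.

End flat_functions.

Section smooth_class.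
Context {R : realType}.

(** A class of differentiable functions that is closed under directional
    derivatives contains smooth functions only; smoothness of every test function
    below is proved by membership in such a class. *)
Lemma smooth_ind_class (V : normedModType R) (F : (V -> R) -> Prop) :
  (forall f, F f -> [/\ continuous f, forall x v, derivable f x v &
    forall v, F ('D_v f)]) -> forall f, F f -> smooth f.
Proof.
move=> HF f Ff; have H vs : F (iter_derive f vs).
  by elim: vs => //= v vs IH; have [] := HF _ IH.
by move=> vs; have [? ?] := HF _ (H vs).
Qed.

(** The last constructor adds antiderivatives: test functions with a prescribed
    derivative are needed to recover a weakly differentiable function on lines. *)
Inductive smooth1 : (R -> R) -> Prop :=
| smooth1_flat c k : 0 < c -> smooth1 (flat c k)
| smooth1_cst a : smooth1 (cst a)
| smooth1_id : smooth1 id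
| smooth1_add f g : smooth1 f -> smooth1 g -> smooth1 (f + g)
| smooth1_mul f g : smooth1 f -> smooth1 g -> smooth1 (f * g)
| smooth1_comp f g : smooth1 f -> smooth1 g -> smooth1 (f \o g)
| smooth1_prim (f g : R -> R) : smooth1 f -> (forall x : R, is_derive x 1 g (f x)) -> smooth1 g.

Lemma smooth1_derive f : smooth1 f -> exists2 f' : R -> R, smooth1 f' & forall x : R, is_derive x 1 f (f' x).
Proof.
elim=> {f}.
- move=> c k c0; exists (cst c * flat c k.+2 + cst (- k%:R) * flat c k.+1).
    by apply: smooth1_add; apply: smooth1_mul; constructor.
  move=> x; have := @is_derive_flat R c k x c0.
  by rewrite -mulNr => /is_derive_eq; apply.
- by move=> a; exists (cst 0); [constructor|move=> x; exact: is_derive_cst].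
- by exists (cst 1); [constructor|move=> x; exact: is_derive_id].
- move=> f g _ [f' sf' df] _ [g' sg' dg]; exists (f' + g'); first exact: smooth1_add.
  by move=> x; exact: is_deriveD.
- move=> f g sf [f' sf' df] sg [g' sg' dg]; exists (f * g' + g * f').
    by apply: smooth1_add; apply: smooth1_mul.
  by move=> x; exact: is_deriveM.
- move=> f g sf [f' sf' df] sg [g' sg' dg]; exists ((f' \o g) * g').
    by apply: smooth1_mul => //; exact: smooth1_comp.
  by move=> x; exact: is_derive1_comp.
- by move=> f g sf _ dg; exists f.
Qed.

Lemma smooth1_derivable f : smooth1 f -> forall x v, derivable f x v.
Proof.
move=> /smooth1_derive[f' _ df] x v; have [d _] := df x.
by apply: diff_derivable; exact/derivable1_diffP.
Qed.

Lemma smooth1_continuous f : smooth1 f -> continuous f.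
Proof.
move=> /smooth1_derive[f' _ df] x; have [d _] := df x.
by apply: differentiable_continuous; exact/derivable1_diffP.
Qed.

Lemma deriveR (f : R -> R) x v : derivable f x 1 -> 'D_v f x = v * 'D_1 f x.
Proof.
move=> /derivable1_diffP d; rewrite !deriveE//.
by rewrite -[v in LHS]mulr1 -[v * 1]/(v *: (1 : R)) linearZ.
Qed.

Lemma smooth1_deriveD f v : smooth1 f -> smooth1 ('D_v f).
Proof.
move=> sf; have [f' sf' df] := smooth1_derive sf.
have -> : 'D_v f = cst v * f'.
  apply/funext => x; have [d dE] := df x.
  by rewrite deriveR// dE.
by apply: smooth1_mul => //; constructor.
Qed.

Lemma smooth1_smooth f : smooth1 f -> smooth f.
Proof.
apply: smooth_ind_class => {}f sf; split.
- exact: smooth1_continuous.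
- exact: smooth1_derivable.
- by move=> v; exact: smooth1_deriveD.
Qed.

Variable V : normedModType R.

(** The functions of several variables in use are built from functions of one
    linear coordinate; the chain rule is then needed along lines only. *)
Inductive smoothV : (V -> R) -> Prop :=
| smoothV_comp (l : V -> R) f : (forall k u v, l (k *: u + v) = k * l u + l v) ->
    continuous l -> smooth1 f -> smoothV (f \o l)
| smoothV_add f g : smoothV f -> smoothV g -> smoothV (f + g)
| smoothV_mul f g : smoothV f -> smoothV g -> smoothV (f * g).

Lemma derive_comp_linear (l : V -> R) (f : R -> R) x v :
  (forall k u v, l (k *: u + v) = k * l u + l v) ->
  'D_v (f \o l) x = 'D_(l v) f (l x).
Proof.
move=> hl; rewrite /derive; set F := fun h => _; set G := fun h => _.
suff -> : F = G by [].
by apply/funext => h; rewrite /F /G /= hl.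
Qed.

Lemma derivable_comp_linear (l : V -> R) (f : R -> R) x v :
  (forall k u v, l (k *: u + v) = k * l u + l v) ->
  derivable f (l x) (l v) -> derivable (f \o l) x v.
Proof.
move=> hl; rewrite /derivable; set F := fun h => _; set G := fun h => _.
suff -> : F = G by [].
by apply/funext => h; rewrite /F /G /= hl.
Qed.

Lemma smoothV_props f : smoothV f -> [/\ continuous f, forall x v, derivable f x v &
    forall v, smoothV ('D_v f)].
Proof.
elim=> {f}.
- move=> l f hl cl sf; split.
  + move=> x; apply: continuous_comp; first exact: cl.
    exact: smooth1_continuous.
  + by move=> x v; apply: derivable_comp_linear => //; exact: smooth1_derivable.
  + move=> v; have -> : 'D_v (f \o l) = 'D_(l v) f \o l.
      by apply/funext => x; exact: derive_comp_linear.
    by apply: smoothV_comp => //; exact: smooth1_deriveD.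
- move=> f g _ [cf df sf] _ [cg dg sg]; split.
  + by move=> x; apply: continuousD; [exact: cf|exact: cg].
  + by move=> x v; exact: derivableD.
  + move=> v; have -> : 'D_v (f + g) = 'D_v f + 'D_v g.
      by apply/funext => x; exact: deriveD.
    exact: smoothV_add.
- move=> f g sf0 [cf df sf] sg0 [cg dg sg]; split.
  + by move=> x; apply: continuousM; [exact: cf|exact: cg].
  + by move=> x v; exact: derivableM.
  + move=> v; have -> : 'D_v (f * g) = f * 'D_v g + g * 'D_v f.
      by apply/funext => x; exact: deriveM.
    by apply: smoothV_add; apply: smoothV_mul.
Qed.

Lemma smoothV_smooth f : smoothV f -> smooth f.
Proof. by apply: smooth_ind_class; exact: smoothV_props. Qed.

End smooth_class.

(** * Windows and steps: the one-dimensional cut-off functions *)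

Section bumps.
Context {R : realType}.
Implicit Types a b h x y : R.

(** The powers p i in a cut-off function need not be integers. For the exponential
    window a real power only changes the constant c, so it stays smooth. *)
Lemma flat_powR p y : 0 < p -> (flat 1 0 y : R) `^ p = flat p 0 y.
Proof.
move=> p0; rewrite /flat; case: ifP => _; last by rewrite powR0 // gt_eqF.
by rewrite !expr0 !mul1r -expRM; congr expR; ring.
Qed.

Lemma flat0_le1 c y : 0 < c -> flat c 0 y <= 1 :> R.
Proof. by move=> c0; have := flat_le 0 y c0; rewrite expr0. Qed.

Lemma flat0_homo c : 0 < c -> {homo (flat c 0 : R -> R) : x y / x <= y}.
Proof.
move=> c0 x y xy; rewrite {1}/flat; case: ifP => x0; last exact: flat_ge0.
have y0 : 0 < y by exact: lt_le_trans xy.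
by rewrite /flat y0 !expr0 !mul1r ler_expR !mulNr lerN2 ler_pM2l// lef_pV2.
Qed.

Lemma derive_flat y : 'D_1 (flat 1 0) y = flat 1 2 y :> R.
Proof.
have [_ ->] := @is_derive_flat R 1 0 y ltr01.
by rewrite mul0r subr0 mul1r.
Qed.

Lemma derive_flat_bound y : 0 <= 'D_1 (flat 1 0 : R -> R) y <= 4.
Proof.
rewrite derive_flat flat_ge0/=; apply: le_trans (flat_le 2 y ltr01) _.
by rewrite divr1 -natrX.
Qed.

Lemma smooth1_affine a b : smooth1 (fun s : R => a * s + b).
Proof.
apply: (@smooth1_add _ (cst a * id) (cst b)); last by constructor.
by apply: smooth1_mul; constructor.
Qed.

(** Positive exactly on ]a, b[; h is the scale over which it rises. *)
Definition window c a b h (s : R) : R := flat c 0 ((s - a) / h) * flat c 0 ((b - s) / h).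

Lemma smooth1_window c a b h : 0 < c -> smooth1 (window c a b h).
Proof.
move=> c0.
have -> : window c a b h =
    (flat c 0 \o (fun s => h^-1 * s + (- a / h))) * (flat c 0 \o (fun s => - h^-1 * s + b / h)).
  by apply/funext => s; rewrite /window; congr (flat _ _ _ * flat _ _ _); ring.
by apply: smooth1_mul; apply: smooth1_comp; [constructor|exact: smooth1_affine|constructor|exact: smooth1_affine].
Qed.

Lemma window_ge0 c a b h s : 0 <= window c a b h s.
Proof. by rewrite mulr_ge0 ?flat_ge0. Qed.

Lemma window_le1 c a b h s : 0 < c -> window c a b h s <= 1.
Proof. by move=> c0; rewrite mulr_ile1 ?flat_ge0 ?flat0_le1. Qed.

Lemma window_neq0 c a b h s : 0 < h -> window c a b h s != 0 -> a < s < b.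
Proof.
move=> h0; apply: contraNT; rewrite negb_and -!leNgt => /orP[sa|bs].
  by rewrite /window flat_le0 ?mul0r// pmulr_lle0 ?invr_gt0// subr_le0.
by rewrite /window [X in _ * X]flat_le0 ?mulr0// pmulr_lle0 ?invr_gt0// subr_le0.
Qed.

Lemma window_powR p a b h s : 0 < p -> window 1 a b h s `^ p = window p a b h s.
Proof. by move=> p0; rewrite powRM ?flat_ge0// !flat_powR. Qed.

(** The window is not identically 1 inside: a lower bound by a constant is all that
    the energy inequality requires. *)
Lemma window_ge a b h s : 0 < h -> a + h / 2 <= s -> s <= b - h / 2 ->
  expR (- 4) <= window 1 a b h s.
Proof.
move=> h0 as_ sb.
have H y : 2^-1 <= y -> expR (- 2) <= (flat 1 0 y : R).
  move=> y2; apply: le_trans (flat0_homo ltr01 y2).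
  by rewrite /flat invr_gt0 ltr0n expr0 mul1r invrK mulN1r.
have -> : - 4 = - 2 + - 2 :> R by ring.
rewrite expRD; apply: ler_pM; rewrite ?expR_ge0//; apply: H.
  rewrite ler_pdivlMr//; lra.
by rewrite ler_pdivlMr//; lra.
Qed.

Lemma derive_window a b h s : 0 < h -> `|'D_1 (window 1 a b h) s| <= 8 / h.
Proof.
move=> h0; set f := fun s => (s - a) / h; set g := fun s => (b - s) / h.
have df : is_derive s 1 f h^-1.
  have -> : f = (cst h^-1 * id) + cst (- a / h) by apply/funext => u; rewrite -[RHS]/(h^-1 * u + (- a / h)) /f; ring.
  by apply: is_derive_eq; rewrite /= scaler0 !addr0 /GRing.scale/= mulr1.
have dg : is_derive s 1 g (- h^-1).
  have -> : g = (cst (- h^-1) * id) + cst (b / h) by apply/funext => u; rewrite -[RHS]/(- h^-1 * u + (b / h)) /g; ring.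
  by apply: is_derive_eq; rewrite /= scaler0 !addr0 /GRing.scale/= mulr1.
have d1 : is_derive s 1 (flat 1 0 \o f) (flat 1 2 (f s) * h^-1).
  apply: is_derive1_comp; have := @is_derive_flat R 1 0 (f s) ltr01.
  by rewrite mul0r subr0 mul1r.
have d2 : is_derive s 1 (flat 1 0 \o g) (flat 1 2 (g s) * (- h^-1)).
  apply: is_derive1_comp; have := @is_derive_flat R 1 0 (g s) ltr01.
  by rewrite mul0r subr0 mul1r.
have [_] := is_deriveM d1 d2.
rewrite -[_ * _]/(window 1 a b h) => ->.
rewrite /GRing.scale/= (le_trans (ler_normD _ _))//.
have hV : 0 < h^-1 by rewrite invr_gt0.
have B1 u : `|flat 1 2 u : R| <= 4.
  by rewrite ger0_norm ?flat_ge0//; have := derive_flat_bound u; rewrite derive_flat => /andP[].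
have B0 u : `|flat 1 0 u : R| <= 1 by rewrite ger0_norm ?flat_ge0 ?flat0_le1.
have -> : 8 / h = 1 * (4 * h^-1) + 1 * (4 * h^-1) by ring.
have P u w : `|flat 1 0 u : R| * (`|flat 1 2 w : R| * h^-1) <= 1 * (4 * h^-1).
  apply: ler_pM => //; first by rewrite mulr_ge0// ltW.
  by apply: ler_wpM2r => //; exact: ltW.
by apply: lerD; rewrite !normrM ?normrN (gtr0_norm hV); exact: P.
Qed.

(** Equal to 0 for y <= 0 and to 1 for y >= 1: the inner flat function reaches its
    value at 1 exactly at y = 1, and the outer one is 0 from there on. *)
Definition step (y : R) : R := 1 - flat 1 0 (flat 1 0 1 - flat 1 0 y) / flat 1 0 (flat 1 0 1).

Let e1 : R := flat 1 0 1.
Let e1_gt0 : 0 < e1. Proof. by rewrite /e1 /flat ltr01 expr0 mul1r expR_gt0. Qed.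
Let e2 : R := flat 1 0 e1.
Let e2_gt0 : 0 < e2. Proof. by rewrite /e2 /flat e1_gt0 expr0 mul1r expR_gt0. Qed.

Let stepE : step = cst 1 + cst (- e2^-1) * (flat 1 0 \o (cst e1 + cst (- 1) * (flat 1 0))).
Proof.
apply/funext => u.
rewrite -[RHS]/(1 + (- e2^-1) * flat 1 0 (e1 + (- 1) * flat 1 0 u)) /step -/e1 -/e2.
have -> : e1 + (- 1) * flat 1 0 u = e1 - flat 1 0 u by rewrite mulN1r.
by ring.
Qed.

Lemma smooth1_step : smooth1 step.
Proof.
rewrite stepE.
apply: smooth1_add; first by constructor.
apply: smooth1_mul; first by constructor.
apply: smooth1_comp; first by constructor.
apply: smooth1_add; first by constructor.
by apply: smooth1_mul; constructor.
Qed.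

Lemma step_le0 y : y <= 0 -> step y = 0.
Proof. by move=> y0; rewrite /step [flat 1 0 y]flat_le0// subr0 mulfV ?subrr// gt_eqF. Qed.

Lemma step_ge1 y : 1 <= y -> step y = 1.
Proof.
move=> y1; rewrite /step [flat 1 0 (_ - _)]flat_le0 ?mul0r ?subr0//.
by rewrite subr_le0; exact: flat0_homo.
Qed.

Lemma step_homo : {homo step : x y / x <= y}.
Proof.
move=> x y xy; rewrite /step lerD2l lerN2; apply: ler_wpM2r; first by rewrite invr_ge0 ltW.
by apply: flat0_homo => //; rewrite lerD2l lerN2; exact: flat0_homo.
Qed.

Lemma step01 y : 0 <= step y <= 1.
Proof.
apply/andP; split; last by rewrite /step gerBl divr_ge0 ?flat_ge0.
have m0 : Num.min y 0 <= 0 by rewrite ge_min lexx orbT.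
have my : Num.min y 0 <= y by rewrite ge_min lexx.
by rewrite -[leLHS](step_le0 m0); exact: step_homo.
Qed.

Definition step_slope : R := 16 / flat 1 0 (flat 1 0 1).

Lemma step_slope_gt0 : 0 < step_slope. Proof. by rewrite divr_gt0. Qed.

Lemma derive_step a h t : 0 < h ->
  0 <= 'D_1 (fun s => step ((s - a) / h)) t <= step_slope / h.
Proof.
move=> h0; set f := fun s => (s - a) / h; rewrite -[fun s => _]/(step \o f).
have df : is_derive t 1 f h^-1.
  have -> : f = (cst h^-1 * id) + cst (- a / h) by apply/funext => u; rewrite -[RHS]/(h^-1 * u + (- a / h)) /f; ring.
  by apply: is_derive_eq; rewrite /= scaler0 !addr0 /GRing.scale/= mulr1.
set y := f t.
have d1 : is_derive y 1 (flat 1 0) (flat 1 2 y).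
  by have := @is_derive_flat R 1 0 y ltr01; rewrite mul0r subr0 mul1r.
have d2 : is_derive y 1 (cst e1 + cst (- 1) * (flat 1 0)) (- flat 1 2 y).
  have := (is_deriveD (is_derive_cst e1 y 1) (is_deriveM (is_derive_cst (-1 : R) y 1) d1)).
  move=> /is_derive_eq; apply.
  by rewrite add0r scaler0 addr0 /GRing.scale/= mulN1r.
set z := (cst e1 + cst (- 1) * (flat 1 0)) y.
have d3 : is_derive z 1 (flat 1 0) (flat 1 2 z).
  by have := @is_derive_flat R 1 0 z ltr01; rewrite mul0r subr0 mul1r.
have d4 := is_derive1_comp d3 d2.
have d5 : is_derive y 1 step (e2^-1 * (flat 1 2 z * flat 1 2 y)).
  rewrite stepE.
  have := (is_deriveD (is_derive_cst (1 : R) y 1) (is_deriveM (is_derive_cst (- e2^-1) y 1) d4)).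
  move=> /is_derive_eq; apply.
  by rewrite add0r scaler0 addr0 /GRing.scale/=; ring.
have [_ ->] := is_derive1_comp d5 df.
rewrite /step_slope -/e1 -/e2.
have hV : 0 < h^-1 by rewrite invr_gt0.
rewrite !mulr_ge0 ?flat_ge0 ?invr_ge0 ?(ltW e2_gt0) ?(ltW h0)//=.
apply: ler_wpM2r; first exact: ltW.
have B u : (flat 1 2 u : R) <= 4.
  by have := derive_flat_bound u; rewrite derive_flat => /andP[].
rewrite mulrC; apply: ler_wpM2r; first by rewrite invr_ge0 ltW.
have -> : 16 = 4 * 4 :> R by ring.
by apply: ler_pM; rewrite ?flat_ge0.
Qed.

Lemma smooth1_step_affine a h : smooth1 (fun s : R => step ((s - a) / h)).
Proof.
have -> : (fun s => step ((s - a) / h)) = step \o (fun s => h^-1 * s + (- a / h)).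
  by apply/funext => s /=; congr step; ring.
by apply: smooth1_comp; [exact: smooth1_step|exact: smooth1_affine].
Qed.

End bumps.

(** * Products of one-dimensional functions, boxes *)

Section tensor_functions.
Context {R : realType}.

Lemma smooth1_primitive (f : R -> R) (a b : R) : smooth1 f ->
  (forall s, f s != 0 -> a < s < b) ->
  exists F : R -> R, [/\ smooth1 F, forall x : R, is_derive x 1 F (f x) &
    forall x, F x = (\int[@lebesgue_measure R]_(s in `]-oo, x]) f s)%R].
Proof.
move=> sf supp; pose F x := (\int[@lebesgue_measure R]_(s in `]-oo, x]) f s)%R.
have cf := smooth1_continuous sf.
have mf : measurable_fun setT f by exact: continuous_measurable_fun.
have intf : (@lebesgue_measure R).-integrable setT (EFin \o f).
  have -> : EFin \o f = (EFin \o f) \_ `[a, b].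
    apply/funext => s; rewrite patchE; case: ifPn => // /negP; rewrite inE/= in_itv/= => H.
    apply/eqP; apply: contraT => fs; exfalso; apply: H.
    by have /andP[/ltW -> /ltW ->] : a < s < b by apply: supp; rewrite -eqe.
  have mI : measurable (`[a, b]%classic : set (measurableTypeR R)) by exact: measurable_itv.
  apply: (integrable_mkcond _ mI).1.
  apply: continuous_compact_integrable; first exact: segment_compact.
  exact: continuous_subspaceT.
have dF (x : R) : is_derive x 1 F (f x).
  have xx : x < x + 1 by rewrite ltrDl.
  have intx : (@lebesgue_measure R).-integrable `]-oo, x + 1] (EFin \o f).
    by apply: integrableS intf => //; exact: measurable_itv.
  have [d dE] := @continuous_FTC1 R f (BInfty _ true) x (x + 1) xx intx (ltNyr _) (cf x).
  by apply: DeriveDef; [exact: d|rewrite -derive1E; exact: dE].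
by exists F; split => //; exact: (smooth1_prim sf dF).
Qed.

Lemma smoothV_cst (V : normedModType R) (a : R) : smoothV (cst a : V -> R).
Proof.
have := @smoothV_comp R V (cst 0) (cst a) _ _ _.
by apply => //; [move=> k u v; rewrite /cst mulr0 addr0|exact: cst_continuous|constructor].
Qed.

Lemma smoothV_prod (V : normedModType R) (I : Type) (s : seq I) (f : I -> V -> R) :
  (forall i, smoothV (f i)) -> smoothV (fun x => \prod_(i <- s) f i x).
Proof.
move=> sf; elim: s => [|i s IH].
  have -> : (fun x => \prod_(i <- [::]) f i x) = cst 1 by apply/funext => x; rewrite big_nil.
  exact: smoothV_cst.
have -> : (fun x => \prod_(j <- i :: s) f j x) = f i * (fun x => \prod_(j <- s) f j x).
  by apply/funext => x; rewrite big_cons.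
exact: smoothV_mul.
Qed.

Variable n : nat.
Local Notation space := 'rV[R]_n.
Local Notation e_ i := (delta_mx ord0 i : 'rV[R]_n).

Lemma smoothV_coord (i : 'I_n) f : smooth1 f -> smoothV (fun x : space => f (x ord0 i)).
Proof.
move=> sf; apply: (@smoothV_comp _ _ (fun x : space => x ord0 i)) => //.
- by move=> k u v; rewrite !mxE.
- exact: coord_continuous.
Qed.

Lemma smoothV_coord1 (i : 'I_n) f : smooth1 f -> smoothV (fun z : space * R => f (z.1 ord0 i)).
Proof.
move=> sf; apply: (@smoothV_comp _ _ (fun z : space * R => z.1 ord0 i)) => //.
- by move=> k u v; rewrite !mxE.
- move=> z; apply: (@continuous_comp _ _ _ fst (fun x : space => x ord0 i)).
    exact: cvg_fst.
  exact: coord_continuous.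
Qed.

Lemma smoothV_coord2 f : smooth1 f -> smoothV (fun z : space * R => f z.2).
Proof.
move=> sf; apply: (@smoothV_comp _ _ (fun z : space * R => z.2)) => //.
by move=> z; exact: cvg_snd.
Qed.

Lemma update_id (x : space) i : update x i (x ord0 i) = x.
Proof. by apply/rowP => j; rewrite mxE; case: eqP => // ->. Qed.

Lemma updateE (x : space) i r : update x i r ord0 i = r.
Proof. by rewrite mxE eqxx. Qed.

Lemma update_neq (x : space) i j r : j != i -> update x i r ord0 j = x ord0 j.
Proof. by move=> ji; rewrite mxE (negbTE ji). Qed.

Lemma update_update (x : space) i r s : update (update x i r) i s = update x i s.
Proof. by apply/rowP => j; rewrite !mxE; case: eqP. Qed.

Lemma update_line (x : space) i h : h *: e_ i + x = update x i (h + x ord0 i).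
Proof.
apply/rowP => j; rewrite !mxE eqxx/=; case: eqP => [->|_]; first by rewrite mulr1.
by rewrite mulr0 add0r.
Qed.

Lemma derive_coord (f : space -> R) x i :
  'D_(e_ i) f x = 'D_1 (fun s => f (update x i s)) (x ord0 i).
Proof.
rewrite /derive; set F := fun h => _; set G := fun h => _.
suff -> : F = G by [].
apply/funext => h; rewrite /F /G /= update_line update_id.
by rewrite -[h *: 1]/(h * 1) mulr1.
Qed.

Lemma derive_coord1 (f : space * R -> R) z i :
  'D_(e_ i, 0) f z = 'D_1 (fun s => f (update z.1 i s, z.2)) (z.1 ord0 i).
Proof.
rewrite /derive; set F := fun h => _; set G := fun h => _.
suff -> : F = G by [].
apply/funext => h; rewrite /F /G /= update_id -surjective_pairing.
rewrite -[h *: 1]/(h * 1) mulr1; congr (_ *: (f _ - _)).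
by rewrite -update_line -[RHS]/(_ , _); congr pair; rewrite /= scaler0 add0r.
Qed.

Lemma derive_coord2 (f : space * R -> R) z :
  'D_(0 : space, 1 : R) f z = 'D_1 (fun s => f (z.1, s)) z.2.
Proof.
rewrite /derive; set F := fun h => _; set G := fun h => _.
suff -> : F = G by [].
apply/funext => h; rewrite /F /G /= -surjective_pairing.
congr (_ *: (f _ - _)).
by rewrite -[RHS]/(_ , _); congr pair; rewrite /= scaler0 add0r.
Qed.

Lemma derive_scale (f : R -> R) (c x : R) : smooth1 f ->
  'D_1 (fun s => c * f s) x = c * 'D_1 f x.
Proof.
move=> sf; have df : is_derive x 1 f ('D_1 f x).
  by apply: derivableP; exact: smooth1_derivable.
have [_] := is_deriveM (is_derive_cst c x 1) df.
rewrite -[_ * _]/(fun s => c * f s) => ->.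
by rewrite scaler0 addr0.
Qed.

(* closed boxes are compact *)
Definition closed_box (a b : 'I_n -> R) : set space :=
  [set x | forall j, a j <= x ord0 j <= b j].
Definition open_box (a b : 'I_n -> R) : set space :=
  [set x | forall j, a j < x ord0 j < b j].

Lemma compact_closed_box a b : compact (closed_box a b).
Proof.
have := @rV_compact R^o n (fun j => `[a j, b j]%classic) (fun j => @segment_compact R (a j) (b j)).
suff -> : closed_box a b = [set v | forall j, `[a j, b j]%classic (v ord0 j)] by [].
by apply/seteqP; split => x /= H j; have := H j; rewrite /= in_itv.
Qed.

Lemma measurable_open_box a b : measurable (open_box a b).
Proof.
rewrite (_ : open_box a b = \bigcap_(j in [set: 'I_n]) ((fun x : space => x ord0 j) @^-1` `]a j, b j[)).
  apply: fin_bigcap_measurable => // j _.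
  by rewrite -[X in measurable X]setTI; exact: measurable_coordR.
apply/seteqP; split => x /= H j; first by move=> _; rewrite /= in_itv; exact: H.
by have := H j I; rewrite /= in_itv.
Qed.

Lemma compactly_contained_sub (V : normedModType R) (A K D : set V) :
  compact K -> A `<=` K -> K `<=` D -> compactly_contained A D.
Proof.
move=> cK AK KD; have clK : closed K by apply: compact_closed => //; exact: norm_hausdorff.
have clA : closure A `<=` K by rewrite [X in _ `<=` X]((closure_id K).1 clK); exact: closure_subset.
split; last exact: subset_trans KD.
by apply: subclosed_compact cK clA; exact: closed_closure.
Qed.

End tensor_functions.

(** * Functions with vanishing integral over all blocks *)

Section du_bois_reymond.
Context {R : realType} {n : nat}.
Local Notation lam := (@lebesgue_measure R).
Local Notation mu2 := ((lebesgue_rV n \x lam)%E).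
Local Notation T := ('rV[R]_n * measurableTypeR R)%type.

Definition open_block (a b : 'I_n -> R) (a' b' : R) : set T :=
  [set z | open_box a b z.1 /\ a' < z.2 < b'].

Lemma measurable_open_block a b a' b' : measurable (open_block a b a' b').
Proof.
rewrite (_ : open_block _ _ _ _ = open_box a b `*` (`]a', b'[%classic : set (measurableTypeR R))).
  by apply: measurableX; [exact: measurable_open_box|exact: measurable_itv].
by apply/seteqP; split => -[x r] /= []; rewrite in_itv/=.
Qed.

Definition blocks : set (set T) :=
  [set A | exists a, exists b, exists a', exists b', A = open_block a b a' b'].

Lemma setI_closed_blocks : setI_closed blocks.
Proof.
move=> _ _ [a [b [a' [b' ->]]]] [c [d [c' [d' ->]]]].
exists (fun j => Num.max (a j) (c j)), (fun j => Num.min (b j) (d j)),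
  (Num.max a' c'), (Num.min b' d').
apply/seteqP; split => -[x r] /=.
  move=> [[ab /andP[ar rb]] [cd /andP[cr rd]]]; split.
    move=> j; have /andP[? ?] := ab j; have /andP[? ?] := cd j.
    by rewrite gt_max lt_min; apply/andP; split; apply/andP; split.
  by rewrite gt_max lt_min ar cr rb rd.
move=> [H]; rewrite gt_max lt_min => /andP[/andP[ar cr] /andP[rb rd]].
split; split; rewrite ?ar ?rb ?cr ?rd//.
  by move=> j; have := H j; rewrite gt_max lt_min => /andP[/andP[-> _] /andP[-> _]].
by move=> j; have := H j; rewrite gt_max lt_min => /andP[/andP[_ ->] /andP[_ ->]].
Qed.

(** A half-space in one coordinate is a countable union of blocks; None stands for
    the last real coordinate. *)
Lemma bigcup_blocks (b : 'I_n -> R) (c : option 'I_n) (r : R) :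
  [set z : T | r < oapp (fun j => z.1 ord0 j) z.2 c] =
  \bigcup_k open_block (fun j => if Some j == c then r else - k%:R) (fun j => k%:R)
     (if None == c then r else - k%:R) k%:R.
Proof.
apply/seteqP; split => -[x y] /=; last first.
  move=> [k _ [H /andP[ay yb]]]; case: c H ay => [j|] H ay /=; last by [].
  by have := H j; rewrite /= eqxx => /andP[].
move=> Hr; pose M : R := \sum_(j < n) `|x ord0 j| + `|y| + 1.
pose k := (Num.trunc M).+1.
have kM : M < k%:R by exact: truncnS_gt.
have M0 j : `|x ord0 j| < M.
  rewrite /M -addrA; apply: (@le_lt_trans _ _ (\sum_(j < n) `|x ord0 j|)).
    by rewrite (bigD1 j)//= lerDl sumr_ge0.
  by rewrite ltrDl ltr_wpDl.
have My : `|y| < M.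
  by rewrite /M addrAC addrC ltrDl ltr_wpDl// sumr_ge0.
exists k => //; split => /=.
  move=> j; have := lt_trans (M0 j) kM; rewrite ltr_norml => /andP[H1 H2].
  by rewrite H2 andbT; case: eqP => // Ec; move: Hr; rewrite -Ec.
have := lt_trans My kM; rewrite ltr_norml => /andP[H1 H2].
by rewrite H2 andbT; case: eqP => // Ec; move: Hr; rewrite -Ec.
Qed.

Lemma measurable_blocks : @measurable _ T = <<s blocks >>.
Proof.
apply/seteqP; split; last first.
  apply: smallest_sub; first exact: sigma_algebra_measurable.
  by move=> _ [a [b [a' [b' ->]]]]; exact: measurable_open_block.
pose TG := g_sigma_algebraType blocks.
have mcoord (c : option 'I_n) : measurable_fun [set: TG]
    (fun z : TG => (oapp (fun j => (z : T).1 ord0 j) (z : T).2 c : measurableTypeR R)).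
  apply: (measurability _ (RGenOInfty.measurableE R)) => _ /= -[_ [r ->] <-].
  rewrite setTI [X in measurable X](_ : _ = [set z : T | r < oapp (fun j => z.1 ord0 j) z.2 c]); last first.
    by apply/seteqP; split => z /=; rewrite in_itv/= andbT.
  rewrite (bigcup_blocks (fun=> 0)); apply: bigcup_measurable => k _.
  by apply: sub_sigma_algebra; do 4 eexists.
have mid : measurable_fun [set: TG] (fun z : TG => (z : T)).
  rewrite (_ : (fun z : TG => _) = (fun z : TG => ((z : T).1, (z : T).2))); last first.
    by apply/funext => -[].
  apply: measurable_fun_pair; last exact: (mcoord None).
  by apply: measurable_fun_rVP => j; exact: (mcoord (Some j)).
by move=> A mA; have := mid measurableT A mA; rewrite setTI.
Qed.

Local Open Scope ereal_scope.

(** Blocks form a pi-system generating the Borel sets, so by Dynkin's theorem the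
    integral of D vanishes over every Borel set. *)
Lemma ae_eq0_blocks (D : T -> \bar R) (a b : 'I_n -> R) (a' b' : R) :
  mu2.-integrable setT D ->
  (forall z, ~ open_block a b a' b' z -> D z = 0) ->
  (forall c d c' d', \int[mu2]_(z in open_block c d c' d') D z = 0) ->
  \forall z \ae mu2, D z = 0.
Proof.
move=> iD D0 Hb.
have HT : \int[mu2]_z D z = 0.
  rewrite -(Hb a b a' b'); apply: ae_eq_integral_nm; apply: aeW => z.
  rewrite patch_setT patchE; case: ifPn => // /negP; rewrite inE; exact: D0.
have H A : measurable A -> \int[mu2]_(z in A) D z = 0.
  rewrite measurable_blocks => mA.
  apply: (dynkin_induction (P := fun A => \int[mu2]_(z in A) D z = 0)
    measurable_blocks setI_closed_blocks HT _ _ _ mA).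
  - by move=> _ [c [d [c' [d' ->]]]]; exact: Hb.
  - move=> S mS HS.
    have := HT; rewrite -(setUv S) integral_setU//; last 3 first.
    + exact: measurableC.
    + by rewrite setUv; exact: measurable_int iD.
    + by apply/disj_setPCl.
    by rewrite HS add0e.
  - move=> F mF tF HF; rewrite integral_bigcup//; last first.
      by apply: integrableS iD => //; exact: bigcup_measurable.
    by rewrite eseries0.
have := @integral_ae_eq _ _ _ mu2 setT measurableT (cst 0) D iD.
move=> /(_ (measurable_cst _)) Hae.
have {}Hae := Hae (fun E _ mE => etrans (H E mE) (esym (integral0 _ _))).
by apply: filterS Hae => z; apply.
Qed.

End du_bois_reymond.

(** * Smooth bumps approximating the indicator of a block *)

Section bump_approximation.
Context {R : realType}.

Definition inner_window (a b : R) (k : nat) : R -> R :=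
  window 1 (a + k.+1%:R^-1) (b - k.+1%:R^-1) k.+1%:R^-1.

Lemma inner_window01 a b k s : 0 <= inner_window a b k s <= 1.
Proof. by rewrite window_ge0 window_le1. Qed.

Lemma smooth1_inner_window a b k : smooth1 (inner_window a b k).
Proof. exact: smooth1_window. Qed.

Lemma inner_window_neq0 a b k s : inner_window a b k s != 0 ->
  a + k.+1%:R^-1 < s < b - k.+1%:R^-1.
Proof. by apply: window_neq0; rewrite invr_gt0. Qed.

Lemma cvg_flat0 (c : R) : 0 < c -> flat 1 0 (c * k.+1%:R - 1) @[k --> \oo] --> (1 : R).
Proof.
move=> c0; apply/cvgrPdist_le => e e0.
near=> k.
have ck : e^-1 <= c * k.+1%:R - 1.
  rewrite lerBrDr -ler_pdivrMl//; apply: (@le_trans _ _ k%:R); last by rewrite ler_nat.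
  by near: k; exact: nbhs_infty_ger.
set y := _ - 1 in ck *.
have y0 : 0 < y by apply: lt_le_trans ck; rewrite invr_gt0.
rewrite ger0_norm ?subr_ge0 ?flat0_le1//.
rewrite /flat y0 expr0 mul1r mulN1r lerBlDr.
have := expR_ge1Dx (- y^-1).
have : y^-1 <= e by rewrite -[leRHS]invrK lef_pV2// posrE invr_gt0.
by lra.
Unshelve. all: by end_near. Qed.

Lemma cvg_inner_window a b s :
  inner_window a b k s @[k --> \oo] --> ((a < s < b)%R%:R : R).
Proof.
have E (k : nat) : inner_window a b k s =
    flat 1 0 ((s - a) * k.+1%:R - 1) * flat 1 0 ((b - s) * k.+1%:R - 1).
  have k0 : k.+1%:R != 0 :> R by rewrite pnatr_eq0.
  rewrite /inner_window /window !invrK; congr (flat _ _ _ * flat _ _ _).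
    by rewrite opprD addrA mulrBl mulVf.
  by rewrite mulrBl mulrBl mulVf// mulrBl addrAC.
under eq_fun do rewrite E.
have [as_|sa] := ltP a s; last first.
  rewrite (_ : (fun=> _) = cst 0); first exact: cvg_cst.
  apply/funext => k; rewrite [flat 1 0 _]flat_le0 ?mul0r//.
  by rewrite subr_le0 (le_trans _ (ler01 : 0 <= 1 :> R))// mulr_le0_ge0 ?subr_le0.
have [sb|bs] := ltP s b; last first.
  rewrite (_ : (fun=> _) = cst 0); first exact: cvg_cst.
  apply/funext => k; rewrite [X in _ * X]flat_le0 ?mulr0//.
  by rewrite subr_le0 (le_trans _ (ler01 : 0 <= 1 :> R))// mulr_le0_ge0 ?subr_le0.
have sa0 : 0 < s - a by rewrite subr_gt0.
have bs0 : 0 < b - s by rewrite subr_gt0.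
have H := cvgM (cvg_flat0 sa0) (cvg_flat0 bs0); rewrite mulr1 in H; exact: H.
Qed.

Lemma cvg_prod_seq (I : Type) (s : seq I) (f : I -> nat -> R) (l : I -> R) :
  (forall i, f i k @[k --> \oo] --> l i) ->
  \prod_(i <- s) f i k @[k --> \oo] --> \prod_(i <- s) l i.
Proof.
move=> fl; elim: s => [|i s IH].
  under eq_fun do rewrite big_nil; rewrite big_nil; exact: cvg_cst.
under eq_fun do rewrite big_cons; rewrite big_cons; exact: cvgM.
Qed.

End bump_approximation.

Section integrable_helpers.
Context d (T : measurableType d) (R : realType).
Variable mu : {measure set T -> \bar R}.

Lemma integrable_mul_bounded (f h : T -> R) (C : R) :
  mu.-integrable setT (EFin \o f) -> measurable_fun setT h ->
  (forall x, `|h x| <= C) -> mu.-integrable setT (fun x => (f x * h x)%:E).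
Proof.
move=> intf mh hC.
have C0 x : 0 <= C := le_trans (normr_ge0 (h x)) (hC x).
have mf : measurable_fun setT f by apply/measurable_EFinP; exact: measurable_int intf.
apply: (@le_integrable _ _ _ _ _ measurableT _ (fun x => (C * f x)%:E)).
- by apply/measurable_EFinP; exact: measurable_funM.
- move=> x _ /=; rewrite lee_fin !normrM mulrC (ger0_norm (C0 x)).
  by apply: ler_wpM2r.
- exact: (@integrableZl _ _ _ mu setT measurableT C (EFin \o f)).
Qed.

End integrable_helpers.

Section bump_tests.
Context {R : realType} {n : nat}.
Local Notation lam := (@lebesgue_measure R).
Local Notation mu2 := ((lebesgue_rV n \x lam)%E).
Local Notation T := ('rV[R]_n * measurableTypeR R)%type.
Local Open Scope ereal_scope.

Definition block_bump (c d : 'I_n -> R) (c' d' : R) (k : nat) (z : T) : R :=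
  (\prod_(j < n) inner_window (c j) (d j) k (z.1 ord0 j) * inner_window c' d' k z.2)%R.

Lemma measurable_smooth1 (f : R -> R) : smooth1 f -> measurable_fun setT f.
Proof. by move=> sf; apply: continuous_measurable_fun; exact: smooth1_continuous. Qed.

Lemma measurable_block_bump c d c' d' k : measurable_fun setT (block_bump c d c' d' k).
Proof.
apply: measurable_funM.
  apply: measurable_prod => j _.
  apply: (@measurableT_comp _ _ _ _ _ _ (inner_window (c j) (d j) k)).
    by apply: measurable_smooth1; exact: smooth1_inner_window.
  by apply: (@measurableT_comp _ _ _ _ _ _ (fun x : 'rV[R]_n => x ord0 j)) => //; exact: measurable_coordR.
apply: (@measurableT_comp _ _ _ _ _ _ (inner_window c' d' k)).
  by apply: measurable_smooth1; exact: smooth1_inner_window.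
exact: measurable_snd.
Qed.

Lemma block_bump01 c d c' d' k z : (0 <= block_bump c d c' d' k z <= 1)%R.
Proof.
rewrite /block_bump; have := inner_window01 c' d' k z.2.
have : (0 <= \prod_(j < n) inner_window (c j) (d j) k (z.1 ord0 j) <= 1)%R.
  apply: (big_ind (fun u : R => 0 <= u <= 1)%R); first by rewrite ler01 lexx.
    by move=> u v /andP[u0 u1] /andP[v0 v1]; rewrite mulr_ge0//= mulr_ile1.
  by move=> j _; exact: inner_window01.
by move=> /andP[p0 p1] /andP[q0 q1]; rewrite mulr_ge0//= mulr_ile1.
Qed.

Lemma cvg_block_bump c d c' d' z :
  (block_bump c d c' d' k z @[k --> \oo] --> (\1_(open_block c d c' d') z : R))%R.
Proof.
have -> : \1_(open_block c d c' d') z =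
    (\prod_(j < n) (c j < z.1 ord0 j < d j)%R%:R * (c' < z.2 < d')%R%:R)%R :> R.
  rewrite indicE.
  have [H1|H1] := boolP [forall j, c j < z.1 ord0 j < d j]%R; last first.
    have /forallPn[j Hj] := H1.
    rewrite (bigD1 j)//= (negbTE Hj) !mul0r.
    rewrite memNset//= => -[H _]; move/negP: Hj; apply; exact: H.
  rewrite big1 ?mul1r; last by move=> j _; rewrite (forallP H1).
  have [H2|H2] := boolP (c' < z.2 < d')%R.
    by rewrite mem_set//; split => // j; exact: (forallP H1).
  by rewrite memNset//= => -[_ H]; move/negP: H2.
apply: cvgM; last exact: cvg_inner_window.
by apply: cvg_prod_seq => j; exact: cvg_inner_window.
Qed.

(** Dominated convergence: the bumps converge to the indicator of the block and
    stay between 0 and 1. *)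
Lemma block_bump_limit (D : T -> R) c d c' d' :
  mu2.-integrable setT (EFin \o D) ->
  (forall k, \int[mu2]_z (D z * block_bump c d c' d' k z)%:E = 0) ->
  \int[mu2]_(z in open_block c d c' d') (D z)%:E = 0.
Proof.
move=> iD H0; rewrite integral_mul_indic.
have mD : measurable_fun setT D by apply/measurable_EFinP; exact: measurable_int iD.
have m1 k : measurable_fun setT (fun z => (D z * block_bump c d c' d' k z)%:E).
  by apply/measurable_EFinP; apply: measurable_funM => //; exact: measurable_block_bump.
have m2 : measurable_fun setT (fun z => (D z * \1_(open_block c d c' d') z)%:E).
  apply/measurable_EFinP; apply: measurable_funM => //.
  by apply: measurable_indic; exact: measurable_open_block.
have lim : {ae mu2, forall z, setT z -> (D z * block_bump c d c' d' k z)%:E @[k --> \oo] -->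
    (D z * \1_(open_block c d c' d') z)%:E}.
  apply: aeW => z _; apply: cvg_EFin; first exact: nearW.
  by apply: cvgM; [exact: cvg_cst|exact: cvg_block_bump].
have dom : {ae mu2, forall z k, setT z -> `|(D z * block_bump c d c' d' k z)%:E| <= `|(D z)%:E|}.
  apply: aeW => z k _; rewrite !abse_EFin lee_fin normrM.
  have /andP[b0 b1] := block_bump01 c d c' d' k z.
  by rewrite (ger0_norm b0) ler_piMr.
have [_ _] := dominated_convergence measurableT m1 m2 lim (integrable_abse iD) dom.
have -> : (fun k => \int[mu2]_z (D z * block_bump c d c' d' k z)%:E) = cst 0.
  by apply/funext => k; exact: H0.
move=> H; apply/esym.
have H' : cst 0 @ \oo --> (0 : \bar R) by exact: cvg_cst.
exact: (cvg_unique _ H' H).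
Qed.

End bump_tests.

(** * Slices and tensor products *)

Section product_ae.
Context d1 d2 (T1 : measurableType d1) (T2 : measurableType d2) (R : realType).
Variables (m1 : {sigma_finite_measure set T1 -> \bar R})
  (m2 : {sigma_finite_measure set T2 -> \bar R}).
Local Open Scope ereal_scope.

Lemma ae_product1 (P : T1 * T2 -> Prop) :
  (\forall z \ae (m1 \x m2), P z) -> \forall x \ae m1, \forall y \ae m2, P (x, y).
Proof.
move=> [N [mN N0 PN]].
have mI : measurable_fun setT (EFin \o (\1_N : T1 * T2 -> R)).
  by apply/measurable_EFinP; exact: measurable_indic.
have I0 z : 0 <= (EFin \o (\1_N : T1 * T2 -> R)) z by rewrite lee_fin.
have H : \int[m1]_x \int[m2]_y (\1_N (x, y))%:E = 0 :> \bar R.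
  rewrite -(fubini_tonelli1 _ mI I0) -[RHS]N0.
  by rewrite integral_indic// setIT.
have mF := measurable_fun_fubini_tonelli_F (m2 := m2) _ mI I0.
have F0 x : 0 <= \int[m2]_y (\1_N (x, y))%:E by apply: integral_ge0 => y _; rewrite lee_fin.
have : \int[m1]_x `|\int[m2]_y (\1_N (x, y))%:E| = 0.
  by rewrite -[RHS]H; apply: eq_integral => x _; rewrite gee0_abs.
move/(ae_eq_integral_abs _ measurableT mF); apply: filterS => x /(_ I) /= Fx.
exists (xsection N x); split; first exact: measurable_xsection.
  rewrite -[RHS]Fx -[X in m2 X]setIT -integral_indic//; last exact: measurable_xsection.
  apply: eq_integral => y _; congr (_%:E); rewrite !indicE; congr (_%:R)%R.
  by rewrite mem_xsection.
by move=> y Py; rewrite /xsection/= inE; apply: PN.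
Qed.

Lemma ae_product2 (P : T1 * T2 -> Prop) :
  (\forall z \ae (m1 \x m2), P z) -> \forall y \ae m2, \forall x \ae m1, P (x, y).
Proof.
move=> [N [mN N0 PN]].
have mI : measurable_fun setT (EFin \o (\1_N : T1 * T2 -> R)).
  by apply/measurable_EFinP; exact: measurable_indic.
have I0 z : 0 <= (EFin \o (\1_N : T1 * T2 -> R)) z by rewrite lee_fin.
have H : \int[m2]_y \int[m1]_x (\1_N (x, y))%:E = 0 :> \bar R.
  rewrite -(fubini_tonelli2 _ mI I0) -[RHS]N0.
  by rewrite integral_indic// setIT.
have mF := measurable_fun_fubini_tonelli_G (m1 := m1) _ mI I0.
have F0 y : 0 <= \int[m1]_x (\1_N (x, y))%:E by apply: integral_ge0 => x _; rewrite lee_fin.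
have : \int[m2]_y `|\int[m1]_x (\1_N (x, y))%:E| = 0.
  by rewrite -[RHS]H; apply: eq_integral => y _; rewrite gee0_abs.
move/(ae_eq_integral_abs _ measurableT mF); apply: filterS => y /(_ I) /= Fy.
exists (ysection N y); split; first exact: measurable_ysection.
  rewrite -[RHS]Fy -[X in m1 X]setIT -integral_indic//; last exact: measurable_ysection.
  apply: eq_integral => x _; congr (_%:E); rewrite !indicE; congr (_%:R)%R.
  by rewrite mem_ysection.
by move=> x Px; rewrite /ysection/= inE; apply: PN.
Qed.

Lemma integrable_tensor (f : T1 -> R) (g : T2 -> R) :
  m1.-integrable setT (EFin \o f) -> m2.-integrable setT (EFin \o g) ->
  (m1 \x m2).-integrable setT (fun z => (f z.1 * g z.2)%:E).
Proof.
move=> intf intg.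
have mf : measurable_fun setT f by apply/measurable_EFinP; exact: measurable_int intf.
have mg : measurable_fun setT g by apply/measurable_EFinP; exact: measurable_int intg.
have mfg : measurable_fun setT (fun z : T1 * T2 => (f z.1 * g z.2)%:E).
  by apply/measurable_EFinP; apply: measurable_funM; exact: measurableT_comp.
apply/integrable12ltyP => //=.
have [_ Hf] := integrableP _ _ _ intf; have [_ Hg] := integrableP _ _ _ intg.
have E x : \int[m2]_y (`|f x * g y|)%:E = (`|f x|)%:E * \int[m2]_y (`|g y|)%:E.
  rewrite -ge0_integralZl//; first by apply: eq_integral => y _; rewrite normrM EFinM.
  by apply/measurable_EFinP; exact: measurableT_comp.
under eq_integral do rewrite E.
rewrite ge0_integralZr//; last 2 first.
- by apply/measurable_EFinP; exact: measurableT_comp.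
- exact: integral_ge0.
by rewrite lte_mul_pinfty// ?integral_ge0// ge0_fin_numE// integral_ge0.
Qed.

Lemma fubini_weight (f : T1 * T2 -> R) (k : T1 -> R) (C : R) :
  (m1 \x m2).-integrable setT (EFin \o f) -> measurable_fun setT k ->
  (forall x, (`|k x| <= C)%R) ->
  \int[m1 \x m2]_z (f z * k z.1)%:E =
  \int[m1]_x (fine (\int[m2]_y (f (x, y))%:E) * k x)%:E.
Proof.
move=> intf mk kC.
have intfk : (m1 \x m2).-integrable setT (fun z => (f z * k z.1)%:E).
  apply: (integrable_mul_bounded (C := C) intf); first exact: measurableT_comp.
  by move=> z; exact: kC.
rewrite -(integral12_prod_meas1 intfk); apply: ae_eq_integral_nm.
have := ae_integrable1 intf; apply: filterS => x /= Hx.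
rewrite !patch_setT /fubini_F.
have E := integralZr measurableT Hx (k x).
transitivity (\int[m2]_y ((f (x, y))%:E * (k x)%:E)).
  by apply: eq_integral => y _; rewrite EFinM.
by rewrite E EFinM fineK//; exact: (integrable_fin_num measurableT).
Qed.

Lemma integral_tensor (f : T1 -> R) (g : T2 -> R) :
  m1.-integrable setT (EFin \o f) -> m2.-integrable setT (EFin \o g) ->
  \int[m1 \x m2]_z (f z.1 * g z.2)%:E =
  (\int[m1]_x (f x)%:E) * (\int[m2]_y (g y)%:E).
Proof.
move=> intf intg; rewrite -(integral12_prod_meas1 (integrable_tensor intf intg)).
have [G GE] : exists G, \int[m2]_y (g y)%:E = G%:E.
  exists (fine (\int[m2]_y (g y)%:E)); rewrite fineK//.
  exact: (integrable_fin_num measurableT intg).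
have E x : fubini_F m2 (fun z => (f z.1 * g z.2)%:E) x = (f x)%:E * G%:E.
  rewrite -GE -(integralZl measurableT intg) /fubini_F.
  by apply: eq_integral => y _; rewrite EFinM.
under eq_integral do rewrite E.
by rewrite (integralZr measurableT intf) GE.
Qed.

End product_ae.

Section line_swap.
Context {R : realType} {n : nat}.
Local Notation lam := (@lebesgue_measure R).
Local Notation mu2 := ((lebesgue_rV n \x lam)%E).
Local Notation T := ('rV[R]_n * measurableTypeR R)%type.
Local Open Scope ereal_scope.

Definition swap_coord (i : 'I_n) (z : T) : T := (update z.1 i z.2, z.1 ord0 i).

Lemma measurable_swap_coord i : measurable_fun setT (swap_coord i).
Proof.
apply: measurable_fun_pair; first exact: measurable_update.
apply: (@measurableT_comp _ _ _ _ _ _ (fun x : 'rV[R]_n => x ord0 i)) => //.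
exact: measurable_coordR.
Qed.

(** The signed version of [ge0_integral_update]. *)
Lemma integral_swap_coord i (f : T -> \bar R) : measurable_fun setT f ->
  \int[mu2]_z f z = \int[mu2]_z f (swap_coord i z).
Proof.
have ge0 (g : T -> \bar R) : measurable_fun setT g -> (forall z, 0 <= g z) ->
    \int[mu2]_z g z = \int[mu2]_z g (swap_coord i z).
  move=> mg g0; rewrite fubini_tonelli1// [RHS]fubini_tonelli1//; last first.
    by apply: (measurableT_comp mg); exact: measurable_swap_coord.
  exact: ge0_integral_update.
move=> mf; rewrite integralE [RHS]integralE; congr (_ - _).
  rewrite ge0//; first by apply: eq_integral => z _; rewrite !funeposE.
  exact: measurable_funepos.
rewrite ge0//; first by apply: eq_integral => z _; rewrite !funenegE.
exact: measurable_funeneg.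
Qed.

Lemma integrable_swap_coord i (f : T -> \bar R) :
  mu2.-integrable setT f -> mu2.-integrable setT (fun z => f (swap_coord i z)).
Proof.
move=> /integrableP[mf fi]; apply/integrableP; split.
  by apply: (measurableT_comp mf); exact: measurable_swap_coord.
rewrite -(@integral_swap_coord i (fun z => `|f z|))//; exact: measurableT_comp.
Qed.

End line_swap.

(** * Weakly differentiable functions on almost every line *)

Section lines.
Context {R : realType} {n : nat}.
Local Notation lam := (@lebesgue_measure R).
Local Notation mu := (lebesgue_rV n).
Local Notation mu2 := ((lebesgue_rV n \x lam)%E).
Local Notation T := ('rV[R]_n * measurableTypeR R)%type.
Local Notation e_ i := (delta_mx ord0 i : 'rV[R]_n).
Local Open Scope ereal_scope.

Variables (a b : 'I_n -> R) (i : 'I_n) (U G : 'rV[R]_n -> R).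
Hypothesis iU : mu.-integrable setT (EFin \o U).
Hypothesis iG : mu.-integrable setT (EFin \o G).
Hypothesis U0 : forall x, ~ open_box a b x -> U x = 0%R.
Hypothesis G0 : forall x, ~ open_box a b x -> G x = 0%R.
Hypothesis weak : forall (phi : 'rV[R]_n -> R) (e : R), (0 < e)%R -> smooth phi ->
  (forall x, phi x != 0%R -> closed_box (fun j => a j + e)%R (fun j => b j - e)%R x) ->
  \int[mu]_x (U x * 'D_(e_ i) phi x)%:E = - \int[mu]_x (G x * phi x)%:E.

Let mU : measurable_fun setT U.
Proof. by apply/measurable_EFinP; exact: measurable_int iU. Qed.
Let mG : measurable_fun setT G.
Proof. by apply/measurable_EFinP; exact: measurable_int iG. Qed.

Let mcoord j : measurable_fun setT (fun z : T => z.1 ord0 j).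
Proof.
by apply: (@measurableT_comp _ _ _ _ _ _ (fun x : 'rV[R]_n => x ord0 j)) => //; exact: measurable_coordR.
Qed.

Let I01 : R -> R := \1_(`]a i, b i[%classic : set R).

Let iI01 : lam.-integrable setT (EFin \o I01).
Proof.
apply/integrableP; split.
  by apply/measurable_EFinP; apply: measurable_indic; exact: measurable_itv.
under eq_integral do rewrite /= ger0_norm ?indicE//.
rewrite -[X in X < _]/(\int[lam]_x (\1_(`]a i, b i[%classic : set R) x)%:E).
rewrite integral_indic//.
rewrite setIT /= lebesgue_measure_itv/=; case: ifP => _; by rewrite ?ltry// -EFinB ltry.
Qed.

(** J is the primitive of G along direction i, started at the face of the box. It
    is written as the integral of the kernel hJ, which is integrable over the
    product space, so that J is measurable and Fubini applies; kJ is the same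
    kernel after the exchange of r and the i-th coordinate. *)
Let K : set T := [set z : T | (a i < z.2 < b i)%R /\ (z.1 ord0 i <= z.2)%R].
Let kJ (z : T) : R := (G z.1 * \1_K z)%R.
Let hJ (z : T) : R := kJ (swap_coord i z).

Let mK : measurable K.
Proof.
rewrite (_ : K = (snd @^-1` (`]a i, b i[%classic : set (measurableTypeR R))) `&`
   [set z : T | (z.1 ord0 i <= z.2)%R]); last first.
  by apply/seteqP; split => z /=; rewrite in_itv/=.
apply: measurableI.
  by rewrite -[X in measurable X]setTI; apply: measurable_snd => //; exact: measurable_itv.
by rewrite -[X in measurable X]setTI; apply: measurable_fun_le => //; exact: measurable_snd.
Qed.

Let ikJ : mu2.-integrable setT (EFin \o kJ).
Proof.
apply: (@le_integrable _ _ _ _ _ measurableT _ (fun z : T => (G z.1 * I01 z.2)%:E)).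
- apply/measurable_EFinP; apply: measurable_funM; first exact: measurableT_comp.
  exact: measurable_indic.
- move=> z _ /=; rewrite lee_fin !normrM; apply: ler_wpM2l => //.
  rewrite /I01 !indicE !ger0_norm//; case: (boolP (z \in K)) => [/set_mem[/= H _]|//].
  by rewrite mem_set//= in_itv.
- exact: integrable_tensor.
Qed.

Let ihJ : mu2.-integrable setT (EFin \o hJ).
Proof. exact: (integrable_swap_coord i ikJ). Qed.

Let J (x : 'rV[R]_n) : R := fine (\int[lam]_r (hJ (x, r))%:E).

Let mJ : measurable_fun setT J.
Proof.
apply: (@measurableT_comp _ _ _ _ _ _ (@fine R)) => //.
exact: (measurable_fubini_F ihJ).
Qed.

Let iJ : mu.-integrable setT (EFin \o J).
Proof.
apply: (@le_integrable _ _ _ _ _ measurableT _ (fubini_F lam (EFin \o hJ))).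
- exact/measurable_EFinP.
- move=> x _; rewrite /J /fubini_F /=.
  by case: (\int[lam]_y _) => [r| |] //=; rewrite leey.
- exact: integrable_fubini_F.
Qed.

Let hJ0 x r : ~ open_box a b x -> hJ (x, r) = 0%R.
Proof.
move=> Bx; rewrite /hJ /kJ /swap_coord /=.
have [Hi|Hi] := boolP ((update x i r, x ord0 i : measurableTypeR R) \in K); last first.
  by rewrite indicE (negbTE Hi) mulr0.
rewrite G0 ?mul0r// => H; apply: Bx => j.
have [/= Ii _] := set_mem Hi.
have [->//|ji] := eqVneq j i.
by have := H j; rewrite update_neq.
Qed.

Let J0 x : ~ open_box a b x -> J x = 0%R.
Proof.
by move=> Bx; rewrite /J (eq_integral (cst 0)) ?integral0// => r _; rewrite hJ0.
Qed.

(** The weak i-th derivative of W is zero. *)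
Let W x : R := (U x - J x)%R.
Let W0 x : ~ open_box a b x -> W x = 0%R.
Proof. by move=> Bx; rewrite /W U0// J0// subr0. Qed.
Let iW : mu.-integrable setT (EFin \o W).
Proof.
rewrite (_ : EFin \o W = (EFin \o U) \- (EFin \o J)); first exact: integrableB.
by apply/funext => x /=; rewrite EFinB.
Qed.

(** D vanishes at (x, r) when W takes the same value at x and at x moved to r along
    direction i; the indicators confine both points to the box. *)
Let D (z : T) : R := (W z.1 * I01 z.2 - W (update z.1 i z.2) * I01 (z.1 ord0 i))%R.

Let iD : mu2.-integrable setT (EFin \o D).
Proof.
have i1 : mu2.-integrable setT (fun z : T => (W z.1 * I01 z.2)%:E) by exact: integrable_tensor.
have i2 := @integrable_swap_coord R n i _ i1.
rewrite (_ : EFin \o D = (fun z : T => (W z.1 * I01 z.2)%:E) \-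
   (fun z => (W (swap_coord i z).1 * I01 (swap_coord i z).2)%:E)).
  exact: integrableB.
by apply/funext => z /=; rewrite -EFinB.
Qed.

Section one_test.
Variables (th : 'I_n -> R -> R) (th' : R -> R) (h : R).
Hypothesis h0 : (0 < h)%R.
Hypothesis sth : forall j, smooth1 (th j).
Hypothesis sth' : smooth1 th'.
Hypothesis th01 : forall j s, (0 <= th j s <= 1)%R.
Hypothesis th'01 : forall s, (0 <= th' s <= 1)%R.
Hypothesis th_supp : forall j s, th j s != 0%R -> (a j + h < s < b j - h)%R.
Hypothesis th'_supp : forall s, th' s != 0%R -> (a i + h < s < b i - h)%R.

Let eta (x : 'rV[R]_n) : R := (\prod_(j < n | j != i) th j (x ord0 j))%R.

Let bounded_supp_integrable (f : R -> R) (C : R) : measurable_fun setT f ->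
  (forall s, (`|f s| <= C)%R) -> (forall s, f s != 0%R -> (a i + h < s < b i - h)%R) ->
  lam.-integrable setT (EFin \o f).
Proof.
move=> mf fC fs; rewrite (_ : EFin \o f = fun s => (I01 s * f s)%:E).
  exact: (integrable_mul_bounded iI01 mf fC).
apply/funext => s /=; have [->|/fs/andP[H1 H2]] := eqVneq (f s) 0%R; first by rewrite mulr0.
by rewrite /I01 indicE mem_set ?mul1r//= in_itv/= (lt_trans _ H1) ?ltrDl//= (lt_trans H2)// ltrBlDr ltrDl.
Qed.

Let th1 j s : (`|th j s| <= 1)%R.
Proof. by have /andP[H1 H2] := th01 j s; rewrite ger0_norm. Qed.
Let th'1 s : (`|th' s| <= 1)%R.
Proof. by have /andP[H1 H2] := th'01 s; rewrite ger0_norm. Qed.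

Let ith : lam.-integrable setT (EFin \o th i).
Proof. exact: (bounded_supp_integrable (measurable_smooth1 (sth i)) (th1 i) (th_supp (j := i))). Qed.
Let ith' : lam.-integrable setT (EFin \o th').
Proof. exact: (bounded_supp_integrable (measurable_smooth1 sth') th'1 th'_supp). Qed.

Let C1 : R := fine (\int[lam]_s (th i s)%:E).
Let C2 : R := fine (\int[lam]_s (th' s)%:E).
Let C1E : \int[lam]_s (th i s)%:E = C1%:E.
Proof. by rewrite fineK//; exact: (integrable_fin_num measurableT ith). Qed.
Let C2E : \int[lam]_s (th' s)%:E = C2%:E.
Proof. by rewrite fineK//; exact: (integrable_fin_num measurableT ith'). Qed.

(** A combination of th i and th' with zero integral, hence the derivative of a
    function chi with compact support: this is du Bois-Reymond's test function. *)
Let f (s : R) : R := (C2 * th i s - C1 * th' s)%R.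

Let sf : smooth1 f.
Proof.
rewrite (_ : f = cst C2 * th i + cst (- C1) * th')%R.
  by apply: smooth1_add; apply: smooth1_mul => //; constructor.
by apply/funext => s; rewrite /f -mulNr.
Qed.

Let f_supp s : f s != 0%R -> (a i + h < s < b i - h)%R.
Proof.
have [t0|/th_supp//] := eqVneq (th i s) 0%R.
have [t0'|/th'_supp//] := eqVneq (th' s) 0%R.
by move=> /eqP[]; rewrite /f t0 [X in (_ - _ * X)%R]t0' !mulr0 subr0.
Qed.

Let fC s : (`|f s| <= `|C2| + `|C1|)%R.
Proof.
rewrite /f; apply: le_trans (ler_normB _ _) _; rewrite !normrM.
have H1 := ler_wpM2l (normr_ge0 C2) (th1 i s).
have H2 := ler_wpM2l (normr_ge0 C1) (th'1 s).
by rewrite mulr1 in H1; rewrite mulr1 in H2; exact: lerD.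
Qed.

Let if_ : lam.-integrable setT (EFin \o f).
Proof. exact: (bounded_supp_integrable (measurable_smooth1 sf) fC f_supp). Qed.

Let int_f : \int[lam]_s (f s)%:E = 0.
Proof.
have i1 : lam.-integrable setT (fun s => C2%:E * (th i s)%:E) by exact: (integrableZl measurableT C2 ith).
have i2 : lam.-integrable setT (fun s => C1%:E * (th' s)%:E) by exact: (integrableZl measurableT C1 ith').
transitivity (\int[lam]_s (C2%:E * (th i s)%:E - C1%:E * (th' s)%:E)).
  by apply: eq_integral => s _; rewrite /f EFinB !EFinM.
rewrite (integralB measurableT i1 i2) (integralZl measurableT ith) (integralZl measurableT ith').
by rewrite C1E C2E -!EFinM -EFinB mulrC subrr.
Qed.

(** The primitive of f vanishes to the left of the support of f, and to the right
    because f has zero integral. *)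
Let exists_chi : exists chi : R -> R, [/\ smooth1 chi, (forall x : R, is_derive x 1 chi (f x))%R,
  forall x, chi x != 0%R -> (a i + h <= x <= b i - h)%R &
  forall x, \int[lam]_(s in `]x, +oo[) (f s)%:E = - (chi x)%:E].
Proof.
have [chi [schi dchi chiE]] := smooth1_primitive sf f_supp.
have I1 x : lam.-integrable `]-oo, x] (EFin \o f).
  by apply: integrableS if_ => //; exact: measurable_itv.
have I2 x : lam.-integrable `]x, +oo[ (EFin \o f).
  by apply: integrableS if_ => //; exact: measurable_itv.
have chiE' x : \int[lam]_(s in `]-oo, x]) (f s)%:E = (chi x)%:E.
  by rewrite chiE /Rintegral fineK//; apply: integrable_fin_num (I1 x).
have add x : \int[lam]_(s in `]-oo, x]) (f s)%:E + \int[lam]_(s in `]x, +oo[) (f s)%:E = 0.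
  rewrite -integral_setU.
  - rewrite -[RHS]int_f; congr (integral _ _ _).
    by rewrite -itv_bndbnd_setU//= set_itvNyy.
  - exact: measurable_itv.
  - exact: measurable_itv.
  - by apply: measurable_funTS; exact: measurable_int if_.
  - apply/disj_setPS => s /=; rewrite !in_itv/= => -[sx /andP[xs _]].
    by move: (le_lt_trans sx xs); rewrite ltxx.
have chiT x : \int[lam]_(s in `]x, +oo[) (f s)%:E = - (chi x)%:E.
  have := add x; rewrite chiE'.
  have : \int[lam]_(s in `]x, +oo[) (f s)%:E \is a fin_num.
    by apply: integrable_fin_num (I2 x).
  case: (\int[lam]_(s in _) _) => [r| |]// _ /eqP.
  by rewrite -EFinD eqe addr_eq0 => /eqP ->; rewrite -EFinN opprK.
exists chi; split => // x; apply: contraNT; rewrite negb_and -!ltNge => /orP[xa|bx].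
  rewrite -eqe -chiE'; apply/eqP; apply: integral0_eq => s /=; rewrite in_itv/= => sx.
  have [->//|/f_supp/andP[H _]] := eqVneq (f s) 0%R.
  by move: (lt_trans H (le_lt_trans sx xa)); rewrite ltxx.
rewrite -oppr_eq0 -eqe EFinN -chiT; apply/eqP; apply: integral0_eq => s /=; rewrite in_itv/= andbT => xs.
have [->//|/f_supp/andP[_ H]] := eqVneq (f s) 0%R.
by move: (lt_trans H (lt_trans bx xs)); rewrite ltxx.
Qed.

Let eta_update x r : eta (update x i r) = eta x.
Proof. by apply: eq_bigr => j ji; rewrite update_neq. Qed.

Let eta01 x : (0 <= eta x <= 1)%R.
Proof.
rewrite /eta; apply: (big_ind (fun u : R => 0 <= u <= 1)%R); first by rewrite ler01 lexx.
  by move=> u v /andP[u0 u1] /andP[v0 v1]; rewrite mulr_ge0//= mulr_ile1.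
by move=> j _; exact: th01.
Qed.

Let meta : measurable_fun setT eta.
Proof.
have E : eta = fun x => (\prod_(j < n) (if j != i then th j (x ord0 j) else 1))%R.
  by apply/funext => x; rewrite /eta big_mkcond.
rewrite E; apply: measurable_prod => j _; case: (j != i); last exact: measurable_cst.
apply: (@measurableT_comp _ _ _ _ _ _ (th j)); first exact: measurable_smooth1.
exact: measurable_coordR.
Qed.

Let mth1 (g : R -> R) : smooth1 g -> measurable_fun setT (fun x : 'rV[R]_n => g (x ord0 i)).
Proof.
move=> sg; apply: (@measurableT_comp _ _ _ _ _ _ g); first exact: measurable_smooth1.
exact: measurable_coordR.
Qed.

Let eta_mul_bound (g : R -> R) (C : R) : (forall s, (`|g s| <= C)%R) ->
  forall x : 'rV[R]_n, (`|eta x * g (x ord0 i)| <= C)%R.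
Proof.
move=> gC x; rewrite normrM; have /andP[e0 e1] := eta01 x.
by rewrite (ger0_norm e0); apply: le_trans (gC (x ord0 i)); rewrite ler_piMl.
Qed.

Let integrable_eta (V : 'rV[R]_n -> R) (g : R -> R) (C : R) :
  mu.-integrable setT (EFin \o V) -> smooth1 g -> (forall s, (`|g s| <= C)%R) ->
  mu.-integrable setT (EFin \o (fun x => V x * (eta x * g (x ord0 i)))%R).
Proof.
move=> iV sg gC; apply: (integrable_mul_bounded (C := C) iV).
  by apply: measurable_funM => //; exact: mth1.
exact: eta_mul_bound.
Qed.

(** Testing the weak equation for U with eta * chi, and computing the same integral
    for J by Fubini, shows that W is orthogonal to eta * f. Spelled out, this says
    that D integrates to zero against a product of one-dimensional functions. *)
Lemma block_test_zero :
  \int[mu2]_z (D z * (\prod_(j < n) th j (z.1 ord0 j) * th' z.2))%:E = 0.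
Proof.
have [chi [schi dchi chi_supp chiT]] := exists_chi.
have prodE (x : 'rV[R]_n) : (\prod_(j < n) th j (x ord0 j) = th i (x ord0 i) * eta x)%R.
  by rewrite (bigD1 i).
pose phi (x : 'rV[R]_n) := (eta x * chi (x ord0 i))%R.
have chiC s : (`|chi s| <= fine (\int[lam]_r `|(f r)%:E|))%R.
  have fin : \int[lam]_r `|(f r)%:E| \is a fin_num.
    exact: (integrable_fin_num measurableT (integrable_abse if_)).
  rewrite -lee_fin fineK// -abse_EFin -abseN -chiT.
  apply: le_trans (le_abse_integral _ _ _) _; first exact: measurable_itv.
    by apply: measurable_funTS; exact: measurable_int if_.
  exact: ge0_subset_integral_nm.
have iphi := integrable_eta iG schi chiC.
have sphi : smooth phi.
  apply: smoothV_smooth; rewrite (_ : phi = fun x : 'rV[R]_n =>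
      (\prod_(j < n) (if j == i then chi else th j) (x ord0 j))%R).
    by apply: smoothV_prod => j; apply: smoothV_coord; case: ifP.
  apply/funext => x; rewrite (bigD1 i)//= eqxx mulrC; congr (_ * _)%R.
  by apply: eq_bigr => j ji; rewrite (negbTE ji).
have phi_supp x : phi x != 0%R -> closed_box (fun j => a j + h)%R (fun j => b j - h)%R x.
  rewrite mulf_eq0 negb_or => /andP[/prodf_neq0 He Hc] j.
  have [->|ji] := eqVneq j i; first exact: chi_supp.
  by have /th_supp/andP[H1 H2] := He j ji; rewrite !ltW.
have dphi x : ('D_(e_ i) phi x = eta x * f (x ord0 i))%R.
  rewrite derive_coord (_ : (fun s => phi (update x i s)) = fun s => (eta x * chi s)%R).
    by rewrite derive_scale//; have [_ ->] := dchi (x ord0 i).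
  by apply/funext => s; rewrite /phi eta_update updateE.
have Hweak := weak h0 sphi phi_supp.
have {}Hweak : \int[mu]_x (U x * (eta x * f (x ord0 i)))%:E = - \int[mu]_x (G x * phi x)%:E.
  by rewrite -Hweak; apply: eq_integral => x _; rewrite dphi.
(* J satisfies the same weak equation as U *)
have HJ : \int[mu]_x (J x * (eta x * f (x ord0 i)))%:E = - \int[mu]_x (G x * phi x)%:E.
  pose k (x : 'rV[R]_n) := (eta x * f (x ord0 i))%R.
  have mk : measurable_fun setT k by apply: measurable_funM => //; exact: mth1.
  have kC := eta_mul_bound fC.
  transitivity (\int[mu2]_z (hJ z * k z.1)%:E); first by rewrite (fubini_weight ihJ mk kC).
  pose kk (z : T) := (kJ z * (eta z.1 * f z.2))%R.
  have mkk : measurable_fun setT (fun z : T => (eta z.1 * f z.2)%R).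
    apply: measurable_funM; first exact: measurableT_comp.
    apply: (@measurableT_comp _ _ _ _ _ _ f); first exact: measurable_smooth1.
    exact: measurable_snd.
  have ikk : mu2.-integrable setT (EFin \o kk).
    apply: (integrable_mul_bounded (C := (`|C2| + `|C1|)%R) ikJ mkk) => z.
    rewrite normrM; have /andP[e0 e1] := eta01 z.1.
    by rewrite (ger0_norm e0); apply: le_trans (fC z.2); rewrite ler_piMl.
  transitivity (\int[mu2]_z (kk z)%:E).
    rewrite (integral_swap_coord i (measurable_int _ ikk)); apply: eq_integral => z _ /=.
    by rewrite /kk /k /hJ /= eta_update.
  rewrite -(integral12_prod_meas1 ikk).
  have inner x : fubini_F lam (EFin \o kk) x = - (G x * phi x)%:E.
    rewrite /fubini_F /=.
    have [Bx|Bx] := pselect (open_box a b x); last first.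
      rewrite (G0 Bx) mul0r oppr0 (eq_integral (cst 0)) ?integral0// => r _.
      by rewrite /kk /kJ /= (G0 Bx) !mul0r.
    transitivity (\int[lam]_(r in `[x ord0 i, +oo[) ((G x * eta x)%:E * (f r)%:E)).
      apply: ae_eq_integral_nm; apply: aeW => r; rewrite patch_setT patchE /kk /kJ /=.
      have [->|fr] := eqVneq (f r) 0%R; first by rewrite !mulr0 mule0; case: ifP.
      have /andP[H1 H2] := f_supp fr.
      have rI : (a i < r < b i)%R.
        by rewrite (lt_trans _ H1) ?ltrDl//= (lt_trans H2)// ltrBlDr ltrDl.
      rewrite indicE; case: (boolP (r \in `[x ord0 i, +oo[%classic)) => [/set_mem/=|/negP].
        rewrite in_itv/= andbT => xr; rewrite mem_set/=; last by split.
        by rewrite mulr1 mulrA.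
      rewrite inE/= in_itv/= andbT => xr; rewrite memNset/= ?mulr0 ?mul0r//.
      by move=> [_].
    have mf' D' : measurable_fun D' (EFin \o f).
      by apply: measurable_funTS; exact: measurable_int if_.
    rewrite -integral_itv_obnd_cbnd; last first.
      by apply: measurable_funeM; exact: mf'.
    have I2 : lam.-integrable `]x ord0 i, +oo[ (EFin \o f).
      by apply: integrableS if_ => //; exact: measurable_itv.
    rewrite integralZl// chiT -EFinM; congr (_%:E); rewrite /phi; ring.
  under eq_integral do rewrite inner.
  by rewrite integralN// integrable_add_def.
(* both halves of D factorize; the coordinate exchange maps one to the other *)
pose g (z : T) := (W z.1 * (eta z.1 * th i (z.1 ord0 i)) * th' z.2)%R.
pose g' (z : T) := (W z.1 * (eta z.1 * th' (z.1 ord0 i)) * th i z.2)%R.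
have iWth := integrable_eta iW (sth i) (th1 i).
have iWth' := integrable_eta iW sth' th'1.
have ig : mu2.-integrable setT (EFin \o g) by exact: (integrable_tensor iWth ith').
have ig' : mu2.-integrable setT (EFin \o g') by exact: (integrable_tensor iWth' ith).
have ig's := integrable_swap_coord i ig'.
transitivity (\int[mu2]_z ((EFin \o g) z - (EFin \o g') (swap_coord i z))).
  apply: eq_integral => z _; rewrite -EFinB; congr EFin.
  have I01E s : (a i + h < s < b i - h)%R -> I01 s = 1%R.
    move=> /andP[H1 H2]; rewrite /I01 indicE mem_set//= in_itv/=.
    by rewrite (lt_trans _ H1) ?ltrDl//= (lt_trans H2)// ltrBlDr ltrDl.
  have E1 : (I01 z.2 * th' z.2 = th' z.2)%R.
    by have [->|/th'_supp/I01E ->] := eqVneq (th' z.2) 0%R; rewrite ?mulr0 ?mul1r.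
  have E2 : (I01 (z.1 ord0 i) * th i (z.1 ord0 i) = th i (z.1 ord0 i))%R.
    by have [->|/th_supp/I01E ->] := eqVneq (th i (z.1 ord0 i)) 0%R; rewrite ?mulr0 ?mul1r.
  rewrite prodE /D /g /g' /= eta_update updateE.
  transitivity (W z.1 * (eta z.1 * th i (z.1 ord0 i)) * (I01 z.2 * th' z.2) -
    W (update z.1 i z.2) * (eta z.1 * th' z.2) * (I01 (z.1 ord0 i) * th i (z.1 ord0 i)))%R.
    by ring.
  by rewrite E1 E2.
rewrite (integralB measurableT ig ig's) -(integral_swap_coord i (measurable_int _ ig')).
rewrite (integral_tensor iWth ith') (integral_tensor iWth' ith) C1E C2E.
have iUf := integrable_eta iU sf fC. have iJf := integrable_eta iJ sf fC.
transitivity (\int[mu]_x (U x * (eta x * f (x ord0 i)))%:E - \int[mu]_x (J x * (eta x * f (x ord0 i)))%:E); last first.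
  by rewrite Hweak HJ subee// fin_numN; exact: (integrable_fin_num measurableT iphi).
rewrite -(integralB measurableT iUf iJf) muleC (muleC _ C1%:E).
rewrite -(integralZl measurableT iWth) -(integralZl measurableT iWth').
rewrite -(integralB measurableT (integrableZl measurableT C2 iWth) (integrableZl measurableT C1 iWth')).
apply: eq_integral => x _; rewrite /= -!EFinM -!EFinB; congr EFin.
rewrite /W /f; ring.
Qed.

End one_test.

Let D_outside z : ~ open_block a b (a i) (b i) z -> D z = 0%R.
Proof.
case: z => x r Hz; rewrite /D /=.
have up y : open_box a b (update x i y) -> (a i < x ord0 i < b i)%R -> open_box a b x.
  move=> H Hi j; have [->//|ji] := eqVneq j i.
  by have := H j; rewrite update_neq.
have I01E y : I01 y = ((a i < y < b i)%R%:R)%R.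
  rewrite /I01 indicE; congr ((nat_of_bool _)%:R)%R.
  by apply/idP/idP => [/set_mem/=|H]; [rewrite in_itv|rewrite mem_set//= in_itv].
rewrite !I01E.
have [Hr|Hr] := boolP (a i < r < b i)%R; last first.
  rewrite mulr0 W0 ?mul0r ?subr0// => H; move/negP: Hr; apply.
  by have := H i; rewrite updateE.
have Hx : ~ open_box a b x by move=> Hx; apply: Hz.
rewrite (W0 Hx) mul0r; have [Hi|Hi] := boolP (a i < x ord0 i < b i)%R; last by rewrite mulr0 subr0.
by rewrite W0 ?mul0r ?subr0// => /up /(_ Hi).
Qed.

(** Intersecting with the box first makes the smooth bumps admissible. *)
Lemma line_identity_block c d c' d' : \int[mu2]_(z in open_block c d c' d') (D z)%:E = 0.
Proof.
pose c1 j := Num.max (a j) (c j); pose d1 j := Num.min (b j) (d j).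
pose c2 := Num.max (a i) c'; pose d2 := Num.min (b i) d'.
transitivity (\int[mu2]_(z in open_block c1 d1 c2 d2) (D z)%:E).
  apply: ae_eq_integral_nm; apply: aeW => z; rewrite !patchE.
  have [Hz|Hz] := pselect (open_block a b (a i) (b i) z); last first.
    by rewrite D_outside//; do 2 case: ifP.
  suff -> : (z \in open_block c d c' d') = (z \in open_block c1 d1 c2 d2) by [].
  case: z Hz => x r [/= H1 /andP[H2 H3]].
  apply/idP/idP; rewrite !inE/= /c1 /d1 /c2 /d2 => -[H4 H5]; split.
  - move=> j; have /andP[? ?] := H1 j; have /andP[? ?] := H4 j.
    by rewrite gt_max lt_min; apply/andP; split; apply/andP; split.
  - by move: H5 => /andP[? ?]; rewrite gt_max lt_min; apply/andP; split; apply/andP; split.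
  - by move=> j; have := H4 j; rewrite gt_max lt_min => /andP[/andP[_ ->] /andP[_ ->]].
  - by move: H5; rewrite gt_max lt_min => /andP[/andP[_ ->] /andP[_ ->]].
apply: block_bump_limit => // k.
apply: (@block_test_zero (fun j => inner_window (c1 j) (d1 j) k) (inner_window c2 d2 k) k.+1%:R^-1).
- by rewrite invr_gt0.
- by move=> j; exact: smooth1_inner_window.
- exact: smooth1_inner_window.
- by move=> j t; exact: inner_window01.
- by move=> t; exact: inner_window01.
- move=> j t /inner_window_neq0/andP[H1 H2].
  apply/andP; split; first by apply: le_lt_trans H1; rewrite lerD2r le_max lexx.
  by apply: (lt_le_trans H2); rewrite lerD2r ge_min lexx.
- move=> t /inner_window_neq0/andP[H1 H2].
  apply/andP; split; first by apply: le_lt_trans H1; rewrite lerD2r le_max lexx.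
  by apply: (lt_le_trans H2); rewrite lerD2r ge_min lexx.
Qed.

(** For almost every x the function W is constant on the line through x, so U
    agrees there almost everywhere with an absolutely continuous function whose
    derivative is G. *)
Lemma line_identity : \forall x \ae mu, \forall r \ae lam, D (x, r) = 0%R.
Proof.
have H : \forall z \ae mu2, (EFin \o D) z = 0.
  apply: (@ae_eq0_blocks R n (EFin \o D) a b (a i) (b i)) => //.
    by move=> z Hz /=; rewrite D_outside.
  exact: line_identity_block.
have := ae_product1 H; apply: filterS => x; apply: filterS => r /= /eqP.
by rewrite eqe => /eqP.
Qed.

(** [line_gagliardo] for a truncation of U, which is Lipschitz and therefore grows
    along lines no faster than U itself. Where the truncation vanishes its power
    s - 1 > 0 does too, so the gradient counts only on the set where it does not. *)
Lemma slice_gagliardo (s M : R) (tr : R -> R) : (1 < s)%R -> (a i < b i)%R ->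
  measurable_fun setT tr -> (forall y, (0 <= tr y)%R) -> (forall y, (tr y <= M)%R) ->
  (forall y y', (`|tr y - tr y'| <= `|y - y'|)%R) ->
  \forall x \ae mu, open_box a b x -> (tr (U x) `^ s)%:E <=
    \int[lam]_(r in `]a i, b i[) (s * (tr (U (update x i r)) `^ (s - 1) *
      (tr (U (update x i r)) / (b i - a i) +
       `|G (update x i r)| * (tr (U (update x i r)) != 0)%R%:R)))%:E.
Proof.
move=> s1 ab mtr tr0 trM trL.
have iGI : mu2.-integrable setT (fun z : T => (G z.1 * I01 z.2)%:E) by exact: integrable_tensor.
have := ae_integrable1 (integrable_swap_coord i iGI).
apply: filterS2 line_identity => x HD /= Hint Bx.
have Bi : (a i < x ord0 i < b i)%R by exact: Bx.
have I01E y : (a i < y < b i)%R -> I01 y = 1%R.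
  by move=> Hy; rewrite /I01 indicE mem_set//= in_itv.
pose g r := G (update x i r).
have ig : lam.-integrable setT (fun r => (g r)%:E).
  move: Hint; apply: eq_integrable => // r _.
  by rewrite /swap_coord /= I01E// mulr1.
have mup : measurable_fun setT (fun r : measurableTypeR R => update x i r).
  apply: measurable_fun_rVP => j.
  rewrite (_ : (fun r => _) = if j == i then id else cst (x ord0 j)); last first.
    by apply/funext => r; rewrite mxE; case: eqP.
  by case: eqP => _; [exact: measurable_id|exact: measurable_cst].
have igS (A : set (measurableTypeR R)) : measurable A -> lam.-integrable A (EFin \o g).
  by move=> mA; apply: integrableS ig.
have JE r : (a i < r < b i)%R -> J (update x i r) = fine (\int[lam]_(z in `]-oo, r]) (g z)%:E).
  move=> Hr; rewrite /J; congr fine; apply: ae_eq_integral_nm; apply: aeW => z.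
  rewrite patch_setT patchE /hJ /kJ /swap_coord /= update_update updateE -/(g z) indicE.
  have -> : (z \in `]-oo, r]%classic) = (z <= r)%R.
    by apply/idP/idP => [/set_mem/=|H]; [rewrite in_itv|rewrite mem_set//= in_itv].
  case: ifP => zr; first by rewrite mem_set ?mulr1//=; split => //; rewrite updateE.
  by rewrite memNset ?mulr0// => -[_ /=]; rewrite updateE zr.
have Jgrowth y z : (a i < y)%R -> (y <= z)%R -> (z < b i)%R ->
    (`|J (update x i z) - J (update x i y)|%R)%:E <= \int[lam]_(r in `]y, z]) (`|g r|%R)%:E.
  move=> ay yz zb.
  rewrite !JE ?(lt_le_trans ay yz) ?ay ?(le_lt_trans yz zb)//.
  have mI (u v : itv_bound R) : measurable ([set` Interval u v] : set (measurableTypeR R)) by exact: measurable_itv.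
  have F1 := integrable_fin_num (mI _ _) (igS _ (mI -oo%O (BRight y))).
  have F2 := integrable_fin_num (mI _ _) (igS _ (mI (BRight y) (BRight z))).
  have -> : \int[lam]_(w in `]-oo, z]) (g w)%:E =
      \int[lam]_(w in `]-oo, y]) (g w)%:E + \int[lam]_(w in `]y, z]) (g w)%:E.
    rewrite -integral_setU.
    - by rewrite -itv_bndbnd_setU.
    - exact: mI.
    - exact: mI.
    - by apply: measurable_funTS; exact: measurable_int ig.
    - apply/disj_setPS => w /=; rewrite !in_itv/= => -[wy /andP[yw _]].
      by move: (le_lt_trans wy yw); rewrite ltxx.
  rewrite fineD// addrAC subrr add0r -abse_EFin fineK//.
  apply: le_abse_integral; first exact: mI.
  by apply: measurable_funTS; exact: measurable_int ig.
(* the absolutely continuous representative of U on the line through x *)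
pose F r := (U x - J x + J (update x i r))%R.
have mF : measurable_fun setT (fun r : R => tr (F r)).
  apply: (@measurableT_comp _ _ _ _ _ _ tr) => //.
  apply: measurable_funD => //.
  exact: (measurableT_comp mJ mup).
have mg : measurable_fun setT (fun r : R => `|g r|%R).
  by apply: measurableT_comp => //; exact: (measurableT_comp mG mup).
have gfin : \int[lam]_(r in `]a i, b i[) (`|g r|%R)%:E < +oo.
  have [_] := integrableP _ _ _ ig; apply: le_lt_trans.
  exact: ge0_subset_integral_nm.
have grow y z : (a i < y)%R -> (y <= z)%R -> (z < b i)%R ->
    (`|tr (F z) - tr (F y)|%R)%:E <= \int[lam]_(r in `]y, z]) (`|g r|%R)%:E.
  move=> ay yz zb; apply: le_trans (Jgrowth _ _ ay yz zb); rewrite lee_fin.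
  by apply: le_trans (trL _ _) _; rewrite /F opprD addrACA subrr add0r.
have xI : x ord0 i \in `]a i, b i[ by rewrite in_itv.
have := @line_gagliardo R (a i) (b i) s M (fun r => tr (F r)) (fun r => `|g r|%R) ab s1 mF mg
  (fun r => tr0 _) (fun r => trM _) (fun r => normr_ge0 _) gfin grow (x ord0 i) xI.
rewrite {1}/F update_id subrK => H; apply: (le_trans H).
rewrite le_eqVlt; apply/orP; left; apply/eqP; apply: ae_eq_integral_nm.
move: HD; apply: filterS => r HD; rewrite !patchE; case: ifPn => // /set_mem/=.
rewrite in_itv/= => Ir.
have FU : F r = U (update x i r).
  move: HD; rewrite /D /= !I01E// !mulr1 /W => /eqP; rewrite subr_eq0 => /eqP E.
  by rewrite /F E subrK.
rewrite FU; congr (_%:E); rewrite -/(g r).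
have [->|t0] := eqVneq (tr (U (update x i r))) 0%R; last by rewrite mulr1.
by rewrite powR0 ?mul0r// subr_eq0 gt_eqF.
Qed.

End lines.

(** * The parabolic embedding *)

Section truncation.
Context {R : realType}.
Implicit Types k M y : R.

(** The upper truncation at M only serves to keep the integrals finite. *)
Definition truncation k M y : R := Num.min (Num.max (y - k) 0) M.

Lemma truncation_ge0 k M y : 0 <= M -> 0 <= truncation k M y.
Proof. by move=> M0; rewrite le_min M0 le_max lexx orbT. Qed.

Lemma truncation_leM k M y : truncation k M y <= M.
Proof. by rewrite ge_min lexx orbT. Qed.

Lemma truncation_le k M y : truncation k M y <= Num.max (y - k) 0.
Proof. by rewrite ge_min lexx. Qed.

Lemma truncation_neq0 k M y : 0 <= M -> truncation k M y != 0 -> k < y.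
Proof.
move=> M0; apply: contraNT; rewrite -leNgt => yk.
by rewrite /truncation max_r ?subr_le0// min_l.
Qed.

Lemma truncation_lip k M y y' : `|truncation k M y - truncation k M y'| <= `|y - y'|.
Proof.
rewrite (_ : y - y' = (y - k) - (y' - k)); last by ring.
rewrite /truncation; move: (y - k) (y' - k) => u v {y y'}.
have lip_max : `|Num.max u 0 - Num.max v 0| <= `|u - v|.
  case: (leP u 0) => u0; case: (leP v 0) => v0; rewrite ler_norml;
    have := ler_norm (u - v); have := ler_norm (v - u); rewrite (distrC v); lra.
apply: le_trans lip_max; move: (Num.max u 0) (Num.max v 0) => {u v} u v.
case: (leP u M) => uM; case: (leP v M) => vM; rewrite ler_norml;
  have := ler_norm (u - v); have := ler_norm (v - u); rewrite (distrC v); lra.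
Qed.

Lemma measurable_truncation k M : measurable_fun setT (truncation k M).
Proof.
apply: measurable_minr; last exact: measurable_cst.
apply: measurable_maxr; last exact: measurable_cst.
by apply: measurable_funB.
Qed.

End truncation.

Section parabolic.
Context {R : realType} {n : nat}.
Local Notation lam := (@lebesgue_measure R).
Local Notation mu := (lebesgue_rV n.+2).
Local Notation T := ('rV[R]_n.+2 * measurableTypeR R)%type.
Local Notation e_ i := (delta_mx ord0 i : 'rV[R]_n.+2).

Variable p : 'I_n.+2 -> R.
Hypothesis p1 : forall i, 1 < p i.
Let N : R := n.+2%:R.
Let pb : R := mean_exponent p.
Hypothesis pbN : pb < N.
Local Notation q := (sobolev_conjugate p).
Local Open Scope ereal_scope.

(** The test functions stay at a positive distance e from the boundary. *)
Definition weak_gradient_on_box (a b : 'I_n.+2 -> R) (U : 'rV[R]_n.+2 -> R)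
    (G : 'I_n.+2 -> 'rV[R]_n.+2 -> R) :=
  [/\ mu.-integrable (open_box a b) (EFin \o U),
   forall i, mu.-integrable (open_box a b) (EFin \o G i) &
   forall i (phi : 'rV[R]_n.+2 -> R) (e : R), (0 < e)%R -> smooth phi ->
   (forall x, phi x != 0%R -> closed_box (fun j => a j + e)%R (fun j => b j - e)%R x) ->
   \int[mu]_(x in open_box a b) (U x * 'D_(e_ i) phi x)%:E =
   - \int[mu]_(x in open_box a b) (G i x * phi x)%:E].

Definition gradient_weight (a b : 'I_n.+2 -> R) (i : 'I_n.+2) (m g : R) : R :=
  (m / (b i - a i) + `|g| * (m != 0)%R%:R)%R.

Lemma sobolev_slice (a b : 'I_n.+2 -> R) (U : 'rV[R]_n.+2 -> R)
    (G : 'I_n.+2 -> 'rV[R]_n.+2 -> R) (k M : R) :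
  measurable_fun setT U -> (forall i, measurable_fun setT (G i)) ->
  (forall j, (a j < b j)%R) -> (0 <= M)%R -> weak_gradient_on_box a b U G ->
  (\int[mu]_(x in open_box a b) (truncation k M (U x) `^ q)%:E) `^ ((N - pb) / N) <=
  (troisi_constant p)%:E * \prod_(i < n.+2)
    (\int[mu]_(x in open_box a b)
      (gradient_weight a b i (truncation k M (U x)) (G i x) `^ p i)%:E) `^ (pb / (N * p i)).
Proof.
move=> mU mG ab M0 [iU iG weak].
set B := open_box a b in iU iG weak *.
have mB : measurable B by exact: measurable_open_box.
pose UB := U \_ B; pose GB i := G i \_ B.
have iUB : mu.-integrable setT (EFin \o UB).
  rewrite (_ : EFin \o UB = (EFin \o U) \_ B); first exact: (integrable_mkcond _ mB).1.
  by apply/funext => x /=; rewrite /UB !patchE; case: ifP.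
have iGB i : mu.-integrable setT (EFin \o GB i).
  rewrite (_ : EFin \o GB i = (EFin \o G i) \_ B); first exact: (integrable_mkcond _ mB).1 (iG i).
  by apply/funext => x /=; rewrite /GB !patchE; case: ifP.
have UBE x : B x -> UB x = U x by move=> Bx; rewrite /UB patchE mem_set.
have GBE i x : B x -> GB i x = G i x by move=> Bx; rewrite /GB patchE mem_set.
have UB0 x : ~ open_box a b x -> UB x = 0%R by move=> Bx; rewrite /UB patchE memNset.
have GB0 i x : ~ open_box a b x -> GB i x = 0%R by move=> Bx; rewrite /GB patchE memNset.
have weakB i (phi : 'rV[R]_n.+2 -> R) (e : R) : (0 < e)%R -> smooth phi ->
    (forall x, phi x != 0%R -> closed_box (fun j => a j + e)%R (fun j => b j - e)%R x) ->
    \int[mu]_x (UB x * 'D_(e_ i) phi x)%:E = - \int[mu]_x (GB i x * phi x)%:E.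
  move=> e0 sphi supp.
  transitivity (\int[mu]_(x in B) (U x * 'D_(e_ i) phi x)%:E).
    apply: ae_eq_integral_nm; apply: aeW => x; rewrite patch_setT patchE /UB patchE.
    by case: ifP; rewrite ?mul0r.
  rewrite (weak i phi e)//; congr (- _).
  apply: ae_eq_integral_nm; apply: aeW => x; rewrite patch_setT patchE /GB patchE.
  by case: ifP; rewrite ?mul0r.
pose m x := truncation k M (U x).
pose w i x := gradient_weight a b i (m x) (G i x).
have mm : measurable_fun setT m.
  by apply: (@measurableT_comp _ _ _ _ _ _ (truncation k M)) => //; exact: measurable_truncation.
have m0 x : (0 <= m x)%R by exact: truncation_ge0.
have w0 i x : (0 <= w i x)%R.
  apply: addr_ge0; last by rewrite mulr_ge0.
  by rewrite divr_ge0// subr_ge0 ltW.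
have mw i : measurable_fun setT (w i).
  apply: measurable_funD; first exact: measurable_funM.
  apply: measurable_funM; first by apply: measurableT_comp.
  rewrite (_ : (fun x => _) = (\1_[set x | m x != 0%R] : _ -> R)).
    apply: measurable_indic.
    rewrite (_ : [set x | m x != 0%R] = setT `&` m @^-1` (~` [set 0%R])).
      by apply: mm => //; apply: measurableC; exact: measurable_set1.
    by apply/seteqP; split => x /=; [move=> /eqP|move=> [_ /eqP]].
  by apply/funext => x; rewrite indicE mem_setE.
have Bfin : mu B < +oo.
  have -> : B = [set x | forall j, (`]a j, b j[%classic : set (measurableTypeR R)) (x ord0 j)].
    by apply/seteqP; split => x /= H j; have := H j; rewrite in_itv.
  rewrite (@lebesgue_rV_box R n.+2 (fun j => `]a j, b j[%classic)); last by move=> j; exact: measurable_itv.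
  rewrite (eq_bigr (fun j => (b j - a j)%:E)); first by rewrite prodEFin ltry.
  by move=> j _; rewrite /= lebesgue_measure_itv/= lte_fin ab EFinB.
apply: troisi_inequality => //; first by exists M => x; exact: truncation_leM.
move=> i; have s1 := gagliardo_exponent_gt1 p1 pbN i.
have := slice_gagliardo iUB (iGB i) UB0 (GB0 i) (weakB i) s1 (ab i) (measurable_truncation k M)
  (fun y => truncation_ge0 k y M0) (truncation_leM k M) (truncation_lip k M).
apply: filterS => x H Bx; have := H Bx; rewrite UBE// => {}H; apply: (le_trans H).
rewrite le_eqVlt; apply/orP; left; apply/eqP.
rewrite /line_integral; apply: ae_eq_integral_nm; apply: aeW => r.
rewrite patch_setT patchE indicE.
have -> : (r \in `]a i, b i[%classic) = (update x i r \in B).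
  apply/idP/idP => [/set_mem/=|/set_mem H'].
    rewrite in_itv/= => Hr; rewrite mem_set// => j.
    by have [->|ji] := eqVneq j i; [rewrite updateE|rewrite update_neq//; exact: Bx].
  by rewrite mem_set//= in_itv/=; have := H' i; rewrite updateE.
case: ifP => [/set_mem HB|_]; last by rewrite mulr0.
by rewrite mulr1 UBE// GBE.
Qed.

(** The exponent l = pb (1 + 2 / N) reached by combining the bound in L^2 that is
    uniform in time with the Sobolev inequality in space. *)
Definition parabolic_exponent : R := (pb * (N + 2) / N)%R.
Local Notation l := parabolic_exponent.

Let mu2 := (mu \x lam)%E.
Let Q (a b : 'I_n.+2 -> R) (t1 t2 : R) : set T := open_box a b `*` `]t1, t2[%classic.

Let pb0 : (0 < pb)%R. Proof. exact: mean_exponent_gt0. Qed.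
Let N0 : (0 < N)%R. Proof. by []. Qed.

Lemma parabolic_exponent_gt0 : (0 < l)%R.
Proof. by rewrite /l divr_gt0// mulr_gt0// addr_gt0. Qed.

(** Hoelder between the powers 2 and q, with weights pb / N and (N - pb) / N. *)
Lemma interpolation_slice (B : set 'rV[R]_n.+2) (m : 'rV[R]_n.+2 -> R) :
  measurable B -> measurable_fun setT m -> (forall x, (0 <= m x)%R) ->
  \int[mu]_(x in B) (m x `^ l)%:E <=
  (\int[mu]_(x in B) (m x ^+ 2)%:E) `^ (pb / N) *
  (\int[mu]_(x in B) (m x `^ q)%:E) `^ ((N - pb) / N).
Proof.
move=> mB mm m0.
have th0 : (0 < pb / N)%R by rewrite divr_gt0.
have th1 : (0 < (N - pb) / N)%R by rewrite divr_gt0// subr_gt0.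
have th01 : (pb / N + (N - pb) / N = 1)%R by rewrite -mulrDl addrC subrK mulfV// gt_eqF.
have mX a : measurable_fun setT (fun x => m x `^ a)%R.
  by exact: (@measurableT_comp _ _ _ _ _ _ (@powR R ^~ a)).
rewrite (integral_mul_indic _ B (fun x => m x `^ l)%R).
rewrite (integral_mul_indic _ B (fun x => m x ^+ 2)%R) (integral_mul_indic _ B (fun x => m x `^ q)%R).
have mI : measurable_fun [set: 'rV[R]_n.+2] (\1_B : _ -> R) by exact: measurable_indic.
apply: (le_trans _ (hoelder_ereal _ _ _ _ _ th0 th1 th01)).
- rewrite le_eqVlt; apply/orP; left; apply/eqP; apply: eq_integral => x _.
  rewrite indicE; case: (x \in B); last by rewrite !mulr0 poweR0r ?gt_eqF// mul0e.
  rewrite !mulr1 !poweR_EFin -EFinM -(powR_mulrn 2 (m0 x)) -!powRrM; congr EFin.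
  have d0 : (N - pb != 0)%R by rewrite gt_eqF// subr_gt0.
  have d1 : (N != 0)%R by rewrite gt_eqF.
  have lE : (l = 2 * (pb / N) + q * ((N - pb) / N))%R.
    rewrite /l /sobolev_conjugate -/N -/pb; move: (N) d0 d1 => N' d0 d1; field.
    by rewrite d0 d1.
  rewrite lE powRD//; apply/implyP => /eqP H; exfalso.
  have := parabolic_exponent_gt0; rewrite lE H ltxx; by [].
- by move=> x; rewrite lee_fin mulr_ge0 ?sqr_ge0.
- by move=> x; rewrite lee_fin mulr_ge0 ?powR_ge0.
- by apply/measurable_EFinP; apply: measurable_funM => //; exact: measurable_funX.
- by apply/measurable_EFinP; apply: measurable_funM.
Qed.

Lemma sum_parabolic_weights : (\sum_(i < n.+2) pb / (N * p i) = 1)%R.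
Proof.
under eq_bigr do rewrite invfM mulrA.
rewrite -mulr_sumr sum_inv_exponent -/N -/pb -(invf_div N pb) mulVf//.
by rewrite gt_eqF// divr_gt0.
Qed.

(** On almost every time slice [interpolation_slice] bounds the power l by the L^2
    norm, at most E, and the Sobolev norm, whose power (N - pb) / N is a product of
    gradient integrals with weights of sum 1. Hoelder in time then integrates the
    product. *)
Lemma parabolic_embedding_truncated (a b : 'I_n.+2 -> R) (t1 t2 : R) (U : T -> R)
    (G : 'I_n.+2 -> T -> R) (k M E F : R) :
  measurable_fun setT U -> (forall i, measurable_fun setT (G i)) ->
  (forall j, (a j < b j)%R) -> (0 <= M)%R -> (0 <= E)%R -> (0 <= F)%R ->
  (\forall t \ae lam, (t1 < t < t2)%R ->
    weak_gradient_on_box a b (fun x => U (x, t)) (fun i x => G i (x, t))) ->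
  (\forall t \ae lam, (t1 < t < t2)%R ->
    \int[mu]_(x in open_box a b) (Num.max (U (x, t) - k) 0 ^+ 2)%:E <= E%:E) ->
  (forall i, \int[mu2]_(z in Q a b t1 t2)
     (gradient_weight a b i (truncation k M (U z)) (G i z) `^ p i)%:E <= F%:E) ->
  \int[mu2]_(z in Q a b t1 t2) (truncation k M (U z) `^ l)%:E <=
  (troisi_constant p * E `^ (pb / N) * F)%:E.
Proof.
move=> mU mG ab M0 E0 F0 Hweak HE HF.
pose m z := truncation k M (U z).
pose w i z := gradient_weight a b i (m z) (G i z).
have mB : measurable (open_box a b) by exact: measurable_open_box.
have mQ : measurable (Q a b t1 t2).
  by apply: measurableX => //; exact: measurable_itv.
have mm : measurable_fun setT m.
  by apply: (@measurableT_comp _ _ _ _ _ _ (truncation k M)) => //; exact: measurable_truncation.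
have m0 z : (0 <= m z)%R by exact: truncation_ge0.
have w0 i z : (0 <= w i z)%R.
  apply: addr_ge0; last by rewrite mulr_ge0.
  by rewrite divr_ge0// subr_ge0 ltW.
have mw i : measurable_fun setT (w i).
  apply: measurable_funD; first exact: measurable_funM.
  apply: measurable_funM; first by apply: measurableT_comp.
  rewrite (_ : (fun x => _) = (\1_[set x | m x != 0%R] : _ -> R)).
    apply: measurable_indic.
    rewrite (_ : [set x | m x != 0%R] = setT `&` m @^-1` (~` [set 0%R])).
      by apply: mm => //; apply: measurableC; exact: measurable_set1.
    by apply/seteqP; split => x /=; [move=> /eqP|move=> [_ /eqP]].
  by apply/funext => x; rewrite indicE mem_setE.
have mX (f : T -> R) e : measurable_fun setT f -> measurable_fun setT (fun x => f x `^ e)%R.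
  by move=> mf; exact: (@measurableT_comp _ _ _ _ _ _ (@powR R ^~ e)).
have mI : measurable_fun [set: T] (\1_(Q a b t1 t2) : _ -> R) by exact: measurable_indic.
pose A i (z : T) : \bar R := (w i z `^ p i * \1_(Q a b t1 t2) z)%:E.
have mA i : measurable_fun setT (A i).
  by apply/measurable_EFinP; apply: measurable_funM => //; exact: mX.
have A0 i z : 0 <= A i z by rewrite lee_fin mulr_ge0 ?powR_ge0.
pose L (z : T) : \bar R := (m z `^ l * \1_(Q a b t1 t2) z)%:E.
have mL : measurable_fun setT L.
  by apply/measurable_EFinP; apply: measurable_funM => //; exact: mX.
have L0 z : 0 <= L z by rewrite lee_fin mulr_ge0 ?powR_ge0.
have slice (f : T -> R) t : \int[mu]_x (f (x, t) * \1_(Q a b t1 t2) (x, t))%:E =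
    if (t1 < t < t2)%R then \int[mu]_(x in open_box a b) (f (x, t))%:E else 0.
  case: ifP => Ht; last first.
    rewrite (eq_integral (cst 0)) ?integral0// => x _.
    by rewrite indicE memNset ?mulr0// => -[_] /=; rewrite in_itv/= Ht.
  rewrite (integral_mul_indic _ (open_box a b) (fun x => f (x, t))).
  apply: eq_integral => x _; rewrite !indicE; congr ((_ * (nat_of_bool _)%:R)%:E).
  apply/idP/idP => /set_mem H; apply: mem_set; first by case: H.
  by split; [exact: H|rewrite /= in_itv].
rewrite (integral_mul_indic _ (Q a b t1 t2) (fun z => m z `^ l)%R) (fubini_tonelli2 L mL L0).
have th0 i : (0 < pb / (N * p i))%R by rewrite divr_gt0// mulr_gt0// (lt_trans ltr01).
pose At i (t : measurableTypeR R) : \bar R := \int[mu]_x A i (x, t).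
have mAt i : measurable_fun setT (At i).
  exact: (measurable_fun_fubini_tonelli_G (m1 := mu) _ (mA i) (A0 i)).
have At0 i t : 0 <= At i t by exact: integral_ge0.
have K0 : (0 <= troisi_constant p * E `^ (pb / N))%R.
  by rewrite mulr_ge0 ?powR_ge0// ltW// troisi_constant_gt0.
apply: (@le_trans _ _ (\int[lam]_t ((troisi_constant p * E `^ (pb / N))%:E *
    \prod_(i < n.+2) At i t `^ (pb / (N * p i))))).
  apply: ge0_ae_le_integral_nm.
  - by move=> t _; apply: integral_ge0.
  - by move=> t _; rewrite mule_ge0// prode_ge0// => i _; exact: poweR_ge0.
  apply: (@filterS2 _ _ (ae_filter_ringOfSetsType lam) _ _ _ _ HE Hweak) => t HEt Hwt; rewrite !patch_setT /fubini_G /=.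
  have prod0 : 0 <= \prod_(i < n.+2) At i t `^ (pb / (N * p i)).
    by apply: prode_ge0 => i _; exact: poweR_ge0.
  rewrite (slice (fun z => m z `^ l)%R t); case: ifP => Ht; last by rewrite mule_ge0.
  have mUt : measurable_fun setT (fun x => U (x, t)) by exact: measurableT_comp.
  have mGt i : measurable_fun setT (fun x => G i (x, t)) by exact: measurableT_comp.
  have mmt : measurable_fun setT (fun x => m (x, t)) by exact: measurableT_comp.
  apply: (le_trans (interpolation_slice mB mmt (fun x => m0 (x, t)))).
  rewrite EFinM -muleA (muleCA (troisi_constant p)%:E); apply: lee_pmul; rewrite ?poweR_ge0//.
    rewrite -poweR_EFin; apply: lee_poweR2r; first by rewrite divr_ge0// ltW.
      by apply: integral_ge0 => x _; rewrite lee_fin sqr_ge0.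
    apply: le_trans (HEt Ht); apply: ge0_le_integral_nm => x _; rewrite lee_fin ?sqr_ge0//.
    apply: lerXn2r; rewrite ?nnegrE//; first by rewrite le_max lexx orbT.
    exact: truncation_le.
  have := sobolev_slice k mUt mGt ab M0 (Hwt Ht); rewrite -/N -/pb.
  move=> /le_trans; apply; apply: lee_pmul => //.
  - by rewrite lee_fin ltW// troisi_constant_gt0.
  - by apply: prode_ge0 => i _; exact: poweR_ge0.
  - apply: lee_prode => i; first exact: poweR_ge0.
    by rewrite /At /A (slice (fun z => w i z `^ p i)%R t) Ht.
rewrite ge0_integralZl//; last 2 first.
- by apply: measurable_prode => i; apply: emeasurable_funX; exact: mAt.
- by move=> t _; apply: prode_ge0 => i _; exact: poweR_ge0.
rewrite [X in _ <= X]EFinM; apply: lee_pmul; rewrite ?lee_fin//.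
  by apply: integral_ge0 => t _; apply: prode_ge0 => i _; exact: poweR_ge0.
apply: (le_trans (hoelder_prod _ At0 mAt th0 sum_parabolic_weights)).
apply: (@le_trans _ _ (\prod_(i < n.+2) F%:E `^ (pb / (N * p i)))).
  apply: lee_prode => i; first exact: poweR_ge0.
  apply: lee_poweR2r; [exact: ltW|exact: integral_ge0|].
  apply: le_trans (HF i); rewrite (integral_mul_indic _ (Q a b t1 t2) (fun z => w i z `^ p i)%R).
  by rewrite (fubini_tonelli2 (A i) (mA i) (A0 i)).
under eq_bigr do rewrite poweR_EFin.
by rewrite prodEFin powR_prodD// sum_parabolic_weights powRr1.
Qed.

(** Monotone convergence as the truncation level M grows. *)
Lemma parabolic_embedding (a b : 'I_n.+2 -> R) (t1 t2 : R) (U : T -> R)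
    (G : 'I_n.+2 -> T -> R) (k E F : R) :
  measurable_fun setT U -> (forall i, measurable_fun setT (G i)) ->
  (forall j, (a j < b j)%R) -> (0 <= E)%R -> (0 <= F)%R ->
  (\forall t \ae lam, (t1 < t < t2)%R ->
    weak_gradient_on_box a b (fun x => U (x, t)) (fun i x => G i (x, t))) ->
  (\forall t \ae lam, (t1 < t < t2)%R ->
    \int[mu]_(x in open_box a b) (Num.max (U (x, t) - k) 0 ^+ 2)%:E <= E%:E) ->
  (forall i, \int[mu2]_(z in Q a b t1 t2)
     ((Num.max (U z - k) 0 / (b i - a i) + `|G i z| * (k < U z)%R%:R) `^ p i)%:E <= F%:E) ->
  \int[mu2]_(z in Q a b t1 t2) (Num.max (U z - k) 0 `^ l)%:E <=
  (troisi_constant p * E `^ (pb / N) * F)%:E.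
Proof.
move=> mU mG ab E0 F0 Hweak HE HF.
have mQ : measurable (Q a b t1 t2).
  by apply: measurableX; [exact: measurable_open_box|exact: measurable_itv].
have mpow e (f : T -> R) : measurable_fun setT f -> measurable_fun setT (fun z => f z `^ e)%R.
  by move=> mf; exact: (@measurableT_comp _ _ _ _ _ _ (@powR R ^~ e)).
have mtr M : measurable_fun setT (fun z => truncation k M (U z)).
  by apply: (@measurableT_comp _ _ _ _ _ _ (truncation k M)) => //; exact: measurable_truncation.
have bound (M : R) : (0 <= M)%R -> \int[mu2]_(z in Q a b t1 t2) (truncation k M (U z) `^ l)%:E <=
    (troisi_constant p * E `^ (pb / N) * F)%:E.
  move=> M0; apply: (parabolic_embedding_truncated mU mG ab M0 E0 F0 Hweak HE) => i.
  apply: le_trans (HF i); apply: ge0_le_integral_nm => z _; rewrite lee_fin ?powR_ge0//.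
  have ba : (0 < b i - a i)%R by rewrite subr_gt0.
  apply: ge0_ler_powR; rewrite ?nnegrE.
  - by rewrite ltW// (lt_trans ltr01).
  - apply: addr_ge0; last by rewrite mulr_ge0.
    by apply: divr_ge0; [exact: truncation_ge0|exact: ltW].
  - apply: addr_ge0; last by rewrite mulr_ge0.
    by apply: divr_ge0; [rewrite le_max lexx orbT|exact: ltW].
  apply: lerD.
    by apply: ler_wpM2r; [rewrite invr_ge0 ltW|exact: truncation_le].
  apply: ler_wpM2l => //; case: eqP => //= /eqP t0.
  by rewrite (truncation_neq0 M0 t0).
have cvg := @cvg_monotone_convergence _ _ _ mu2 (Q a b t1 t2) mQ
  (fun j z => (truncation k j%:R (U z) `^ l)%:E).
have l0 : (0 <= l)%R by rewrite ltW// parabolic_exponent_gt0.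
have lim z : limn (fun j => (truncation k j%:R (U z) `^ l)%:E) = (Num.max (U z - k) 0 `^ l)%:E.
  apply/cvg_lim => //; apply: cvg_near_cst; near=> j.
  rewrite /truncation min_l//; near: j; exact: nbhs_infty_ger.
rewrite (_ : (fun z => _) = fun z => limn (fun j => (truncation k j%:R (U z) `^ l)%:E)); last first.
  by apply/funext => z; rewrite lim.
have {}cvg : \int[mu2]_(z in Q a b t1 t2) (truncation k j%:R (U z) `^ l)%:E @[j --> \oo] -->
    \int[mu2]_(z in Q a b t1 t2) limn (fun j => (truncation k j%:R (U z) `^ l)%:E).
  apply: cvg.
  - by move=> j; apply/measurable_EFinP; apply: measurable_funTS; exact: mpow.
  - by move=> j z _; rewrite lee_fin powR_ge0.
  - move=> z _ i j ij; rewrite lee_fin; apply: ge0_ler_powR; rewrite ?nnegrE ?truncation_ge0//.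
    by rewrite /truncation le_min !ge_min lexx/= (_ : (i%:R <= j%:R :> R)%R) ?orbT// ler_nat.
rewrite -(cvg_lim _ cvg)//; apply: lime_le; first by apply/cvg_ex; eexists; exact: cvg.
by apply: nearW => j; apply: bound.
Unshelve. all: by end_near. Qed.

End parabolic.

(** * Cut-off functions and the energy inequality *)

Section cutoff.
Context {R : realType} {n : nat}.
Variable p : 'I_n -> R.
Hypothesis p1 : forall i, 1 < p i.
Local Notation space := 'rV[R]_n.
Local Notation e_ i := (delta_mx ord0 i : 'rV[R]_n).

Let p0 i : 0 < p i. Proof. exact: lt_trans ltr01 (p1 i). Qed.

Definition side_gap (r r' : R) (i : 'I_n) : R := r `^ (p i)^-1 - r' `^ (p i)^-1.

Lemma side_gap_gt0 r r' i : 0 < r' -> r' < r -> 0 < side_gap r r' i.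
Proof.
move=> r'0 rr'; rewrite subr_gt0; apply: gt0_ltr_powR; rewrite ?nnegrE ?invr_gt0//.
- exact: ltW.
- by rewrite ltW// (lt_trans r'0).
Qed.

(** The window in direction i stops at distance h / 2 from the faces of the outer
    cuboid, so that its closed support lies in the open side, and is bounded below
    from distance h on, that is on the inner cuboid. *)
Lemma cutoff_exists (r r' : R) (x0 : space) (t0 : R) : 0 < r' -> r' < r ->
  exists zeta : space * R -> R,
  [/\ admissible_cutoff p r x0 t0 zeta,
      forall z, 0 <= zeta z,
      forall z, cuboid p r' x0 z.1 -> t0 - r' < z.2 ->
        expR (- (4 * \sum_(i < n) p i)) <= zeta z,
      forall z, 0 <= 'D_(0 : space, 1 : R) zeta z <= step_slope / ((r - r') / 2) &
      forall i z, `|'D_(e_ i, 0 : R) (fun y => zeta y `^ (p i)^-1) z| <= 8 / side_gap r r' i].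
Proof.
move=> r'0 rr'; set eps := r - r'; have eps0 : 0 < eps by rewrite subr_gt0.
have eps2 : 0 < eps / 2 by rewrite divr_gt0.
pose h := side_gap r r'; have h0 i : 0 < h i by exact: side_gap_gt0.
pose a i := x0 ord0 i - r `^ (p i)^-1 + h i / 2.
pose b i := x0 ord0 i + r `^ (p i)^-1 - h i / 2.
pose psi t := step ((t - (t0 - r + eps / 2)) / (eps / 2)).
pose W i s := window (p i) (a i) (b i) (h i) s.
pose zeta z := psi z.2 * \prod_(i < n) W i ((z : space * R).1 ord0 i).
have psi01 t : 0 <= psi t <= 1 by exact: step01.
have W0 i s : 0 <= W i s by exact: window_ge0.
have W1 i s : W i s <= 1 by exact: window_le1.
have prodW01 (P : pred 'I_n) (f : 'I_n -> R) : 0 <= \prod_(i | P i) W i (f i) <= 1.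
  by rewrite prodr_ge0//= prodr_ile1// => i _; rewrite W0 W1.
exists zeta; split.
- split.
    apply: smoothV_smooth; apply: smoothV_mul.
      by apply: smoothV_coord2; exact: smooth1_step_affine.
    by apply: smoothV_prod => i; apply: smoothV_coord1; exact: smooth1_window.
  exists psi, (fun i => window 1 (a i) (b i) (h i)); split.
  + by move=> x t; rewrite /zeta/=; congr (_ * _); apply: eq_bigr => i _; rewrite window_powR.
  + split; [|exact: psi01| |].
    * by apply: smooth1_smooth; exact: smooth1_step_affine.
    * move=> s t st; apply: step_homo; apply: ler_wpM2r; first by rewrite invr_ge0 ltW.
      by rewrite lerD2r.
    * exists eps; first by rewrite eps0/= /eps gtrBl.
      split=> t Ht.
        by apply: step_le0; rewrite pmulr_lle0 ?invr_gt0// subr_le0.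
      apply: step_ge1; rewrite ler_pdivlMr// mul1r; lra.
  + move=> i; split; last by move=> s; rewrite window_ge0/= window_le1.
    split; first by apply: smooth1_smooth; exact: smooth1_window.
    apply: (@compactly_contained_sub R R^o _ `[a i, b i]%classic).
    * exact: segment_compact.
    * move=> s /= /(window_neq0 (h0 i)) /andP[sa sb].
      by rewrite in_itv/= (ltW sa) (ltW sb).
    * move=> s; rewrite /= !in_itv/= => /andP[sa sb].
      have := h0 i; rewrite /a in sa; rewrite /b in sb => hi; apply/andP; split; lra.
- by move=> z; rewrite mulr_ge0//; [have /andP[] := psi01 z.2|have /andP[] := prodW01 xpredT (fun i => z.1 ord0 i)].
- move=> z Kz tz; rewrite /zeta [psi _]step_ge1 ?mul1r; last first.
    rewrite ler_pdivlMr// mul1r /eps; lra.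
  have -> : expR (- (4 * \sum_(i < n) p i)) = \prod_(i < n) (expR (- 4) `^ p i).
    rewrite -mulNr mulr_sumr expR_sum; apply: eq_bigr => i _; exact: expRM.
  apply: ler_prod => i _; rewrite powR_ge0/= /W -window_powR//.
  apply: ge0_ler_powR; rewrite ?nnegrE ?expR_ge0 ?window_ge0//; first exact: ltW.
  have := Kz i; rewrite /cuboid => /andP[k1 k2].
  by apply: window_ge => //; rewrite /a /b /h /side_gap; lra.
- move=> z; rewrite derive_coord2 /=.
  set c := \prod_(i < n) W i (z.1 ord0 i).
  rewrite (_ : (fun s => zeta (z.1, s)) = (fun s => c * psi s)); last first.
    by apply/funext => s; rewrite /zeta/= mulrC.
  rewrite derive_scale; last exact: smooth1_step_affine.
  have /andP[c0 c1] : 0 <= c <= 1 by exact: prodW01.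
  have /andP[d0 d1] := derive_step (t0 - r + eps / 2) z.2 eps2.
  by rewrite mulr_ge0//=; apply: le_trans d1; rewrite -[leRHS]mul1r; exact: ler_wpM2r.
- move=> i z; rewrite derive_coord1 /=.
  set A := psi z.2 * \prod_(j < n | j != i) W j (z.1 ord0 j).
  have /andP[A0 A1] : 0 <= A <= 1.
    have /andP[c0 c1] := prodW01 (fun j => j != i) (fun j => z.1 ord0 j).
    have /andP[d0 d1] := psi01 z.2.
    by rewrite mulr_ge0//= mulr_ile1.
  rewrite (_ : (fun s => _) = (fun s => A `^ (p i)^-1 * window 1 (a i) (b i) (h i) s)); last first.
    apply/funext => s; rewrite /zeta/= (bigD1 i)//= updateE mulrCA.
    rewrite (eq_bigr (fun j => W j (z.1 ord0 j))) => [|j ji]; last by rewrite update_neq.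
    rewrite mulrC powRM// /W -window_powR// -powRrM mulfV ?gt_eqF// powRr1//.
    exact: window_ge0.
  rewrite derive_scale; last exact: smooth1_window.
  rewrite normrM ger0_norm ?powR_ge0//.
  have Ap : A `^ (p i)^-1 <= 1.
    have e1 : (1 : R) `^ (p i)^-1 = 1 by rewrite powR1.
    rewrite -[leRHS]e1; apply: ge0_ler_powR; rewrite ?nnegrE//.
    by rewrite invr_ge0 ltW.
  apply: le_trans (derive_window (a i) (b i) (z.1 ord0 i) (h0 i)); rewrite -[leRHS]mul1r.
  by apply: ler_wpM2r.
Qed.

End cutoff.

Section caccioppoli.
Context {R : realType} {n : nat}.
Variable p : 'I_n -> R.
Hypothesis p1 : forall i, 1 < p i.
Local Notation space := 'rV[R]_n.
Local Notation e_ i := (delta_mx ord0 i : 'rV[R]_n).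
Local Notation T := (space * measurableTypeR R)%type.
Local Notation mu := (lebesgue_rV n).
Local Notation lam := (@lebesgue_measure R).
Local Notation mu2 := (@lebesgue_xt R n).

Let p0 i : 0 < p i. Proof. exact: lt_trans ltr01 (p1 i). Qed.

Lemma measurable_cuboid r (x0 : space) : measurable (cuboid p r x0).
Proof. exact: measurable_open_box. Qed.

Lemma measurable_cylinder r (x0 : space) (t0 : R) : measurable (cylinder p r x0 t0 : set T).
Proof. by apply: measurableX; [exact: measurable_cuboid|exact: measurable_itv]. Qed.

Lemma cuboid_sub r' r (x0 : space) : 0 <= r' -> r' <= r -> cuboid p r' x0 `<=` cuboid p r x0.
Proof.
move=> r'0 rr' x Kx i; have := Kx i.
have : r' `^ (p i)^-1 <= r `^ (p i)^-1.
  apply: ge0_ler_powR; rewrite ?nnegrE ?invr_ge0//; first exact: ltW.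
  exact: le_trans rr'.
by move=> H /andP[k1 k2]; apply/andP; split; lra.
Qed.

Lemma cylinder_sub r' r (x0 : space) t0 : 0 <= r' -> r' <= r ->
  cylinder p r' x0 t0 `<=` cylinder p r x0 t0.
Proof.
move=> r'0 rr' [x t] [/= Kx]; rewrite /time_interval/= !in_itv/= => /andP[t1 t2]; split => /=.
  exact: cuboid_sub Kx.
by rewrite /time_interval/= in_itv/= t2 andbT; lra.
Qed.

Local Open Scope ereal_scope.

(** The right-hand side of the energy inequality after the derivatives of the
    cut-off function have been replaced by their bounds. *)
Definition caccioppoli_bound (C r r' : R) (x0 : space) (t0 k : R) (U : T -> R) : \bar R :=
  C%:E * ((step_slope / ((r - r') / 2))%:E *
    \int[mu2]_(z in cylinder p r x0 t0) (Num.max (U z - k) 0 ^+ 2)%:E) +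
  C%:E * \sum_(i < n) (((8 / side_gap p r r' i) `^ p i)%:E *
    \int[mu2]_(z in cylinder p r x0 t0) (Num.max (U z - k) 0 `^ p i)%:E).

(** Both terms on the left of the energy inequality are nonnegative, the essential
    supremum because the time interval has positive measure, so each is bounded by
    the right-hand side. The functions u and Du are replaced by Borel
    representatives U and G. *)
Lemma caccioppoli (D : set T) (u U : T -> R) (Du G : 'I_n -> T -> R) (delta : 'I_n -> R)
    (C r r' : R) (x0 : space) (t0 k : R) :
  (0 <= C)%R -> (0 < r')%R -> (r' < r)%R ->
  measurable_fun setT U -> (forall i, measurable_fun setT (G i)) ->
  (\forall z \ae mu2, D z -> u z = U z) ->
  (forall i, \forall z \ae mu2, D z -> Du i z = G i z) ->
  cylinder p r x0 t0 `<=` D ->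
  (forall zeta, admissible_cutoff p r x0 t0 zeta ->
    energy_estimate p delta C r x0 t0 zeta Du (fun z => Num.max (u z - k) 0)%R
      [set z | (k < u z)%R]) ->
  let c := (expR (- (4 * \sum_(i < n) p i)))%:E in
  (\forall t \ae lam, (t0 - r' < t < t0)%R ->
    c * \int[mu]_(x in cuboid p r' x0) (Num.max (U (x, t) - k) 0 ^+ 2)%:E <=
    caccioppoli_bound C r r' x0 t0 k U) /\
  (forall i, c * \int[mu2]_(z in cylinder p r' x0 t0)
      (Num.max (`|G i z| - delta i) 0 `^ p i * (k < U z)%R%:R)%:E <=
    caccioppoli_bound C r r' x0 t0 k U).
Proof.
move=> C0 r'0 rr' mU mG uU DuG QD energy c.
have [zeta [adm z0 zlow zt zx]] := cutoff_exists p1 x0 t0 r'0 rr'.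
have {energy} := energy _ adm; rewrite /energy_estimate.
set Es := ess_sup_on _ _ _; set Sg := \sum_(i < n) _; set Rt := (X in _ <= X) => energy.
have mK s : measurable (cuboid p s x0) by exact: measurable_cuboid.
have mQ s : measurable (cylinder p s x0 t0 : set T) by exact: measurable_cylinder.
have mw : measurable_fun setT (fun z => Num.max (U z - k) 0)%R.
  by apply: measurable_maxr; [exact: measurable_funB|exact: measurable_cst].
have mX (f : T -> R) e : measurable_fun setT f -> measurable_fun setT (fun x => f x `^ e)%R.
  by move=> mf; exact: (@measurableT_comp _ _ _ _ _ _ (@powR R ^~ e)).
have max0 (y : R) : (0 <= Num.max y 0)%R by rewrite le_max lexx orbT.
have slope0 : (0 <= step_slope / ((r - r') / 2) :> R)%R.
  apply: divr_ge0; first exact/ltW/step_slope_gt0.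
  by apply: divr_ge0; rewrite ?subr_ge0// ltW.
have c0 : 0 <= c by rewrite lee_fin expR_ge0.
have RtS : Rt <= caccioppoli_bound C r r' x0 t0 k U.
  apply: leeD; apply: lee_wpmul2l => //.
    rewrite -ge0_integralZl//; last 2 first.
    - by apply/measurable_EFinP; apply: measurable_funTS; exact: measurable_funX.
    - by move=> z _; rewrite lee_fin sqr_ge0.
    apply: ge0_ae_le_integral_nm.
    - by move=> z _; rewrite lee_fin mulr_ge0 ?sqr_ge0//; have /andP[] := zt z.
    - by move=> z _; rewrite -EFinM lee_fin mulr_ge0 ?sqr_ge0.
    apply: filterS uU => z uUz; rewrite !patchE; case: ifP => // /set_mem Qz.
    rewrite uUz; last exact: QD.
    rewrite -EFinM lee_fin [leRHS]mulrC; apply: ler_wpM2l; first exact: sqr_ge0.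
    by have /andP[] := zt z.
  apply: lee_sum => i _; rewrite -ge0_integralZl; last 4 first.
  - exact: mQ.
  - by apply/measurable_EFinP; apply: measurable_funTS; exact: mX.
  - by move=> z _; rewrite lee_fin powR_ge0.
  - by rewrite lee_fin powR_ge0.
  apply: ge0_ae_le_integral_nm.
  - by move=> z _; rewrite lee_fin mulr_ge0 ?powR_ge0.
  - by move=> z _; rewrite -EFinM lee_fin mulr_ge0 ?powR_ge0.
  apply: filterS uU => z uUz; rewrite !patchE; case: ifP => // /set_mem Qz.
  rewrite uUz; last exact: QD.
  rewrite -EFinM lee_fin [leRHS]mulrC; apply: ler_wpM2l; first exact: powR_ge0.
  apply: ge0_ler_powR; rewrite ?nnegrE//; first exact: ltW.
  by rewrite divr_ge0// ltW// side_gap_gt0.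
have Sg0 : 0 <= Sg.
  apply: sume_ge0 => i _; apply: integral_ge0 => z _.
  by rewrite lee_fin !mulr_ge0 ?powR_ge0.
have Es0 : 0 <= Es.
  rewrite leNgt; apply/negP => Es0.
  have nI : \forall t \ae lam, ~ time_interval r t0 t.
    have := @ess_sup_ge _ _ _ lam (fun tau => if tau \in time_interval r t0 then
      \int[mu]_(x in cuboid p r x0) (Num.max (u (x, tau) - k) 0 ^+ 2 * zeta (x, tau))%:E else -oo).
    rewrite -/Es; apply: filterS => t Ht It; move: Ht; rewrite mem_set// => Ht.
    have := le_lt_trans Ht Es0; rewrite ltNge; apply/negP/negPn.
    by apply: integral_ge0 => x _; rewrite lee_fin mulr_ge0 ?sqr_ge0.
  have mI : measurable (time_interval r t0 : set (measurableTypeR R)) by exact: measurable_itv.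
  have : lam (time_interval r t0) = 0.
    have [N [mN N0 IN]] := nI; apply: (@subset_measure0 _ _ _ lam _ _ mI mN _ N0) => t It.
    by apply: IN => /=.
  rewrite /time_interval lebesgue_measure_itv/= lte_fin gtrBl (lt_trans r'0)// => /eqP.
  rewrite -EFinB eqe; have : (0 < r)%R by apply: lt_trans rr'.
  by move=> r0; rewrite opprB addrC subrK gt_eqF.
split.
  have uUt := ae_product2 uU.
  have := @ess_sup_ge _ _ _ lam (fun tau => if tau \in time_interval r t0 then
      \int[mu]_(x in cuboid p r x0) (Num.max (u (x, tau) - k) 0 ^+ 2 * zeta (x, tau))%:E else -oo).
  rewrite -/Es => HEs.
  apply: (@filterS2 _ _ (ae_filter_ringOfSetsType lam) _ _ _ _ HEs uUt) => t Ht uUz /andP[t1 t2].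
  apply: le_trans RtS; apply: le_trans energy.
  apply: (@le_trans _ _ Es); last exact: leeDl.
  have It : time_interval r t0 t by rewrite /time_interval/= in_itv/= t2 andbT; lra.
  move: Ht; rewrite mem_set// => Ht; apply: le_trans Ht.
  rewrite -ge0_integralZl//; last 2 first.
  - apply/measurable_EFinP; apply: measurable_funTS; apply: measurable_funX.
    exact: (measurableT_comp mw).
  - by move=> z _; rewrite lee_fin sqr_ge0.
  apply: ge0_ae_le_integral_nm.
  - by move=> z _; rewrite -EFinM lee_fin mulr_ge0 ?sqr_ge0 ?expR_ge0.
  - by move=> z _; rewrite lee_fin mulr_ge0 ?sqr_ge0.
  apply: filterS uUz => x uUx; rewrite !patchE.
  case: ifP => [/set_mem Kx|_]; last first.
    by case: ifP => // _; rewrite lee_fin mulr_ge0 ?sqr_ge0.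
  have Kx' := cuboid_sub (ltW r'0) (ltW rr') Kx.
  rewrite mem_set// uUx; last by apply: QD; split.
  rewrite -EFinM lee_fin mulrC; apply: ler_wpM2l; first exact: sqr_ge0.
  exact: zlow.
move=> i; apply: le_trans RtS; apply: le_trans energy.
apply: (@le_trans _ _ Sg); last exact: leeDr.
rewrite /Sg (bigD1 i)//=; apply: (@le_trans _ _ _ _ _ _ (leeDl _ _)); last first.
  apply: sume_ge0 => j _; apply: integral_ge0 => z _.
  by rewrite lee_fin !mulr_ge0 ?powR_ge0.
have mI : measurable_fun setT (fun z => (k < U z)%R%:R : R).
  rewrite (_ : (fun x => _) = (\1_[set x | (k < U x)%R] : _ -> R)).
    apply: measurable_indic.
    rewrite (_ : [set x | (k < U x)%R] = setT `&` U @^-1` `]k, +oo[%classic).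
      by apply: mU => //; exact: measurable_itv.
    by apply/seteqP; split => x /=; [move=> H; split => //; rewrite in_itv/= H|rewrite in_itv/= andbT => -[]].
  by apply/funext => x; rewrite indicE mem_setE.
rewrite -ge0_integralZl//; last 2 first.
- apply/measurable_EFinP; apply: measurable_funTS; apply: measurable_funM => //; apply: mX.
  apply: measurable_maxr; last exact: measurable_cst.
  by apply: measurable_funB => //; apply: measurableT_comp.
- by move=> z _; rewrite lee_fin mulr_ge0 ?powR_ge0.
apply: ge0_ae_le_integral_nm.
- by move=> z _; rewrite -EFinM lee_fin !mulr_ge0 ?powR_ge0 ?expR_ge0.
- by move=> z _; rewrite lee_fin !mulr_ge0 ?powR_ge0.
apply: (@filterS2 _ _ (ae_filter_ringOfSetsType mu2) _ _ _ _ uU (DuG i)) => z uUz DuGz; rewrite !patchE.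
case: ifP => [/set_mem Kz|_]; last first.
  by case: ifP => // _; rewrite lee_fin !mulr_ge0 ?powR_ge0.
have Kz' := cylinder_sub (ltW r'0) (ltW rr') Kz.
rewrite mem_set// DuGz; last exact: QD.
have memE : (z \in [set z | (k < u z)%R]) = (k < U z)%R.
  by rewrite -uUz; [apply/idP/idP; rewrite inE|exact: QD].
rewrite -EFinM lee_fin indicE memE.
rewrite mulrC -!mulrA; apply: ler_wpM2l; first exact: powR_ge0.
rewrite mulrC; apply: ler_wpM2r => //.
case: Kz => Kx; rewrite /time_interval/= in_itv/= => /andP[t1 _].
exact: zlow.
Qed.

End caccioppoli.

(** * Borel representatives *)

Section borel_representatives.
Context {R : realType} {n : nat}.
Local Notation space := 'rV[R]_n.
Local Notation e_ i := (delta_mx ord0 i : 'rV[R]_n).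
Local Notation T := (space * measurableTypeR R)%type.
Local Notation mu := (lebesgue_rV n).
Local Notation lam := (@lebesgue_measure R).
Local Notation mu2 := (@lebesgue_xt R n).

(** The sigma-algebra is generated by the coordinates, so an open set has to be
    written as a countable union of boxes with rational centres. *)
Lemma open_measurable_rV (D : set space) : open D -> measurable D.
Proof.
move=> oD.
pose B (qm : 'rV[rat]_n * nat) : set space :=
  open_box (fun i => ratr (qm.1 ord0 i) - qm.2.+1%:R^-1) (fun i => ratr (qm.1 ord0 i) + qm.2.+1%:R^-1).
pose F k : set space := if unpickle k is Some qm then
  (if `[< B qm `<=` D >] then B qm else set0) else set0.
suff -> : D = \bigcup_k F k.
  apply: bigcupT_measurable => k; rewrite /F.
  case: unpickle => [qm|]; last exact: measurable0.
  by case: ifP => _; [exact: measurable_open_box|exact: measurable0].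
apply/seteqP; split => [x Dx|x [k _]]; last first.
  by rewrite /F; case: unpickle => [qm|//]; case: ifPn => // /asboolP; exact.
have /nbhs_ballP[e /= e0 xe] : nbhs x D by apply: open_nbhs_nbhs.
have e2 : 0 < e / 2 by rewrite divr_gt0.
have [m me] := ltr_add_invr e2; rewrite add0r in me.
have [d dE] : exists d : R, d = m.+1%:R^-1 by exists m.+1%:R^-1.
have d0 : 0 < d by rewrite dE invr_gt0.
rewrite -dE in me.
have /choice[q Hq] : forall i : 'I_n, exists q : rat, `|x ord0 i - ratr q| < d.
  move=> i; have xd : x ord0 i - d < x ord0 i + d by lra.
  have [q] := rat_in_itvoo xd; rewrite in_itv/= => /andP[q1 q2].
  exists q; rewrite ltr_norml; apply/andP; split; lra.
exists (pickle (\row_i q i, m)) => //; rewrite /F pickleK.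
have BD : B (\row_i q i, m) `<=` D.
  move=> y By; apply: xe; split => // i j; rewrite (ord1 i) /ball/=.
  have := By j; rewrite /= !mxE -dE => /andP[b1 b2]; have := Hq j.
  rewrite ltr_norml => /andP[h1 h2]; rewrite ltr_norml; apply/andP; split; lra.
case: asboolP => // _ j; rewrite /= mxE -dE; have := Hq j.
by rewrite ltr_norml => /andP[h1 h2]; apply/andP; split; lra.
Qed.

Lemma measurable_time_cylinder (Omega : set space) (S : R) :
  open Omega -> measurable (time_cylinder Omega S : set T).
Proof. by move=> oO; apply: measurableX; [exact: open_measurable_rV|exact: measurable_itv]. Qed.

Lemma borel_representative (D : set T) (f : T -> R) : measurable D -> ae_measurable mu2 D f ->
  exists2 F : T -> R, measurable_fun setT F & \forall z \ae mu2, D z -> f z = F z.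
Proof.
move=> mD [g mg fg]; exists (g \_ D).
  by apply/(measurable_restrict _ _ _).1 => //; rewrite ?setTI.
by apply: filterS fg => z fg Dz; rewrite fg// patchE mem_set.
Qed.

Lemma derive_eq0_out (phi : space -> R) (K : set space) v x : closed K ->
  (forall y, phi y != 0 -> K y) -> ~ K x -> 'D_v phi x = 0.
Proof.
move=> cK supp Kx; rewrite (@near_eq_derive _ _ _ phi (cst 0)) ?derive_cst//.
have : nbhs x (~` K) by apply: open_nbhs_nbhs; split => //; exact: closed_openC.
by apply: filterS => y Ky; apply/eqP; apply: contra_notT Ky; exact: supp.
Qed.

Local Open Scope ereal_scope.

(** A test function supported inside the box is a test function on Omega, and both
    integrals only see the box. *)
Lemma weak_partial_box (Omega : set space) (a b : 'I_n -> R) (u U : space -> R)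
    (Du G : 'I_n -> space -> R) :
  closed_box a b `<=` Omega ->
  measurable_fun setT U -> (forall i, measurable_fun setT (G i)) ->
  (\forall x \ae mu, Omega x -> u x = U x) ->
  (forall i, \forall x \ae mu, Omega x -> Du i x = G i x) ->
  (forall i, weak_partial Omega i u (Du i)) ->
  [/\ (forall i : 'I_n, mu.-integrable (open_box a b) (EFin \o U)),
   forall i, mu.-integrable (open_box a b) (EFin \o G i) &
   forall i (phi : space -> R) (e : R), (0 < e)%R -> smooth phi ->
   (forall x, phi x != 0%R -> closed_box (fun j => a j + e)%R (fun j => b j - e)%R x) ->
   \int[mu]_(x in open_box a b) (U x * 'D_(e_ i) phi x)%:E =
   - \int[mu]_(x in open_box a b) (G i x * phi x)%:E].
Proof.
move=> abO mU mG uU DuG weak.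
have oc : open_box a b `<=` closed_box a b.
  by move=> x H j; have /andP[h1 h2] := H j; rewrite (ltW h1) (ltW h2).
have integr (f F : space -> R) : measurable_fun setT F ->
    (\forall x \ae mu, Omega x -> f x = F x) -> L1loc_x Omega f ->
    mu.-integrable (open_box a b) (EFin \o F).
  have cB : compact (closed_box a b) by exact: compact_closed_box.
  move=> mF fF [_ /(_ _ cB abO) If]; apply/integrableP; split.
    by apply/measurable_EFinP; exact: measurable_funTS.
  apply: le_lt_trans If; apply: ge0_ae_le_integral_nm => //.
  apply: filterS fF => x fF; rewrite !patchE.
  case: ifPn => [/set_mem /oc Bx|_]; last first.
    by case: ifPn => // _; rewrite lee_fin.
  by rewrite mem_set// fF//; exact: abO.
split.
- by move=> i; have [Lu _ _] := weak i; exact: integr uU Lu.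
- by move=> i; have [_ LDu _] := weak i; exact: integr (DuG i) LDu.
move=> i phi e e0 sphi supp; have [_ _ /(_ phi)] := weak i.
set K := closed_box _ _ in supp.
have KB : K `<=` open_box a b.
  by move=> x Kx j; have /andP[k1 k2] := Kx j; apply/andP; split; lra.
have BO : open_box a b `<=` Omega by apply: subset_trans abO.
have cK : compact K by exact: compact_closed_box.
have clK : closed K by apply: compact_closed => //; exact: norm_hausdorff.
have restrict (f F psi : space -> R) : (\forall x \ae mu, Omega x -> f x = F x) ->
    (forall x, ~ K x -> psi x = 0%R) ->
    \int[mu]_(x in Omega) (f x * psi x)%:E = \int[mu]_(x in open_box a b) (F x * psi x)%:E.
  move=> fF psi0; apply: ae_eq_integral_nm; apply: filterS fF => x fF; rewrite !patchE.
  have [Kx|Kx] := pselect (K x).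
    by rewrite !mem_set ?fF//; [exact: BO (KB _ Kx)|exact: KB|exact: BO (KB _ Kx)].
  by rewrite psi0// !mulr0; do 2 case: ifP => _.
rewrite (restrict _ _ _ uU); last by move=> x; exact: derive_eq0_out.
rewrite (restrict _ _ _ (DuG i)); last first.
  by move=> x Kx; apply/eqP; apply: contra_notT Kx; exact: supp.
apply; split => //; apply: (compactly_contained_sub cK) => [x|]; first exact: supp.
exact: subset_trans KB BO.
Qed.

End borel_representatives.

(** * Raising the level *)

Section levels.
Context {R : realType}.
Implicit Types g w y k beta s P kappa : R.

Lemma powR_level g w s P : 0 < g -> g <= w -> s <= P -> w `^ s <= g `^ (s - P) * w `^ P.
Proof.
move=> g0 gw sP; have w0 : 0 < w by exact: lt_le_trans gw.
have -> : w `^ s = w `^ (s - P) * w `^ P.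
  by rewrite -powRD ?subrK// (gt_eqF w0) implybT.
apply: ler_wpM2r; first exact: powR_ge0.
rewrite -opprB !powRN lef_pV2 ?posrE ?powR_gt0//.
by apply: ge0_ler_powR; rewrite ?nnegrE ?subr_ge0// ltW.
Qed.

(** Where y exceeds the higher level, y - kappa is at least the gap g, and a lower
    power can be traded for the power P at the price of a power of g. *)
Lemma level_power kappa g y s P : 0 < g -> 0 < s -> s <= P ->
  Num.max (y - (kappa + g)) 0 `^ s <= g `^ (s - P) * Num.max (y - kappa) 0 `^ P.
Proof.
move=> g0 s0 sP; have [yk|yk] := leP (y - (kappa + g)) 0.
  by rewrite powR0 ?gt_eqF// mulr_ge0 ?powR_ge0.
rewrite max_l; last by lra.
apply: le_trans (powR_level g0 _ sP); last by lra.
by apply: ge0_ler_powR; rewrite ?nnegrE; lra.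
Qed.

Lemma level_indicator kappa g y P : 0 < g -> 0 <= P ->
  (kappa + g < y)%R%:R <= g `^ (- P) * Num.max (y - kappa) 0 `^ P.
Proof.
move=> g0 P0; case: ltP => yk /=; last by rewrite mulr_ge0 ?powR_ge0.
rewrite max_l; last by lra.
have gy : g <= y - kappa by lra.
by have := powR_level g0 gy P0; rewrite powRr0 sub0r.
Qed.

Lemma level_gap k beta s P : 1 <= k -> 1 <= beta -> 0 <= s -> s <= P ->
  (k / beta) `^ (s - P) <= beta `^ P.
Proof.
move=> k1 b1 s0 sP; have k0 : 0 < k by exact: lt_le_trans k1.
have b0 : 0 < beta by exact: lt_le_trans b1.
apply: (@le_trans _ _ (beta `^ (P - s))); last by apply: ler_powR => //; rewrite gerBl.
have -> : beta `^ (P - s) = (beta^-1) `^ (s - P).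
  by rewrite -(powR_inv1 (ltW b0)) -powRrM mulN1r opprB.
rewrite -opprB !powRN lef_pV2 ?posrE ?powR_gt0// ?divr_gt0// ?invr_gt0//.
apply: ge0_ler_powR; rewrite ?nnegrE ?subr_ge0 ?divr_ge0 ?invr_ge0 ?(ltW k0) ?(ltW b0)//.
by rewrite ler_peMl// invr_ge0 ltW.
Qed.

End levels.

Section exponents.
Context {R : realType} {n : nat}.
Variable p : 'I_n.+2 -> R.
Hypothesis p1 : forall i, 1 < p i.
Let N : R := n.+2%:R.
Let pb : R := mean_exponent p.
Hypothesis pbN : pb < N.
Local Notation PP := (family_max p).
Local Notation P := (integrability_exponent p).

Lemma le_family_max (a : 'I_n.+2 -> R) i : a i <= family_max a.
Proof. exact: (le_bigmax_cond _ a (erefl true)). Qed.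

Lemma family_max_gt1 : 1 < PP.
Proof. exact: lt_le_trans (p1 ord0) (le_family_max p ord0). Qed.

Lemma integrability_exponent_ge2 : 2 <= P.
Proof. by rewrite le_max lexx. Qed.

Lemma le_integrability_exponent i : p i <= P.
Proof. by rewrite le_max le_family_max orbT. Qed.

Lemma integrability_exponent_lt l : 2 < l -> (forall i, p i < l) -> P < l.
Proof.
move=> l2 pl; rewrite gt_max l2 /family_max /=; elim/big_ind: _ => //.
- by apply: lt_trans l2.
- by move=> x y xl yl; rewrite gt_max xl.
Qed.

(** The gap between the sides is estimated through the convexity of the power p i
    applied to the sides themselves; the bound scales like the inverse of rho,
    as the time term does. *)
Lemma side_gap_power r r' rho s i : 0 < r' -> r' < r -> r <= rho -> 0 < s -> rho / s <= r - r' ->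
  (8 / side_gap p r r' i) `^ p i <= (8 * p i) `^ p i * (s `^ p i / rho).
Proof.
move=> r'0 rr' rrho s0 Hs.
have p0 : 0 < p i by exact: lt_trans (p1 i).
have r0 : 0 < r by exact: lt_trans rr'.
have rho0 : 0 < rho by exact: lt_le_trans rrho.
have h0 : 0 < side_gap p r r' i by exact: side_gap_gt0.
set a := r `^ (p i)^-1; set b := r' `^ (p i)^-1.
have root y : 0 <= y -> (y `^ (p i)^-1) `^ p i = y.
  by move=> y0; rewrite -powRrM mulVf ?gt_eqF// powRr1.
have H : r - r' <= p i * a `^ (p i - 1) * side_gap p r r' i.
  rewrite -{1}(root r (ltW r0)) -{1}(root r' (ltW r'0)).
  by apply: powR_sub_le; rewrite ?powR_ge0.
have Ha : a `^ (p i - 1) <= rho * rho `^ (- (p i)^-1).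
  rewrite /a -powRrM mulrBr mulr1 mulVf ?gt_eqF//.
  rewrite -[X in X * _](powRr1 (ltW rho0)) -powRD; last by rewrite (gt_eqF rho0) implybT.
  apply: ge0_ler_powR; rewrite ?nnegrE ?(ltW r0) ?(ltW rho0)//.
  by rewrite subr_ge0 invf_le1// ltW.
set h := side_gap _ _ _ _ in h0 H *; set q := rho `^ _ in Ha *.
have q0 : 0 < q by rewrite powR_gt0.
have H1 : 1 <= p i * s * q * h.
  rewrite -(ler_pM2l rho0) mulr1.
  have -> : rho * (p i * s * q * h) = p i * (rho * q) * h * s by ring.
  rewrite -ler_pdivrMr//; apply: (le_trans Hs); apply: (le_trans H).
  by apply: ler_wpM2r; [exact: ltW|apply: ler_wpM2l; first exact: ltW].
have Hg : h^-1 <= p i * s * q by rewrite -[leLHS]mul1r ler_pdivrMr.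
have qp : q `^ p i = rho^-1.
  by rewrite /q -powRrM mulNr mulVf ?gt_eqF// powR_inv1// ltW.
rewrite -qp -[X in _ <= _ * X]powRM ?(ltW s0) ?(ltW q0)// -powRM ?mulr_ge0 ?(ltW s0) ?(ltW q0) ?(ltW p0)//.
apply: ge0_ler_powR; rewrite ?nnegrE ?divr_ge0 ?mulr_ge0 ?(ltW s0) ?(ltW q0) ?(ltW p0) ?(ltW h0)//.
rewrite -mulrA; apply: ler_wpM2l => //.
by rewrite mulrA.
Qed.

End exponents.

(** * One step of De Giorgi's iteration *)

Lemma powR_add3 (R : realType) (a b c q : R) : 0 < q -> 0 <= a -> 0 <= b -> 0 <= c ->
  (a + b + c) `^ q <= 3 `^ q * (a `^ q + b `^ q + c `^ q).
Proof.
move=> q0 a0 b0 c0; set m := Num.max a (Num.max b c).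
have m0 : 0 <= m by rewrite le_max a0.
apply: (@le_trans _ _ ((3 * m) `^ q)).
  have am : a <= m by rewrite le_max lexx.
  have bm : b <= m by rewrite !le_max lexx orbT.
  have cm : c <= m by rewrite !le_max lexx !orbT.
  by apply: ge0_ler_powR; rewrite ?nnegrE; lra.
rewrite powRM//; apply: ler_wpM2l; first exact: powR_ge0.
have := powR_ge0 a q; have := powR_ge0 b q; have := powR_ge0 c q.
rewrite /m; case: (leP a _) => _; last by lra.
by case: (leP b _) => _; lra.
Qed.

Section degiorgi_step.
Context {R : realType} {n : nat}.
Variable p : 'I_n.+2 -> R.
Hypothesis p1 : forall i, 1 < p i.
Let N : R := n.+2%:R.
Let pb : R := mean_exponent p.
Hypothesis pbN : pb < N.
Local Notation PP := (family_max p).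
Local Notation P := (integrability_exponent p).
Local Notation l := (parabolic_exponent p).
Hypothesis Pl : P < l.
Local Notation space := 'rV[R]_n.+2.
Local Notation T := (space * measurableTypeR R)%type.
Local Notation mu := (lebesgue_rV n.+2).
Local Notation lam := (@lebesgue_measure R).
Local Notation mu2 := (@lebesgue_xt R n.+2).

Let p0 i : 0 < p i. Proof. exact: lt_trans ltr01 (p1 i). Qed.
Let P0 : 0 < P.
Proof. by apply: lt_le_trans (integrability_exponent_ge2 p). Qed.

Definition caccioppoli_constant (C : R) : R :=
  C * (2 * step_slope + \sum_(i < n.+2) (8 * p i) `^ p i).

Definition energy_constant (C D : R) : R :=
  3 `^ PP * (1 + expR (4 * \sum_(i < n.+2) p i) * caccioppoli_constant C + Num.max 1 D `^ PP).

(** The common factor of all terms of the energy bound: s controls the inverse of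
    the difference of the radii relative to rho, beta that of the difference of the
    levels relative to k. *)
Definition energy_growth (s beta rho : R) : R := s `^ PP * beta `^ P / rho.

Lemma caccioppoli_constant_ge0 C : 0 <= C -> 0 <= caccioppoli_constant C.
Proof.
move=> C0; apply: mulr_ge0 => //; apply: addr_ge0.
  by apply: mulr_ge0 => //; exact/ltW/step_slope_gt0.
by apply: sumr_ge0 => i _; exact: powR_ge0.
Qed.

Local Open Scope ereal_scope.

Section levels.
Variables (Q : set T) (U : T -> R) (kappa k beta x : R).
Hypothesis mQ : measurable Q.
Hypothesis mU : measurable_fun setT U.
Hypothesis k1 : (1 <= k)%R.
Hypothesis b1 : (1 <= beta)%R.
Hypothesis Hx : \int[mu2]_(z in Q) (Num.max (U z - kappa) 0 `^ P)%:E = x%:E.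

Let g0 : (0 < k / beta)%R.
Proof. by rewrite divr_gt0 ?(lt_le_trans ltr01). Qed.

Let mX (f : T -> R) e : measurable_fun setT f -> measurable_fun setT (fun x => f x `^ e)%R.
Proof. by move=> mf; exact: (@measurableT_comp _ _ _ _ _ _ (@powR R ^~ e)). Qed.

Lemma measurable_level c : measurable_fun setT (fun z => Num.max (U z - c) 0)%R.
Proof. by apply: measurable_maxr; [exact: measurable_funB|exact: measurable_cst]. Qed.

Lemma measurable_above c : measurable_fun setT (fun z => (c < U z)%R%:R : R).
Proof.
rewrite (_ : (fun z => _) = (\1_[set z | (c < U z)%R] : T -> R)); last first.
  by apply/funext => z; rewrite indicE mem_setE.
apply: measurable_indic; rewrite (_ : [set z | _] = setT `&` U @^-1` `]c, +oo[%classic).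
  by apply: mU => //; exact: measurable_itv.
by apply/seteqP; split => z /=; rewrite in_itv/= andbT; [split|move=> []].
Qed.

Lemma integral_level_power q : (0 < q)%R -> (q <= P)%R ->
  \int[mu2]_(z in Q) (Num.max (U z - (kappa + k / beta)) 0 `^ q)%:E <= (beta `^ P * x)%:E.
Proof.
move=> q0 qP; rewrite EFinM -Hx -ge0_integralZl//; last 3 first.
- by apply/measurable_EFinP; apply: measurable_funTS; apply: mX; exact: measurable_level.
- by move=> z _; rewrite lee_fin powR_ge0.
- by rewrite lee_fin powR_ge0.
apply: ge0_le_integral_nm => z _; first by rewrite lee_fin powR_ge0.
rewrite -EFinM lee_fin; apply: le_trans (level_power _ _ g0 q0 qP) _.
by apply: ler_wpM2r; [exact: powR_ge0|apply: level_gap => //; exact: ltW].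
Qed.

Lemma integral_level_indicator :
  \int[mu2]_(z in Q) ((kappa + k / beta < U z)%R%:R)%:E <= (beta `^ P * k `^ (- P) * x)%:E.
Proof.
rewrite EFinM -Hx -ge0_integralZl//; last 3 first.
- by apply/measurable_EFinP; apply: measurable_funTS; apply: mX; exact: measurable_level.
- by move=> z _; rewrite lee_fin powR_ge0.
- by rewrite lee_fin mulr_ge0 ?powR_ge0.
apply: ge0_le_integral_nm => z _; first by rewrite lee_fin.
rewrite -EFinM lee_fin; apply: le_trans (level_indicator _ _ g0 (ltW P0)) _.
apply: ler_wpM2r; first exact: powR_ge0.
have k0 : (0 < k)%R by exact: lt_le_trans k1.
have b0 : (0 < beta)%R by exact: lt_le_trans b1.
rewrite powRM ?invr_ge0 ?(ltW k0) ?(ltW b0)// -(powR_inv1 (ltW b0)) -powRrM mulN1r opprK.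
by rewrite mulrC.
Qed.

End levels.

Lemma caccioppoli_bound_le (U : T -> R) (C r r' rho s k beta kappa x t0 : R) (x0 : space) :
  (0 <= C)%R -> measurable_fun setT U ->
  (0 < r')%R -> (r' < r)%R -> (r <= rho)%R -> (1 <= s)%R -> (rho / s <= r - r')%R ->
  (1 <= k)%R -> (1 <= beta)%R -> (0 <= x)%R ->
  \int[mu2]_(z in cylinder p r x0 t0) (Num.max (U z - kappa) 0 `^ P)%:E = x%:E ->
  caccioppoli_bound p C r r' x0 t0 (kappa + k / beta) U <=
  (caccioppoli_constant C * (energy_growth s beta rho * x))%:E.
Proof.
move=> C0 mU r'0 rr' rrho s1 Hs k1 b1 x0' Hx.
have mQ : measurable (cylinder p r x0 t0 : set T) by exact: measurable_cylinder.
have s0 : (0 < s)%R by exact: lt_le_trans s1.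
have rho0 : (0 < rho)%R by apply: lt_le_trans rrho; exact: lt_trans rr'.
have d0 : (0 < r - r')%R by rewrite subr_gt0.
have y0 : (0 <= beta `^ P * x)%R by rewrite mulr_ge0 ?powR_ge0.
have PPs e : (0 <= e)%R -> (e <= PP)%R -> (s `^ e <= s `^ PP)%R by move=> *; apply: ler_powR.
rewrite /caccioppoli_constant /caccioppoli_bound mulrDr mulrDl EFinD; apply: leeD.
  rewrite -mulrA [X in _ <= X]EFinM; apply: lee_wpmul2l; first by rewrite lee_fin.
  apply: (@le_trans _ _ ((step_slope / ((r - r') / 2))%:E * (beta `^ P * x)%:E)).
    apply: lee_wpmul2l.
      rewrite lee_fin; apply: divr_ge0; first exact/ltW/step_slope_gt0.
      by apply: divr_ge0 => //; exact: ltW.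
    under eq_integral do rewrite -powR_mulrn ?le_max ?lexx ?orbT//.
    exact: (integral_level_power mQ mU k1 b1 Hx _ (integrability_exponent_ge2 p)).
  rewrite -EFinM lee_fin /energy_growth.
  have -> : (2 * step_slope * (s `^ PP * beta `^ P / rho * x) =
    step_slope * (2 * (s `^ PP / rho)) * (beta `^ P * x))%R by ring.
  apply: ler_wpM2r => //; apply: ler_wpM2l; first exact/ltW/step_slope_gt0.
  rewrite invf_div; apply: ler_wpM2l => //.
  rewrite -[leLHS]div1r ler_pdivrMr// mulrAC ler_pdivlMr// mul1r.
  rewrite ler_pdivrMr// in Hs; apply: (le_trans Hs); rewrite mulrC; apply: ler_wpM2r; first exact: ltW.
  by apply: le1r_powR => //; exact/ltW/family_max_gt1.
rewrite -mulrA [X in _ <= X]EFinM; apply: lee_wpmul2l; first by rewrite lee_fin.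
rewrite mulr_suml -sumEFin; apply: lee_sum => i _.
apply: (@le_trans _ _ (((8 / side_gap p r r' i) `^ p i)%:E * (beta `^ P * x)%:E)).
  apply: lee_wpmul2l; first by rewrite lee_fin powR_ge0.
  exact: (integral_level_power mQ mU k1 b1 Hx _ (le_integrability_exponent p i)).
rewrite -EFinM lee_fin /energy_growth.
have -> : ((8 * p i) `^ p i * (s `^ PP * beta `^ P / rho * x) =
  (8 * p i) `^ p i * (s `^ PP / rho) * (beta `^ P * x))%R by ring.
apply: ler_wpM2r => //.
apply: (le_trans (side_gap_power p1 i r'0 rr' rrho s0 Hs)).
apply: ler_wpM2l; first exact: powR_ge0.
apply: ler_wpM2r; first by rewrite invr_ge0 ltW.
by apply: PPs; [exact: ltW|exact: le_family_max].
Qed.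

(** The energy inequality between the radii r > r' at the higher level bounds the
    two quantities that enter the parabolic embedding by the same multiple H of x.
    The powers of the lower-order terms are traded for x with [level_power]; the
    constants delta i contribute the measure of the superlevel set, which is at most
    beta^P k^-P x <= beta^P x / rho thanks to k^P >= rho. Hoelder lowers the
    exponent l to P and gains a power of that measure. *)
Lemma degiorgi_step (U : T -> R) (G : 'I_n.+2 -> T -> R) (delta : 'I_n.+2 -> R)
    (C D r r' rho s k beta kappa x t0 : R) (x0 : space) :
  (0 <= C)%R -> (forall i, (0 <= delta i <= D)%R) ->
  measurable_fun setT U -> (forall i, measurable_fun setT (G i)) ->
  (0 < r')%R -> (r' < r)%R -> (r <= rho)%R -> (1 <= s)%R ->
  (rho / s <= r - r')%R -> (rho / s <= r')%R ->
  (1 <= k)%R -> (rho <= k `^ P)%R -> (1 <= beta)%R -> (0 <= x)%R ->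
  \int[mu2]_(z in cylinder p r x0 t0) (Num.max (U z - kappa) 0 `^ P)%:E = x%:E ->
  (\forall t \ae lam, (t0 - r' < t < t0)%R ->
    weak_gradient_on_box (fun i => x0 ord0 i - r' `^ (p i)^-1)%R
      (fun i => x0 ord0 i + r' `^ (p i)^-1)%R (fun y => U (y, t)) (fun i y => G i (y, t))) ->
  let kappa' := (kappa + k / beta)%R in
  let c := (expR (- (4 * \sum_(i < n.+2) p i)))%:E in
  (\forall t \ae lam, (t0 - r' < t < t0)%R ->
    c * \int[mu]_(y in cuboid p r' x0) (Num.max (U (y, t) - kappa') 0 ^+ 2)%:E <=
    caccioppoli_bound p C r r' x0 t0 kappa' U) ->
  (forall i, c * \int[mu2]_(z in cylinder p r' x0 t0)
      (Num.max (`|G i z| - delta i) 0 `^ p i * (kappa' < U z)%R%:R)%:E <=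
    caccioppoli_bound p C r r' x0 t0 kappa' U) ->
  forall H, H = (energy_constant C D * (energy_growth s beta rho * x))%R ->
  \int[mu2]_(z in cylinder p r' x0 t0) (Num.max (U z - kappa') 0 `^ P)%:E <=
  ((troisi_constant p * H `^ (pb / N) * H) `^ (P / l) *
   (beta `^ P * k `^ (- P) * x) `^ (1 - P / l))%:E.
Proof.
move=> C0 deltaD mU mG r'0 rr' rrho s1 Hs Hs' k1 rhok b1 x0' Hx Hweak kappa' c Hsup Hgrad H HE.
have mQ' : measurable (cylinder p r' x0 t0 : set T) by exact: measurable_cylinder.
have mQ : measurable (cylinder p r x0 t0 : set T) by exact: measurable_cylinder.
have QQ : cylinder p r' x0 t0 `<=` cylinder p r x0 t0 by apply: (cylinder_sub p1); exact: ltW.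
have s0 : (0 < s)%R by exact: lt_le_trans s1.
have k0 : (0 < k)%R by exact: lt_le_trans k1.
have rho0 : (0 < rho)%R by apply: lt_le_trans rrho; exact: lt_trans rr'.
have PP1 : (1 < PP)%R by exact: family_max_gt1.
have l0 : (0 < l)%R by exact: lt_trans Pl.
have mX (f : T -> R) e : measurable_fun setT f -> measurable_fun setT (fun z => f z `^ e)%R.
  by move=> mf; exact: (@measurableT_comp _ _ _ _ _ _ (@powR R ^~ e)).
set L := energy_growth s beta rho in HE *; set c1 := caccioppoli_constant C.
have c10 : (0 <= c1)%R by exact: caccioppoli_constant_ge0.
set ex := expR (4 * \sum_(i < n.+2) p i).
have ex0 : (0 < ex)%R by exact: expR_gt0.
have exV : (ex * expR (- (4 * \sum_(i < n.+2) p i)) = 1)%R by rewrite /ex -expRD subrr expR0.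
have L0 : (0 <= L)%R.
  by rewrite /L /energy_growth; apply: divr_ge0; [apply: mulr_ge0; exact: powR_ge0|exact: ltW].
have one_le y e : (1 <= y)%R -> (0 <= e)%R -> (1 <= y `^ e :> R)%R.
  by move=> y1 e0; have := ler_powR y1 e0; rewrite powRr0.
have PP0 : (0 <= PP)%R by exact/ltW/(lt_trans ltr01).
have D1 : (1 <= Num.max 1 D `^ PP)%R by apply: one_le => //; rewrite le_max lexx.
have Lx0 : (0 <= L * x)%R by exact: mulr_ge0.
have three : (1 <= 3 `^ PP :> R)%R by apply: one_le => //; lra.
have sPP : (s <= s `^ PP)%R by apply: le1r_powR => //; exact: ltW.
have bP1 : (1 <= beta `^ P)%R by apply: one_le => //; exact: ltW.
have H0 : (0 <= H)%R.
  rewrite HE /energy_constant mulr_ge0// mulr_ge0 ?powR_ge0// !addr_ge0// ?powR_ge0//.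
  by rewrite mulr_ge0// ltW.
have := caccioppoli_bound_le C0 mU r'0 rr' rrho s1 Hs k1 b1 x0' Hx.
rewrite -/kappa' -/L -/c1 => Hcacc.
have scale (I : \bar R) : c * I <= caccioppoli_bound p C r r' x0 t0 kappa' U ->
    I <= (ex * c1 * (L * x))%:E.
  move=> HI; have : ex%:E * (c * I) <= ex%:E * (c1 * (L * x))%:E.
    by apply: lee_wpmul2l; [rewrite lee_fin ltW|exact: le_trans Hcacc].
  by rewrite /c muleA -[X in X * I]EFinM exV mul1e -[(ex * c1 * _)%R]mulrA EFinM.
have HexH : (ex * c1 * (L * x) <= H)%R.
  rewrite HE; apply: ler_wpM2r => //; rewrite /energy_constant -/c1 -/ex.
  have z0 : (0 <= ex * c1)%R by rewrite mulr_ge0// ltW.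
  rewrite -[leLHS]mul1r; apply: ler_pM => //; lra.
have Hpar : \int[mu2]_(z in cylinder p r' x0 t0) (Num.max (U z - kappa') 0 `^ l)%:E <=
    (troisi_constant p * H `^ (pb / N) * H)%:E.
  apply: (parabolic_embedding p1 pbN mU mG _ H0 H0 Hweak).
  - move=> j; have : (0 < r' `^ (p j)^-1)%R by exact: powR_gt0.
    by move=> ?; lra.
  - apply: (@filterS _ _ (ae_filter_ringOfSetsType lam) _ _ _ Hsup) => t Ht /Ht /scale Hle; apply: (le_trans Hle).
    by rewrite lee_fin.
  move=> i; have Hg := scale _ (Hgrad i).
  rewrite /=; set ell := (x0 ord0 i + r' `^ (p i)^-1 - (x0 ord0 i - r' `^ (p i)^-1))%R.
  have root0 : (0 < r' `^ (p i)^-1)%R by exact: powR_gt0.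
  have ellE : (ell = 2 * r' `^ (p i)^-1)%R by rewrite /ell; ring.
  have ell0 : (0 < ell)%R by rewrite ellE mulr_gt0.
  have ellp : ((ell^-1) `^ p i <= s / rho)%R.
    apply: (@le_trans _ _ (r'^-1)%R).
      have -> : (r'^-1 = (r' `^ (p i)^-1)^-1 `^ p i)%R.
        by rewrite -(powR_inv1 (ltW root0)) -!powRrM mulN1r mulrN mulVf ?gt_eqF// powR_inv1// ltW.
      apply: ge0_ler_powR; rewrite ?nnegrE ?invr_ge0 ?(ltW ell0) ?(ltW root0) ?(ltW (p0 i))//.
      by rewrite lef_pV2 ?posrE// ellE ler_peMl ?(ltW root0)// ler1n.
    rewrite -(invf_div rho s) lef_pV2 ?posrE ?divr_gt0//.
  pose w (z : T) : R := Num.max (U z - kappa')%R 0%R.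
  pose J (z : T) : R := (kappa' < U z)%R%:R.
  have mJ : measurable_fun setT J by exact: measurable_above.
  have mw : measurable_fun setT (w : T -> R) by exact: measurable_level.
  have w0 z : (0 <= w z)%R by rewrite le_max lexx orbT.
  have [d0 dD] := andP (deltaD i).
  (* |G| <= (|G| - delta)_+ + delta splits the gradient weight into three parts *)
  pose a1 z : \bar R := ((w z / ell) `^ p i)%:E.
  pose a2 z : \bar R := (Num.max (`|G i z| - delta i) 0 `^ p i * J z)%:E.
  pose a3 z : \bar R := (delta i `^ p i * J z)%:E.
  have ma1 : measurable_fun setT (a1 : T -> \bar R).
    by apply/measurable_EFinP; apply: mX; exact: measurable_funM.
  have ma2 : measurable_fun setT (a2 : T -> \bar R).
    apply/measurable_EFinP; apply: measurable_funM => //; apply: mX.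
    apply: measurable_maxr; last exact: measurable_cst.
    by apply: measurable_funB => //; exact: measurableT_comp.
  have ma3 : measurable_fun setT (a3 : T -> \bar R).
    by apply/measurable_EFinP; apply: measurable_funM => //; exact: measurable_cst.
  have a10 z : 0 <= a1 z by rewrite lee_fin powR_ge0.
  have a20 z : 0 <= a2 z by rewrite lee_fin mulr_ge0 ?powR_ge0.
  have a30 z : 0 <= a3 z by rewrite lee_fin mulr_ge0 ?powR_ge0.
  apply: (@le_trans _ _ (\int[mu2]_(z in cylinder p r' x0 t0) ((3 `^ p i)%:E * (a1 z + a2 z + a3 z)))).
    apply: ge0_le_integral_nm => z _; first by rewrite lee_fin powR_ge0.
    rewrite -!EFinD -EFinM lee_fin.
    have J01 : (J z `^ p i = J z)%R.
      by rewrite /J; case: (_ < _)%R; rewrite ?powR1// powR0// gt_eqF.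
    have max0 : (0 <= Num.max (`|G i z| - delta i) 0)%R by rewrite le_max lexx orbT.
    have J0 : (0 <= J z)%R by [].
    have -> : (delta i `^ p i * J z = (delta i * J z) `^ p i)%R by rewrite powRM// J01.
    have -> : (Num.max (`|G i z| - delta i) 0 `^ p i * J z =
      (Num.max (`|G i z| - delta i) 0 * J z) `^ p i)%R by rewrite powRM// J01.
    have we0 : (0 <= w z / ell)%R by apply: divr_ge0 => //; exact: ltW.
    have dJ0 : (0 <= delta i * J z)%R by exact: mulr_ge0.
    have mJ0 := mulr_ge0 max0 J0; have GJ0 := mulr_ge0 (normr_ge0 (G i z)) J0.
    apply: le_trans (powR_add3 (p0 i) we0 mJ0 dJ0).
    apply: ge0_ler_powR; rewrite ?nnegrE; first exact: ltW.
    - exact: addr_ge0.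
    - by apply: addr_ge0 => //; exact: addr_ge0.
    rewrite -addrA lerD2l -mulrDl; apply: ler_wpM2r => //.
    by rewrite -lerBlDr le_max lexx.
  rewrite ge0_integralZl; last 4 first.
  - exact: mQ'.
  - by apply: measurable_funTS; do 2 apply: emeasurable_funD => //.
  - by move=> z _; rewrite !adde_ge0.
  - by rewrite lee_fin powR_ge0.
  rewrite ge0_integralD; last 5 first.
  - exact: mQ'.
  - by move=> z _; rewrite adde_ge0.
  - by apply: measurable_funTS; apply: emeasurable_funD.
  - by [].
  - exact: measurable_funTS.
  rewrite ge0_integralD; last 5 first.
  - exact: mQ'.
  - by [].
  - exact: measurable_funTS.
  - by [].
  - exact: measurable_funTS.
  have A1 : \int[mu2]_(z in cylinder p r' x0 t0) a1 z <= (L * x)%:E.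
    apply: (@le_trans _ _ ((s / rho)%:E * (beta `^ P * x)%:E)); last first.
      rewrite -EFinM lee_fin /L /energy_growth.
      have -> : (s `^ PP * beta `^ P / rho * x = s `^ PP / rho * (beta `^ P * x))%R by ring.
      apply: ler_wpM2r; first by rewrite mulr_ge0// powR_ge0.
      by apply: ler_wpM2r => //; rewrite invr_ge0 ltW.
    apply: (@le_trans _ _ (\int[mu2]_(z in cylinder p r x0 t0) ((s / rho)%:E * (w z `^ p i)%:E))).
      apply: (@le_trans _ _ (\int[mu2]_(z in cylinder p r x0 t0) a1 z)).
        exact: ge0_subset_integral_nm.
      apply: ge0_le_integral_nm => z _ //; rewrite -EFinM lee_fin powRM ?invr_ge0 ?(ltW ell0)//.
      by rewrite mulrC; apply: ler_wpM2r; first exact: powR_ge0.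
    rewrite ge0_integralZl//; last 3 first.
    - by apply/measurable_EFinP; apply: measurable_funTS; exact: mX.
    - by move=> z _; rewrite lee_fin powR_ge0.
    - by rewrite lee_fin divr_ge0// ltW.
    apply: lee_wpmul2l; first by rewrite lee_fin divr_ge0// ltW.
    exact: (integral_level_power mQ mU k1 b1 Hx (p0 i) (le_integrability_exponent p i)).
  have A3 : \int[mu2]_(z in cylinder p r' x0 t0) a3 z <= (Num.max 1 D `^ PP * (L * x))%:E.
    apply: (@le_trans _ _ ((Num.max 1 D `^ PP)%:E * (beta `^ P * k `^ (- P) * x)%:E)); last first.
      rewrite -EFinM lee_fin; apply: ler_wpM2l; first exact: powR_ge0.
      apply: ler_wpM2r => //; rewrite /L /energy_growth powRN.
      have -> : (s `^ PP * beta `^ P / rho = beta `^ P * (s `^ PP / rho))%R by ring.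
      apply: ler_wpM2l; first exact: powR_ge0.
      rewrite ler_pdivlMr// mulrC ler_pdivrMr ?powR_gt0//.
      apply: (le_trans rhok); rewrite ler_peMl ?powR_ge0//.
      exact: le_trans sPP.
    apply: (@le_trans _ _ (\int[mu2]_(z in cylinder p r x0 t0) ((Num.max 1 D `^ PP)%:E * (J z)%:E))).
      apply: (@le_trans _ _ (\int[mu2]_(z in cylinder p r x0 t0) a3 z)).
        exact: ge0_subset_integral_nm.
      apply: ge0_le_integral_nm => z _ //; rewrite -EFinM lee_fin; apply: ler_wpM2r => //.
      apply: (@le_trans _ _ (Num.max 1 D `^ p i)%R).
        apply: ge0_ler_powR; rewrite ?nnegrE ?(ltW (p0 i))// ?le_max ?ler01// dD orbT//.
      by apply: ler_powR; [rewrite le_max lexx|exact: le_family_max].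
    rewrite ge0_integralZl; last 4 first.
    - exact: mQ.
    - by apply/measurable_EFinP; exact: measurable_funTS.
    - by move=> z _; rewrite lee_fin.
    - by rewrite lee_fin powR_ge0.
    apply: lee_wpmul2l; first by rewrite lee_fin powR_ge0.
    exact: (integral_level_indicator mQ mU k1 b1 Hx).
  apply: (@le_trans _ _ ((3 `^ p i)%:E * ((L * x)%:E + (ex * c1 * (L * x))%:E + (Num.max 1 D `^ PP * (L * x))%:E))).
    apply: lee_wpmul2l; first by rewrite lee_fin powR_ge0.
    by apply: leeD => //; apply: leeD.
  rewrite -!EFinD -EFinM lee_fin HE /energy_constant -/c1 -/ex -[leRHS]mulrA.
  have -> : (L * x + ex * c1 * (L * x) + Num.max 1 D `^ PP * (L * x) =
    (1 + ex * c1 + Num.max 1 D `^ PP) * (L * x))%R by ring.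
  apply: ler_wpM2r.
    apply: mulr_ge0 => //; rewrite !addr_ge0// ?powR_ge0//.
    by rewrite mulr_ge0// ltW.
  by apply: ler_powR; [rewrite ler1n|exact: le_family_max].
pose w (z : T) : R := Num.max (U z - kappa')%R 0%R.
pose J (z : T) : R := (kappa' < U z)%R%:R.
have mJ : measurable_fun setT J by exact: measurable_above.
have w0 z : (0 <= w z)%R by rewrite le_max lexx orbT.
have mw : measurable_fun setT w by exact: measurable_level.
have th0 : (0 < P / l)%R by rewrite divr_gt0.
have th1 : (0 < 1 - P / l)%R by rewrite subr_gt0 ltr_pdivrMr// mul1r.
have th01 : (P / l + (1 - P / l) = 1)%R by rewrite addrC subrK.
have mI : measurable_fun [set: T] (\1_(cylinder p r' x0 t0) : _ -> R) by exact: measurable_indic.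
have HJ : \int[mu2]_(z in cylinder p r' x0 t0) (J z)%:E <= (beta `^ P * k `^ (- P) * x)%:E.
  apply: le_trans (integral_level_indicator mQ mU k1 b1 Hx).
  by apply: ge0_subset_integral_nm => // z _; rewrite lee_fin.
rewrite [X in X <= _](integral_mul_indic _ _ (fun z => w z `^ P)%R).
apply: (@le_trans _ _ ((\int[mu2]_z (w z `^ l * \1_(cylinder p r' x0 t0) z)%:E) `^ (P / l) *
    (\int[mu2]_z (J z * \1_(cylinder p r' x0 t0) z)%:E) `^ (1 - P / l))).
  apply: (le_trans _ (hoelder_ereal _ _ _ _ _ th0 th1 th01)).
  - rewrite le_eqVlt; apply/orP; left; apply/eqP; apply: eq_integral => z _.
    rewrite !poweR_EFin -EFinM; congr EFin; rewrite indicE /J.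
    case: (z \in _); last by rewrite !mulr0 !powR0 ?mulr0// gt_eqF.
    rewrite !mulr1 -powRrM (mulrC l) divfK ?gt_eqF//.
    case: ltP => [_|Uk]; first by rewrite powR1 mulr1.
    by rewrite [X in _ = (_ * X)%R]powR0 ?gt_eqF// mulr0 /w max_r ?subr_le0// powR0// gt_eqF.
  - by move=> z; rewrite lee_fin mulr_ge0 ?powR_ge0.
  - by move=> z; rewrite lee_fin mulr_ge0.
  - by apply/measurable_EFinP; apply: measurable_funM => //; exact: mX.
  - by apply/measurable_EFinP; exact: measurable_funM.
rewrite -(integral_mul_indic _ _ (fun z => w z `^ l)%R) -(integral_mul_indic _ _ J).
rewrite [X in _ <= X]EFinM -!poweR_EFin; apply: lee_pmul; rewrite ?poweR_ge0//.
  apply: lee_poweR2r Hpar; first exact: ltW.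
  by apply: integral_ge0 => z _; rewrite lee_fin powR_ge0.
apply: lee_poweR2r HJ; first exact: ltW.
by apply: integral_ge0 => z _; rewrite lee_fin.
Qed.

End degiorgi_step.

(** * The exponents of the iteration *)

Section iteration_algebra.
Context {R : realType}.
Variables N pb P : R.
Hypothesis N0 : 0 < N.
Hypothesis pb0 : 0 < pb.
Hypothesis P0 : 0 < P.
Hypothesis PN : N * P < pb * (N + 2).
Let l := pb * (N + 2) / N.
Let alpha := P / (N + 2).
Let theta := (pb / N + 1) * (P / l).
Let gamma := pb / (pb * (N + 2) - N * P).

Let N2 : 0 < N + 2. Proof. exact: addr_gt0. Qed.
Let dN : N != 0. Proof. by rewrite gt_eqF. Qed.
Let dpb : pb != 0. Proof. by rewrite gt_eqF. Qed.
Let dN2 : N + 2 != 0. Proof. by rewrite gt_eqF. Qed.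
Let dg : pb * (N + 2) - N * P != 0. Proof. by rewrite gt_eqF// subr_gt0. Qed.
Let l0 : 0 < l. Proof. by rewrite divr_gt0// mulr_gt0. Qed.

Let Pl : P / l = P * N / (pb * (N + 2)).
Proof. by rewrite /l; field; rewrite dN dpb dN2. Qed.

Let alpha0 : 0 < alpha. Proof. exact: divr_gt0. Qed.

(** The total power of x exceeds 1, which makes the iteration converge. *)
Let theta_sum : theta + (1 - P / l) = 1 + alpha.
Proof. by rewrite /theta Pl /alpha; field; rewrite dN dpb dN2. Qed.

Let theta_alpha : theta = alpha * ((N + pb) / pb).
Proof. by rewrite /theta Pl /alpha; field; rewrite dN dpb dN2. Qed.

Let gamma_alpha : gamma * (P * (1 - P / l)) = alpha.
Proof. by rewrite /gamma Pl /alpha; field; rewrite dpb dN2 dg. Qed.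

Let Pl1 : 0 < 1 - P / l.
Proof. by rewrite subr_gt0 ltr_pdivrMr// mul1r /l ltr_pdivlMr// mulrC. Qed.

Let theta0 : 0 < theta.
Proof. by apply: mulr_gt0; [rewrite addr_gt0// divr_gt0|exact: divr_gt0]. Qed.

Definition growth_exponent (PP : R) : R := (PP + P) * theta + P * (1 - P / l).

Lemma growth_exponent_gt0 PP : 0 < PP -> 0 < growth_exponent PP.
Proof. by move=> PP0; rewrite addr_gt0// mulr_gt0// addr_gt0. Qed.

(** The bound of one step, sorted by the quantities it depends on. *)
Lemma step_algebra (Tr c2 PP sigma rho beta k x : R) :
  0 <= Tr -> 0 <= c2 -> 0 < PP -> sigma < 1 -> 0 < rho -> 0 < beta -> 0 < k -> 0 <= x ->
  let H := c2 * ((beta / (1 - sigma)) `^ PP * beta `^ P / rho * x) in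
  (Tr * H `^ (pb / N) * H) `^ (P / l) * (beta `^ P * k `^ (- P) * x) `^ (1 - P / l) =
  Tr `^ (P / l) * c2 `^ theta * ((1 - sigma) `^ (- PP) / rho) `^ theta *
  k `^ (- (P * (1 - P / l))) * beta `^ growth_exponent PP * x `^ (1 + alpha).
Proof.
move=> Tr0 c20 PP0 s1 rho0 b0 k0 x0 H.
have d0 : 0 < 1 - sigma by rewrite subr_gt0.
have Pl0 : 0 < P / l by exact: divr_gt0.
set y := (1 - sigma) `^ (- PP) / rho.
have y0 : 0 < y by rewrite divr_gt0// powR_gt0.
have HE : H = c2 * y * beta `^ (PP + P) * x.
  rewrite /H /y powRM ?invr_ge0 ?(ltW b0) ?(ltW d0)// powRD ?(gt_eqF b0) ?implybT//.
  rewrite -(powR_inv1 (ltW d0)) -powRrM mulN1r; ring.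
have cy0 : 0 <= c2 * y by apply: mulr_ge0 => //; exact: ltW.
have cyb0 : 0 <= c2 * y * beta `^ (PP + P) by apply: mulr_ge0 => //; exact: powR_ge0.
have H0 : 0 <= H by rewrite HE mulr_ge0.
have HH : H `^ (pb / N) * H = H `^ (pb / N + 1).
  rewrite powRD ?powRr1//; apply/implyP => /eqP e.
  have : 0 < pb / N + 1 by rewrite addr_gt0// divr_gt0.
  by rewrite e ltxx.
rewrite -mulrA HH powRM ?powR_ge0// -powRrM -/theta HE.
rewrite (powRM _ cyb0 x0) (powRM _ cy0 (powR_ge0 _ _)) (powRM _ c20 (ltW y0)).
rewrite (powRM _ (mulr_ge0 (powR_ge0 beta P) (powR_ge0 k (- P))) x0).
rewrite (powRM _ (powR_ge0 beta P) (powR_ge0 k (- P))) -!powRrM mulNr.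
have -> : beta `^ growth_exponent PP = beta `^ ((PP + P) * theta) * beta `^ (P * (1 - P / l)).
  by rewrite -powRD// (gt_eqF b0) implybT.
have -> : x `^ (1 + alpha) = x `^ theta * x `^ (1 - P / l).
  rewrite -theta_sum powRD//; apply/implyP => /eqP e.
  by have := addr_gt0 theta0 Pl1; rewrite e ltxx.
ring.
Qed.

(** How the final estimate arises: the smallness of X needed for geometric decay is
    a lower bound for k, and solving it for k gives the power gamma of the average
    of U_+^P. For q = 2^n the factor q rho^(N / pb) rho is the volume of the cylinder. *)
Lemma level_choice (K PP sigma rho X k q : R) (m := growth_exponent PP) :
  0 <= K -> sigma < 1 -> 0 < rho -> 0 <= X -> 0 < k -> 0 < q ->
  ((K * 2 `^ m * (2 `^ m) `^ alpha^-1) `^ alpha^-1 * q) `^ gamma *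
    ((1 - sigma) `^ (- (PP * (N + pb) / pb)) * ((q * rho `^ (N / pb) * rho)^-1 * X)) `^ gamma <= k ->
  K * 2 `^ m * ((1 - sigma) `^ (- PP) / rho) `^ theta * k `^ (- (P * (1 - P / l))) *
    X `^ alpha * (2 `^ m) `^ alpha^-1 <= 1.
Proof.
move=> K0 s1 rho0 X0 k0 q0.
have d0 : 0 < 1 - sigma by rewrite subr_gt0.
set B := K * 2 `^ m * (2 `^ m) `^ alpha^-1; set Y := _ * (_ * X) => Hk.
have B0 : 0 <= B by rewrite !mulr_ge0 ?powR_ge0.
have Y0 : 0 <= Y.
  by rewrite mulr_ge0 ?powR_ge0// mulr_ge0// invr_ge0 ?mulr_ge0 ?powR_ge0 ?(ltW q0) ?(ltW rho0).
have e0 : 0 < P * (1 - P / l) by exact: mulr_gt0.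
have Bq0 : 0 <= B `^ alpha^-1 * q by rewrite mulr_ge0 ?powR_ge0// ltW.
rewrite -(powRM _ Bq0 Y0) in Hk.
have Hk2 : (B `^ alpha^-1 * q * Y) `^ alpha <= k `^ (P * (1 - P / l)).
  set Z := B `^ _ * q * Y in Hk *.
  have -> : Z `^ alpha = (Z `^ gamma) `^ (P * (1 - P / l)) by rewrite -powRrM gamma_alpha.
  by apply: ge0_ler_powR Hk; rewrite ?nnegrE; [exact: ltW|exact: powR_ge0|exact: ltW].
set y := (1 - sigma) `^ (- PP) / rho.
have y0 : 0 <= y by rewrite divr_ge0 ?powR_ge0// ltW.
have qY : q * Y = y `^ ((N + pb) / pb) * X.
  have rE : q * rho `^ (N / pb) * rho = q * rho `^ ((N + pb) / pb).
    rewrite -mulrA; congr (_ * _); rewrite mulrDl divff// powRD ?powRr1 ?(ltW rho0)//.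
    by rewrite (gt_eqF rho0) implybT.
  rewrite /Y rE /y powRM ?powR_ge0 ?invr_ge0 ?(ltW rho0)// -powRrM.
  rewrite -(powR_inv1 (ltW rho0)) -powRrM mulN1r (powRN rho) mulNr.
  have r0 : rho `^ ((N + pb) / pb) != 0 by rewrite gt_eqF// powR_gt0.
  by rewrite -(mulrA PP); field; rewrite r0 gt_eqF.
rewrite -mulrA qY powRM ?powR_ge0 ?mulr_ge0 ?powR_ge0// -powRrM mulVf ?gt_eqF// powRr1// in Hk2.
rewrite powRM ?powR_ge0// -powRrM [(N + pb) / pb * alpha]mulrC -theta_alpha in Hk2.
rewrite powRN; set ke := k `^ _ in Hk2 *.
have ke0 : 0 < ke by exact: powR_gt0.
rewrite -(ler_pM2r ke0) mul1r; apply: le_trans Hk2.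
rewrite le_eqVlt; apply/orP; left; apply/eqP; rewrite /B.
by field; rewrite gt_eqF.
Qed.

End iteration_algebra.

(** The induction step of fast geometric convergence: a sequence that satisfies
    X_{j+1} <= A b^j X_j^{1 + alpha} decays like q^j when X_0 is small, because
    q^alpha compensates b and A X_0^alpha is at most q. *)
Lemma geometric_step (R : realType) (A b alpha X x : R) (j : nat) (q := b `^ (- alpha^-1)) :
  0 <= A -> 0 < b -> 0 < alpha -> 0 <= X -> 0 <= x -> x <= X * q ^+ j ->
  A * X `^ alpha * b `^ alpha^-1 <= 1 ->
  A * b ^+ j * x `^ (1 + alpha) <= X * q ^+ j.+1.
Proof.
move=> A0 b0 a0 X0 x0 xX HA.
have q0 : 0 < q by exact: powR_gt0.
have HAq : A * X `^ alpha <= q by rewrite /q powRN -[leRHS]mul1r ler_pdivlMr// powR_gt0.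
have qa : q `^ alpha = b^-1 by rewrite /q -powRrM mulNr mulVf ?gt_eqF// powR_inv1// ltW.
have xa : x `^ alpha <= X `^ alpha / b ^+ j.
  apply: (@le_trans _ _ ((X * q ^+ j) `^ alpha)).
    apply: ge0_ler_powR; rewrite ?nnegrE//; first exact: ltW.
    by rewrite mulr_ge0// exprn_ge0// ltW.
  rewrite powRM// ?exprn_ge0 ?(ltW q0)//; apply: ler_wpM2l; first exact: powR_ge0.
  rewrite -(powR_mulrn j (ltW q0)) powRAC qa powR_mulrn ?exprVn// invr_ge0.
  exact: ltW.
have bj : 0 < b ^+ j by exact: exprn_gt0.
rewrite powRD ?powRr1//; last first.
  by apply/implyP => /eqP e; have : 0 < 1 + alpha by [rewrite addr_gt0]; rewrite e ltxx.
apply: (@le_trans _ _ (A * b ^+ j * (X * q ^+ j * (X `^ alpha / b ^+ j)))).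
  apply: ler_wpM2l; first by rewrite mulr_ge0// ltW.
  by apply: ler_pM => //; exact: powR_ge0.
have -> : A * b ^+ j * (X * q ^+ j * (X `^ alpha / b ^+ j)) = X * q ^+ j * (A * X `^ alpha).
  by field; rewrite gt_eqF.
rewrite exprSr [leRHS]mulrA; apply: ler_wpM2l => //.
by rewrite mulr_ge0// exprn_ge0// ltW.
Qed.

(** * De Giorgi's iteration *)

Section degiorgi.
Context {R : realType} {n : nat}.
Variable p : 'I_n.+2 -> R.
Hypothesis p1 : forall i, 1 < p i.
Let N : R := n.+2%:R.
Let pb : R := mean_exponent p.
Hypothesis pbN : pb < N.
Local Notation PP := (family_max p).
Local Notation P := (integrability_exponent p).
Local Notation l := (parabolic_exponent p).
Hypothesis Pl : P < l.
Local Notation space := 'rV[R]_n.+2.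
Local Notation T := (space * measurableTypeR R)%type.
Local Notation mu := (lebesgue_rV n.+2).
Local Notation lam := (@lebesgue_measure R).
Local Notation mu2 := (@lebesgue_xt R n.+2).

Let p0 i : 0 < p i. Proof. exact: lt_trans ltr01 (p1 i). Qed.
Let N0 : 0 < N. Proof. by rewrite ltr0n. Qed.
Let pb0 : 0 < pb. Proof. exact: mean_exponent_gt0. Qed.
Let P0 : 0 < P.
Proof. by apply: lt_le_trans (integrability_exponent_ge2 p). Qed.
Let PP0 : 0 < PP. Proof. exact: lt_trans ltr01 (family_max_gt1 p1). Qed.
Let PN : N * P < pb * (N + 2).
Proof. by rewrite mulrC -ltr_pdivlMr. Qed.

Let alpha := P / (N + 2).
Let theta := (pb / N + 1) * (P / l).
Let m := growth_exponent N pb P PP.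

Definition iteration_constant (C D : R) : R :=
  troisi_constant p `^ (P / l) * energy_constant p C D `^ theta.

Definition degiorgi_constant (C D : R) : R :=
  ((iteration_constant C D * 2 `^ m * (2 `^ m) `^ alpha^-1) `^ alpha^-1 * 2 ^+ n.+2)
    `^ (pb / (pb * (N + 2) - N * P)).

Lemma energy_constant_gt0 C D : 0 <= C -> 0 < energy_constant p C D.
Proof.
move=> C0; apply: mulr_gt0; first exact: powR_gt0.
apply: ltr_wpDr; first exact: powR_ge0.
apply: ltr_wpDr => //; apply: mulr_ge0; first exact: expR_ge0.
exact: caccioppoli_constant_ge0.
Qed.

Lemma iteration_constant_gt0 C D : 0 <= C -> 0 < iteration_constant C D.
Proof.
move=> C0; apply: mulr_gt0; apply: powR_gt0; first exact: troisi_constant_gt0.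
exact: energy_constant_gt0.
Qed.

Lemma degiorgi_constant_gt0 C D : 0 <= C -> 0 < degiorgi_constant C D.
Proof.
move=> C0; apply: powR_gt0; apply: mulr_gt0; last exact: exprn_gt0.
apply: powR_gt0; apply: mulr_gt0; last by apply: powR_gt0; exact: powR_gt0.
by apply: mulr_gt0; [exact: iteration_constant_gt0|exact: powR_gt0].
Qed.

Definition slice_energy_bound (C rho t0 : R) (x0 : space) (U : T -> R) :=
  forall r r' kappa, 0 < r' -> r' < r -> r <= rho ->
  \forall t \ae lam, t0 - r' < t < t0 ->
    ((expR (- (4 * \sum_(i < n.+2) p i)))%:E *
     \int[mu]_(y in cuboid p r' x0) (Num.max (U (y, t) - kappa) 0 ^+ 2)%:E <=
     caccioppoli_bound p C r r' x0 t0 kappa U)%E.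

Definition gradient_energy_bound (C rho t0 : R) (x0 : space) (delta : 'I_n.+2 -> R)
    (U : T -> R) (G : 'I_n.+2 -> T -> R) :=
  forall r r' kappa, 0 < r' -> r' < r -> r <= rho -> forall i,
    ((expR (- (4 * \sum_(i < n.+2) p i)))%:E * \int[mu2]_(z in cylinder p r' x0 t0)
      (Num.max (`|G i z| - delta i) 0 `^ p i * (kappa < U z)%R%:R)%:E <=
     caccioppoli_bound p C r r' x0 t0 kappa U)%E.

Definition slice_weak_gradient (rho t0 : R) (x0 : space) (U : T -> R) (G : 'I_n.+2 -> T -> R) :=
  \forall t \ae lam, t0 - rho < t < t0 -> forall r, 0 < r < rho ->
    weak_gradient_on_box (fun i => x0 ord0 i - r `^ (p i)^-1)
      (fun i => x0 ord0 i + r `^ (p i)^-1) (fun y => U (y, t)) (fun i y => G i (y, t)).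

(** The radii decrease from rho to sigma rho and the levels increase from 0 to k,
    both geometrically with ratio 1 / 2, and the integrals of (U - lev j)_+^P decay
    to 0; hence (U - k)_+ vanishes on the limiting cylinder. *)
Lemma degiorgi_bound (U : T -> R) (G : 'I_n.+2 -> T -> R) (delta : 'I_n.+2 -> R)
    (C D rho sigma k X t0 : R) (x0 : space) :
  0 <= C -> (forall i, 0 <= delta i <= D) ->
  measurable_fun setT U -> (forall i, measurable_fun setT (G i)) ->
  0 < rho -> 0 < sigma < 1 -> 1 <= k -> rho <= k `^ P -> 0 <= X ->
  (\int[mu2]_(z in cylinder p rho x0 t0) (Num.max (U z) 0 `^ P)%:E = X%:E)%E ->
  slice_weak_gradient rho t0 x0 U G ->
  slice_energy_bound C rho t0 x0 U -> gradient_energy_bound C rho t0 x0 delta U G ->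
  degiorgi_constant C D * ((1 - sigma) `^ (- (PP * (N + pb) / pb)) *
    ((2 ^+ n.+2 * rho `^ (N / pb) * rho)^-1 * X)) `^ (pb / (pb * (N + 2) - N * P)) <= k ->
  \forall z \ae mu2, cylinder p (sigma * rho) x0 t0 z -> U z <= k.
Proof.
move=> C0 deltaD mU mG rho0 /andP[s0 s1] k1 rhok X0 HX Hweak Hsup Hgrad Hk.
have k0 : 0 < k by exact: lt_le_trans k1.
have d0 : 0 < 1 - sigma by rewrite subr_gt0.
have K0 : 0 < iteration_constant C D by exact: iteration_constant_gt0.
set y := (1 - sigma) `^ (- PP) / rho.
set A := iteration_constant C D * 2 `^ m * y `^ theta * k `^ (- (P * (1 - P / l))).
have A0 : 0 <= A.
  by rewrite /A; apply: mulr_ge0; [apply: mulr_ge0; [apply: mulr_ge0; [exact: ltW|]|]|]; exact: powR_ge0.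
set b : R := 2 `^ m; set q := b `^ (- alpha^-1).
have b0 : 0 < b by exact: powR_gt0.
have alpha0 : 0 < alpha by rewrite divr_gt0// addr_gt0.
have HA : A * X `^ alpha * b `^ alpha^-1 <= 1.
  have q2 : (0 : R) < 2 ^+ n.+2 by exact: exprn_gt0.
  exact: (level_choice N0 pb0 P0 PN (ltW K0) s1 rho0 X0 k0 q2 Hk).
pose rad j := sigma * rho + (1 - sigma) * rho / 2 ^+ j.
pose lev j := k - k / 2 ^+ j.
have two j : (0 : R) < 2 ^+ j by exact: exprn_gt0.
have rad_gt j : sigma * rho < rad j by rewrite /rad ltrDl divr_gt0// mulr_gt0.
have sr0 : 0 < sigma * rho by exact: mulr_gt0.
have rad0 j : 0 < rad j by exact: lt_trans (rad_gt j).
have step j : rad j - rad j.+1 = rho / (2 ^+ j.+1 / (1 - sigma)).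
  rewrite /rad exprS; field; rewrite (gt_eqF (two j))/= gt_eqF//.
have rad_lt j : rad j.+1 < rad j by rewrite -subr_gt0 step divr_gt0// divr_gt0.
have rad_le j : rad j <= rho.
  elim: j => [|j IH]; last exact: ltW (lt_le_trans (rad_lt j) IH).
  by rewrite /rad expr0; lra.
have claim j : exists2 x, 0 <= x <= X * q ^+ j &
    (\int[mu2]_(z in cylinder p (rad j) x0 t0) (Num.max (U z - lev j) 0 `^ P)%:E = x%:E)%E.
  elim: j => [|j [x /andP[x0' xX] IH]].
    exists X; first by rewrite X0 expr0 mulr1 lexx.
    have -> : rad 0%N = rho by rewrite /rad expr0; lra.
    rewrite -HX; apply: eq_integral => z _.
    by rewrite /lev expr0 divr1 subrr subr0.
  set beta := (2 : R) ^+ j.+1.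
  have levS : lev j.+1 = lev j + k / beta.
    by rewrite /lev /beta exprS; field; rewrite gt_eqF.
  have beta1 : 1 <= beta by rewrite exprn_ege1// ler1n.
  have s1' : 1 <= beta / (1 - sigma) by rewrite ler_pdivlMr// mul1r; lra.
  have Hw : \forall t \ae lam, t0 - rad j.+1 < t < t0 ->
      weak_gradient_on_box (fun i => x0 ord0 i - rad j.+1 `^ (p i)^-1)
      (fun i => x0 ord0 i + rad j.+1 `^ (p i)^-1) (fun y => U (y, t)) (fun i y => G i (y, t)).
    apply: (@filterS _ _ (ae_filter_ringOfSetsType lam) _ _ _ Hweak) => t Ht /andP[t1 t2].
    apply: Ht; last by rewrite rad0 (lt_le_trans (rad_lt j)).
    by rewrite t2 andbT; have := rad_le j.+1; lra.
  have Hs1 : rho / (beta / (1 - sigma)) <= rad j - rad j.+1 by rewrite step.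
  have Hs2 : rho / (beta / (1 - sigma)) <= rad j.+1.
    have := step j; rewrite -/beta => <-; have := rad0 j.+1; rewrite /rad exprS.
    have -> : (1 - sigma) * rho / 2 ^+ j = 2 * ((1 - sigma) * rho / (2 * 2 ^+ j)).
      by field; rewrite gt_eqF.
    by move: sr0; lra.
  have := degiorgi_step p1 pbN Pl C0 deltaD mU mG (rad0 j.+1) (rad_lt j) (rad_le j) s1' Hs1 Hs2
    k1 rhok beta1 x0' IH Hw (Hsup _ _ _ (rad0 _) (rad_lt j) (rad_le j))
    (Hgrad _ _ _ (rad0 _) (rad_lt j) (rad_le j)) (erefl _).
  rewrite -levS /energy_growth.
  have Tr0 := ltW (troisi_constant_gt0 p1 pbN); have c20 := ltW (energy_constant_gt0 D C0).
  have -> := step_algebra N0 pb0 P0 PN Tr0 c20 PP0 s1 rho0 (lt_le_trans ltr01 beta1) k0 x0'.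
  have -> : beta `^ growth_exponent N pb P PP = 2 `^ m * b ^+ j.
    rewrite /beta -(powR_mulrn j.+1)// powRAC -/m -/b powR_mulrn ?powR_ge0// exprS //.
  set v := (_ * x `^ _)%R => Hv.
  have vX : v <= X * q ^+ j.+1.
    apply: le_trans (geometric_step A0 b0 alpha0 X0 x0' xX HA).
    rewrite le_eqVlt; apply/orP; left; apply/eqP; rewrite /v /A /iteration_constant; ring.
  set I := (\int[mu2]_(z in cylinder p (rad j.+1) x0 t0) _)%E in Hv *.
  have I0 : (0 <= I)%E by apply: integral_ge0 => z _; rewrite lee_fin powR_ge0.
  have Ifin : I \is a fin_num by rewrite ge0_fin_numE// (le_lt_trans Hv)// ltry.
  exists (fine I); last by rewrite fineK.
  by rewrite -!lee_fin fineK// I0/= (le_trans Hv)// lee_fin.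
set Q := cylinder p (sigma * rho) x0 t0.
have mQ : measurable (Q : set T) by exact: measurable_cylinder.
set I := (\int[mu2]_(z in Q) (Num.max (U z - k) 0 `^ P)%:E)%E.
have I0 : (0 <= I)%E by apply: integral_ge0 => z _; rewrite lee_fin powR_ge0.
have Ij j : (I <= (X * q ^+ j)%:E)%E.
  have [x /andP[_ xX] Hx] := claim j.
  apply: (@le_trans _ _ x%:E); last by rewrite lee_fin.
  rewrite -Hx; apply: (@le_trans _ _ (\int[mu2]_(z in cylinder p (rad j) x0 t0)
      (Num.max (U z - k) 0 `^ P)%:E)%E).
    apply: ge0_subset_integral_nm; last by move=> z _; rewrite lee_fin powR_ge0.
    by apply: (cylinder_sub p1); exact: ltW.
  apply: ge0_le_integral_nm => z _; rewrite lee_fin ?powR_ge0//.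
  have levk : lev j <= k by rewrite /lev gerBl divr_ge0// ltW.
  have max0 (u : R) : 0 <= Num.max u 0 by rewrite le_max lexx orbT.
  apply: ge0_ler_powR; rewrite ?nnegrE ?max0//; first exact: ltW.
  by rewrite ge_max max0 andbT le_max lerD2l lerN2 levk.
have m0 : 0 < m by exact: growth_exponent_gt0.
have q0 : 0 < q by exact: powR_gt0.
have q1 : q < 1.
  rewrite /q powRN invf_lt1; last exact: powR_gt0.
  have b1 : 1 < b by have := @gt0_ltr_powR R m m0 1 2; rewrite !nnegrE powR1; apply; rewrite ?ltr1n.
  have := @gt0_ltr_powR R alpha^-1 _ 1 b; rewrite !nnegrE powR1; apply; rewrite ?invr_gt0 ?(ltW b0)//.
have Iz : I = 0%E.
  apply/eqP; rewrite eq_le I0 andbT.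
  have Ifin : I \is a fin_num by rewrite ge0_fin_numE// (le_lt_trans (Ij 0%N))// ltry.
  rewrite -(fineK Ifin) lee_fin.
  have cv : X * q ^+ j @[j --> \oo] --> (0 : R).
    rewrite -[X in _ --> X](mulr0 X); apply: cvgMr.
    by apply: cvg_expr; rewrite gtr0_norm.
  rewrite -(cvg_lim _ cv)//; apply: limr_ge; first by apply/cvg_ex; exists 0.
  by apply: nearW => j; rewrite -lee_fin fineK.
have mf : measurable_fun Q (fun z => (Num.max (U z - k) 0 `^ P)%:E).
  apply/measurable_EFinP; apply: measurable_funTS.
  apply: (@measurableT_comp _ _ _ _ _ _ (@powR R ^~ P)) => //; exact: measurable_level.
have := (@ae_eq_integral_abs _ _ _ mu2 Q mQ _ mf).1.
have -> : (\int[mu2]_(z in Q) `|(Num.max (U z - k) 0 `^ P)%:E| = I)%E.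
  by apply: eq_integral => z _; rewrite gee0_abs// lee_fin powR_ge0.
move=> /(_ Iz); apply: filterS => z Hz Qz; have := Hz Qz => /= -[] /powR_eq0_eq0 h.
by rewrite -subr_le0 -h le_max lexx.
Qed.


End degiorgi.

(** * The estimate for functions in the De Giorgi class *)

Section sup_estimate.
Context {R : realType} {n : nat}.
Variable p : 'I_n.+2 -> R.
Hypothesis p1 : forall i, 1 < p i.
Let N : R := n.+2%:R.
Let pb : R := mean_exponent p.
Hypothesis pbN : pb < N.
Local Notation PP := (family_max p).
Local Notation P := (integrability_exponent p).
Local Notation l := (parabolic_exponent p).
Hypothesis Pl : P < l.
Local Notation space := 'rV[R]_n.+2.
Local Notation T := (space * measurableTypeR R)%type.
Local Notation mu := (lebesgue_rV n.+2).
Local Notation lam := (@lebesgue_measure R).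
Local Notation mu2 := (@lebesgue_xt R n.+2).

Let p0 i : 0 < p i. Proof. exact: lt_trans ltr01 (p1 i). Qed.
Let P0 : 0 < P.
Proof. by apply: lt_le_trans (integrability_exponent_ge2 p). Qed.

Lemma cylinder_measure (rho t0 : R) (x0 : space) : 0 < rho ->
  mu2 (cylinder p rho x0 t0) = (2 ^+ n.+2 * rho `^ (N / pb) * rho)%:E.
Proof.
move=> rho0.
have -> : mu2 (cylinder p rho x0 t0) =
    (mu (cuboid p rho x0) * lam (time_interval rho t0))%E.
  by apply: product_measure1E; [exact: measurable_cuboid|exact: measurable_itv].
rewrite [X in (_ * X)%E](_ : _ = rho%:E); last first.
  by rewrite /time_interval lebesgue_measure_itv/= lte_fin gtrBl rho0 -EFinB opprB addrC subrK.
rewrite [X in (X * _)%E](_ : _ = (2 ^+ n.+2 * rho `^ (N / pb))%:E) -?EFinM//.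
pose a i := x0 ord0 i - rho `^ (p i)^-1; pose b i := x0 ord0 i + rho `^ (p i)^-1.
have -> : cuboid p rho x0 = [set x | forall j, (`]a j, b j[%classic : set (measurableTypeR R)) (x ord0 j)].
  by apply/seteqP; split => x /= H j; have := H j; rewrite in_itv.
rewrite (@lebesgue_rV_box R n.+2 (fun j => `]a j, b j[%classic)); last by move=> j; exact: measurable_itv.
rewrite (eq_bigr (fun j => (2 * rho `^ (p j)^-1)%:E)).
  rewrite prodEFin; congr EFin; rewrite big_split/= prodr_const card_ord powR_prodD.
    by rewrite sum_inv_exponent.
  by move=> i; rewrite invr_gt0.
move=> j _; have r0 : 0 < rho `^ (p j)^-1 by exact: powR_gt0.
have ab : a j < b j by rewrite /a /b; lra.
by rewrite /= lebesgue_measure_itv/= lte_fin ab -EFinB; congr EFin; rewrite /a /b; ring.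
Qed.

Lemma closure_cylinder (rho t0 : R) (x0 : space) : 0 < rho ->
  closure (cylinder p rho x0 t0) (x0, t0).
Proof.
move=> rho0 B /nbhs_ballP[e /= e0 eB].
pose d := Num.min e rho / 2.
have m0 : 0 < Num.min e rho by rewrite lt_min e0.
have d0 : 0 < d by rewrite divr_gt0.
have de : d < e.
  by apply: (@lt_le_trans _ _ (Num.min e rho)); [rewrite /d ltr_pdivrMr// ltr_pMr// ltr1n|rewrite ge_min lexx].
have dr : d < rho.
  by apply: (@lt_le_trans _ _ (Num.min e rho)); [rewrite /d ltr_pdivrMr// ltr_pMr// ltr1n|rewrite ge_min lexx orbT].
exists (x0, t0 - d); split.
  split => /=.
    by move=> i; have r0 : 0 < rho `^ (p i)^-1 by [exact: powR_gt0]; apply/andP; split; lra.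
  by rewrite /time_interval/= in_itv/=; apply/andP; split; lra.
apply: eB; split => /=; first exact: ballxx.
by rewrite /ball/= opprB addrC subrK gtr0_norm.
Qed.

Lemma powR_invK (rho : R) : 0 < rho ->
  (rho `^ P^-1) `^ P = rho.
Proof. by move=> rho0; rewrite -powRrM mulVf ?gt_eqF// powRr1// ltW. Qed.

Lemma integral_pos_part_fin (D0 Q : set T) (u : T -> R) : Lqloc_xt P D0 u ->
  compactly_contained Q D0 ->
  exists2 X : R, 0 <= X & (\int[mu2]_(z in Q) (Num.max (u z) 0 `^ P)%:E = X%:E)%E.
Proof.
move=> [_ Lu] [cQ QD].
set I := (\int[mu2]_(z in Q) _)%E.
have I0 : (0 <= I)%E by apply: integral_ge0 => z _; rewrite lee_fin powR_ge0.
have Ifin : I \is a fin_num.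
  rewrite ge0_fin_numE//; apply: le_lt_trans (Lu _ cQ QD).
  apply: (@le_trans _ _ (\int[mu2]_(z in closure Q) (Num.max (u z) 0 `^ P)%:E)%E).
    apply: ge0_subset_integral_nm; first exact: subset_closure.
    by move=> z _; rewrite lee_fin powR_ge0.
  apply: ge0_le_integral_nm => z _; rewrite lee_fin ?powR_ge0//.
  apply: ge0_ler_powR; rewrite ?nnegrE//; first exact: ltW.
    by rewrite le_max lexx orbT.
  by rewrite ge_max ler_norm normr_ge0.
by exists (fine I); [exact: fine_ge0|rewrite fineK].
Qed.

(** Everything the iteration uses about u, stated for Borel representatives. For
    r < rho the closed cuboid of radius r lies in the open one of radius rho, hence
    in Omega, which gives the weak gradient on slices. *)
Lemma DG_plus_borel (Omega : set space) (S C rho t0 : R) (delta : 'I_n.+2 -> R)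
    (u : T -> R) (x0 : space) :
  open Omega -> 0 <= C -> DG_plus p delta Omega S C u -> 0 < rho ->
  compactly_contained (cylinder p rho x0 t0) (time_cylinder Omega S) ->
  exists (U : T -> R) (G : 'I_n.+2 -> T -> R),
  [/\ measurable_fun setT U /\ (forall i, measurable_fun setT (G i)),
      \forall z \ae mu2, cylinder p rho x0 t0 z -> u z = U z,
      slice_weak_gradient p rho t0 x0 U G,
      slice_energy_bound p C rho t0 x0 U & gradient_energy_bound p C rho t0 x0 delta U G].
Proof.
move=> oO C0 [mu_u [Du [[[_ mDu weak] _] _ energy]]] rho0 [cQ QD].
have mD : measurable (time_cylinder Omega S : set T) by exact: measurable_time_cylinder.
have [U mU uU] := borel_representative mD mu_u.
have /choice[G HG] : forall i, exists G : T -> R, measurable_fun setT G /\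
    \forall z \ae mu2, time_cylinder Omega S z -> Du i z = G z.
  by move=> i; have [G mG uG] := borel_representative mD (mDu i).1; exists G.
have mG i := (HG i).1; have DuG i := (HG i).2.
have QD' : cylinder p rho x0 t0 `<=` time_cylinder Omega S.
  by apply: subset_trans QD; exact: subset_closure.
have cyl r : 0 < r -> r <= rho -> cylinder p r x0 t0 `<=` cylinder p rho x0 t0.
  by move=> r0 rrho; exact: (cylinder_sub p1 (ltW r0) rrho).
have est r : 0 < r -> r <= rho -> forall k zeta, admissible_cutoff p r x0 t0 zeta ->
    energy_estimate p delta C r x0 t0 zeta Du (fun z => Num.max (u z - k) 0)
      [set z | k < u z].
  move=> r0 rrho; apply: energy; [by apply: QD; exact: closure_cylinder|exact: r0|].
  apply: (compactly_contained_sub cQ _ QD).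
  by apply: subset_trans (cyl r r0 rrho) _; exact: subset_closure.
clear energy; exists U, G; split.
- by split.
- by apply: filterS uU => z uz Qz; apply: uz; exact: QD'.
- have uUt := ae_product2 uU.
  have DuGt : \forall t \ae lam, forall i, \forall x \ae mu,
      time_cylinder Omega S (x, t) -> Du i (x, t) = G i (x, t).
    by apply: filter_forall => i; exact: (ae_product2 (DuG i)).
  apply: (@filterS3 _ _ (ae_filter_ringOfSetsType lam) _ _ _ _ _ weak uUt DuGt) => t wt ut Dt tI r /andP[r0 rr].
  have Kt x : cuboid p rho x0 x -> time_cylinder Omega S (x, t).
    by move=> Kx; apply: QD'; split; [exact: Kx|rewrite /time_interval/= in_itv].
  have r1 i : r `^ (p i)^-1 < rho `^ (p i)^-1.
    by apply: gt0_ltr_powR; rewrite ?nnegrE ?invr_gt0 ?(ltW r0) ?(ltW rho0).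
  have [_ tS'] : time_cylinder Omega S (x0, t).
    by apply: Kt => i; have r2 := powR_gt0 (p i)^-1 rho0; apply/andP; split; lra.
  have tS : 0 < t < S by have := tS'; rewrite /= in_itv.
  have boxO : closed_box (fun i => x0 ord0 i - r `^ (p i)^-1)
      (fun i => x0 ord0 i + r `^ (p i)^-1) `<=` Omega.
    move=> x Hx; suff [] : time_cylinder Omega S (x, t) by []; apply: Kt => i.
    by have /andP[h1 h2] := Hx i; have := r1 i; move=> ?; apply/andP; split; lra.
  have mUt : measurable_fun setT (fun x => U (x, t)) by exact: measurableT_comp.
  have mGt i : measurable_fun setT (fun x => G i (x, t)) by exact: measurableT_comp.
  have ut' : \forall x \ae mu, Omega x -> u (x, t) = U (x, t).
    by apply: filterS ut => x ux Ox; apply: ux; split.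
  have Dt' i : \forall x \ae mu, Omega x -> Du i (x, t) = G i (x, t).
    by apply: filterS (Dt i) => x ux Ox; apply: ux; split.
  have [H1 H2 H3] := weak_partial_box boxO mUt mGt ut' Dt' (wt tS).
  by split; [exact: H1 ord0|exact: H2|exact: H3].
- move=> r r' kappa r'0 rr' rrho; have r0 := lt_trans r'0 rr'.
  have sub := subset_trans (cyl r r0 rrho) QD'.
  by have [] := caccioppoli p1 C0 r'0 rr' mU mG uU DuG sub (est _ r0 rrho kappa).
- move=> r r' kappa r'0 rr' rrho; have r0 := lt_trans r'0 rr'.
  have sub := subset_trans (cyl r r0 rrho) QD'.
  by have [] := caccioppoli p1 C0 r'0 rr' mU mG uU DuG sub (est _ r0 rrho kappa).
Qed.

(** The right-hand side is a real number k because u is locally in L^P, and it is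
    an admissible level for [degiorgi_bound]. *)
Lemma sup_bound_DG_plus (Omega : set space) (S C D rho sigma t0 : R) (delta : 'I_n.+2 -> R)
    (u : T -> R) (x0 : space) :
  open Omega -> 0 <= C -> (forall i, 0 <= delta i <= D) -> DG_plus p delta Omega S C u ->
  0 < rho -> 0 < sigma < 1 ->
  compactly_contained (cylinder p rho x0 t0) (time_cylinder Omega S) ->
  exists2 k : R, sup_bound p (degiorgi_constant p C D) rho sigma x0 t0
    (fun z => Num.max (u z) 0) = k%:E &
    \forall z \ae mu2, cylinder p (sigma * rho) x0 t0 z -> u z <= k.
Proof.
move=> oO C0 deltaD DG rho0 s01 cc.
have [U [G [[mU mG] uU Hweak Hsup Hgrad]]] := DG_plus_borel oO C0 DG rho0 cc.
have [_ [_ [_ Lu _]]] := DG; have [X X0 uX] := integral_pos_part_fin Lu cc.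
have UX : (\int[mu2]_(z in cylinder p rho x0 t0) (Num.max (U z) 0 `^ P)%:E = X%:E)%E.
  rewrite -uX; apply: ae_eq_integral_nm.
  apply: (@filterS _ _ (ae_filter_ringOfSetsType mu2) _ _ _ uU) => z uz; rewrite !patchE.
  by case: ifPn => // /set_mem Qz; rewrite uz.
clear DG Lu.
pose Y := (1 - sigma) `^ (- (PP * (N + pb) / pb)) * ((2 ^+ n.+2 * rho `^ (N / pb) * rho)^-1 * X).
pose k := Num.max 1 (Num.max (rho `^ P^-1)
  (degiorgi_constant p C D * Y `^ (pb / (pb * (N + 2) - N * P)))).
exists k.
  rewrite /sup_bound uX cylinder_measure; last exact: rho0.
  by rewrite /= -!EFin_max.
have k1 : 1 <= k by rewrite le_max lexx.
have rhok : rho <= k `^ P.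
  rewrite -[leLHS]powR_invK//.
  apply: ge0_ler_powR; rewrite ?nnegrE ?powR_ge0//; [exact: ltW|exact: le_trans k1|].
  by rewrite /k !le_max lexx orbT.
have Hk : degiorgi_constant p C D * Y `^ (pb / (pb * (N + 2) - N * P)) <= k.
  by rewrite /k !le_max lexx !orbT.
have Hae := degiorgi_bound p1 pbN Pl C0 deltaD mU mG rho0 s01 k1 rhok X0 UX Hweak Hsup Hgrad Hk.
have /andP[s0 s1] := s01.
apply: (@filterS2 _ _ (ae_filter_ringOfSetsType mu2) _ _ _ _ uU Hae) => z uz Uk Qz.
rewrite uz; first exact: Uk.
apply: (cylinder_sub p1 _ _ Qz); first by rewrite ltW// mulr_gt0.
by rewrite ler_piMl// ltW.
Qed.

End sup_estimate.

(** * Local boundedness *)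

Section local_boundedness.
Context {R : realType} {n : nat}.
Variable p : 'I_n.+2 -> R.
Hypothesis p1 : forall i, 1 < p i.
Local Notation PP := (family_max p).
Local Notation space := 'rV[R]_n.+2.
Local Notation T := (space * measurableTypeR R)%type.
Local Notation mu2 := (@lebesgue_xt R n.+2).

Let p0 i : 0 < p i. Proof. exact: lt_trans ltr01 (p1 i). Qed.

(** The time rho / 4 is added so that the cylinder, which ends at its reference time,
    contains a neighbourhood of (x0, t0) after halving rho. *)
Lemma small_cylinder (D : set (space * R)) (x0 : space) (t0 : R) : open D -> D (x0, t0) ->
  exists2 rho, 0 < rho & compactly_contained (cylinder p rho x0 (t0 + rho / 4)) D /\
    nbhs (x0, t0) (cylinder p (2^-1 * rho) x0 (t0 + rho / 4)).
Proof.
move=> oD Dz; have /nbhs_ballP[e /= e0 eD] : nbhs (x0, t0) D by exact: open_nbhs_nbhs.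
set c := Num.min 1 (e / 2).
have c0 : 0 < c by rewrite lt_min ltr01 divr_gt0.
have c1 : c <= 1 by rewrite ge_min lexx.
have ce : c <= e / 2 by rewrite ge_min lexx orbT.
have cb : 0 < c <= 1 by rewrite c0 c1.
set rho := c `^ PP; have rho0 : 0 < rho by exact: powR_gt0.
have PP1 : 1 < PP by exact: family_max_gt1.
have rhoc : rho <= c by rewrite -[leRHS]powRr1 ?(ltW c0)//; apply: ger_powR => //; exact: ltW.
have rc i : rho `^ (p i)^-1 <= c.
  rewrite /rho -powRrM -[leRHS]powRr1 ?(ltW c0)//; apply: ger_powR => //.
  by rewrite ler_pdivlMr// mul1r; exact: le_family_max.
have rr i : 2^-1 * rho <= (2^-1 * rho) `^ (p i)^-1.
  rewrite -[leLHS]powRr1 ?mulr_ge0 ?(ltW rho0)//; apply: ger_powR.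
    by rewrite mulr_gt0//=; lra.
  by rewrite invf_le1// ltW.
exists rho => //; split.
  pose K := closed_box (fun i => x0 ord0 i - rho `^ (p i)^-1) (fun i => x0 ord0 i + rho `^ (p i)^-1)
    `*` `[t0 - rho, t0 + rho]%classic.
  have cK : compact K.
    by apply: compact_setX; [exact: compact_closed_box|exact: segment_compact].
  apply: (compactly_contained_sub cK).
    move=> [x t] [/= Kx]; rewrite /time_interval/= in_itv/= => /andP[h1 h2]; split => /=.
      by move=> i; have /andP[k1 k2] := Kx i; rewrite (ltW k1) (ltW k2).
    by rewrite in_itv/=; apply/andP; split; lra.
  move=> [x t] [/= Kx]; rewrite in_itv/= => /andP[h1 h2]; apply: eD; split => /=.
    split => // i j; rewrite (ord1 i) /ball/=; have := rc j; have /andP[k1 k2] := Kx j.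
    by move=> ?; rewrite ltr_norml; apply/andP; split; lra.
  by rewrite /ball/= ltr_norml; apply/andP; split; lra.
apply/nbhs_ballP; exists (rho / 4); first by rewrite /= divr_gt0.
move=> [x t] [/= [_ Bx]]; rewrite /ball/= ltr_norml => /andP[h1 h2]; split => /=.
  move=> i; have := Bx ord0 i; rewrite /ball/= ltr_norml => /andP[k1 k2]; have := rr i.
  by move=> ?; apply/andP; split; lra.
by rewrite /time_interval/= in_itv/=; apply/andP; split; lra.
Qed.

(** Compactness in filter form: the sets outside which u is essentially bounded on K
    form a filter, and a cluster point would contradict the local bound. *)
Lemma compact_ae_bound (K D : set (space * R)) (u : T -> R) : compact K -> K `<=` D ->
  (forall z, D z -> exists V M, nbhs z V /\ \forall y \ae mu2, V y -> u y <= M) ->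
  exists M, \forall y \ae mu2, K y -> u y <= M.
Proof.
move=> cK KD loc; apply: contrapT => unbounded.
pose F (E : set (space * R)) := exists M, \forall y \ae mu2, K y -> ~ E y -> u y <= M.
have PF : ProperFilter F.
  apply: Build_ProperFilter.
    move=> [M HM]; apply: unbounded; exists M.
    by apply: (@filterS _ _ (ae_filter_ringOfSetsType mu2) _ _ _ HM) => y Hy Ky; apply: Hy.
  split.
  - by exists 0; apply: aeW => y _ /(_ I).
  - move=> A B [MA HA] [MB HB]; exists (Num.max MA MB).
    apply: (@filterS2 _ _ (ae_filter_ringOfSetsType mu2) _ _ _ _ HA HB) => y Ay By Ky /not_andP[nA|nB].
      by rewrite le_max Ay.
    by rewrite le_max By// orbT.
  - move=> A B AB [M HM]; exists M.
    apply: (@filterS _ _ (ae_filter_ringOfSetsType mu2) _ _ _ HM) => y Hy Ky nB.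
    by apply: Hy => // /AB.
have [z [Kz clz]] : K `&` cluster F !=set0.
  by apply: cK; exists 0; apply: aeW => y Ky /(_ Ky).
have [V [M [Vz HM]]] := loc z (KD z Kz).
have FV : F (~` V).
  exists M; apply: (@filterS _ _ (ae_filter_ringOfSetsType mu2) _ _ _ HM) => y Hy _ /contrapT.
  exact: Hy.
by have [y []] := clz _ _ FV Vz.
Qed.

End local_boundedness.

(** * The reflection exchanging the two De Giorgi classes *)

Section reflection.
Context {R : realType} {n : nat}.
Variable p : 'I_n -> R.
Local Notation space := 'rV[R]_n.
Local Notation T := (space * measurableTypeR R)%type.
Local Notation mu := (lebesgue_rV n).
Local Notation mu2 := (@lebesgue_xt R n).

Lemma smooth_opp (V : normedModType R) (f : V -> R) : smooth f -> smooth (fun x => - f x).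
Proof.
move=> sf; have iter vs : iter_derive (fun x => - f x) vs = (fun x => - iter_derive f vs x).
  elim: vs => [//|v vs IH] /=; rewrite IH; apply/funext => x.
  by rewrite -[LHS]/('D_v (- iter_derive f vs) x) deriveN//; exact: (sf vs).2.
move=> vs; rewrite iter; split=> [x|x v].
  by apply: continuousN; exact: (sf vs).1.
by apply: derivableN; exact: (sf vs).2.
Qed.

Lemma ae_measurable_opp d (X : measurableType d) (nu : {measure set X -> \bar R})
    (D : set X) (f : X -> R) :
  ae_measurable nu D f -> ae_measurable nu D (fun x => - f x).
Proof.
move=> [g mg fg]; exists (fun x => - g x); first exact: measurable_funN.
by apply: filterS fg => x fg /fg ->.
Qed.

Lemma Lqloc_xt_opp q (D : set (space * R)) (f : space * R -> R) :
  Lqloc_xt q D f -> Lqloc_xt q D (fun z => - f z).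
Proof.
move=> [mf Hf]; split; first exact: ae_measurable_opp.
by move=> K cK KD; under eq_integral do rewrite normrN; exact: Hf.
Qed.

(** The sign is carried by the test function, so that the integral is not required
    to be odd, which it is only for functions with a well-defined integral. *)
Lemma weak_partial_opp (Omega : set space) i (f g : space -> R) :
  weak_partial Omega i f g -> weak_partial Omega i (fun x => - f x) (fun x => - g x).
Proof.
have L1 (h : space -> R) : L1loc_x Omega h -> L1loc_x Omega (fun x => - h x).
  move=> [mh Hh]; split; first exact: ae_measurable_opp.
  by move=> K cK KO; under eq_integral do rewrite normrN; exact: Hh.
move=> [Lf Lg weak]; split; [exact: L1|exact: L1|] => phi [sphi cphi].
have tphi : test_function Omega (fun x => - phi x).
  split; first exact: smooth_opp.
  by rewrite (_ : [set x | _] = [set x | phi x != 0])//; apply/seteqP; split => x /=; rewrite oppr_eq0.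
have := weak _ tphi.
under eq_integral => x _.
  rewrite -[fun x => - phi x]/(- phi) deriveN; last exact: (sphi [::]).2.
  rewrite mulrN -mulNr.
  over.
move=> ->; congr (- _)%E; apply: eq_integral => x _.
by rewrite mulrN -mulNr.
Qed.

Lemma DG_plus_opp (delta : 'I_n -> R) (Omega : set space) (S C : R) (u : space * R -> R) :
  DG_minus p delta Omega S C u -> DG_plus p delta Omega S C (fun z => - u z).
Proof.
move=> [mu_u [Du [[[Lu LDu weak] LpDu] LPu energy]]]; split.
  exact: ae_measurable_opp.
exists (fun i z => - Du i z); split.
- split; last by move=> i; apply: Lqloc_xt_opp (LpDu i).
  split; [apply: Lqloc_xt_opp Lu|move=> i; apply: Lqloc_xt_opp (LDu i)|].
  apply: (@filterS _ _ (ae_filter_ringOfSetsType lebesgue_measure) _ _ _ weak) => t wt tS i.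
  exact: weak_partial_opp (wt tS i).
- apply: Lqloc_xt_opp LPu.
move=> x0 t0 rho D0 rho0 cc k zeta adm.
have := energy x0 t0 rho D0 rho0 cc (- k) zeta adm.
have -> : (fun z => Num.max (- (u z - - k)) 0) = (fun z => Num.max (- u z - k) 0).
  by apply/funext => z; congr Num.max; ring.
have -> : [set z | u z < - k] = [set z | k < - u z].
  by apply/seteqP; split => z /=; rewrite ltrNr.
rewrite /energy_estimate; under [X in (_ + X <= _)%E -> _]eq_bigr do
  under eq_integral do rewrite -normrN.
by [].
Qed.

End reflection.
(** * The theorem *)

Theorem theorem4p1 (R : realType) (n : nat) (p : 'I_n -> R) (C delta_max : R)
  (hn : (2 <= n)%N)
  (hp : forall i, 1 < p i < mean_exponent p * (1 + 2 / n%:R))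
  (hpn : mean_exponent p < n%:R)
  (hp2 : 2 * n%:R / (n%:R + 2) < mean_exponent p)
  (hC : 0 < C) :
  exists2 C' : R, 0 < C' &
  forall (Omega : set 'rV[R]_n) (T : R) (delta : 'I_n -> R),
    domain Omega -> bounded_set Omega -> 0 < T ->
    (forall i, 0 <= delta i) -> family_max delta = delta_max ->
    (forall u : 'rV[R]_n * R -> R,
      DG_plus p delta Omega T C u ->
      locally_bounded_above (time_cylinder Omega T) u /\
      forall (x0 : 'rV[R]_n) (t0 rho sigma : R), 0 < rho -> 0 < sigma < 1 ->
        compactly_contained (cylinder p rho x0 t0) (time_cylinder Omega T) ->
        (ess_sup_on lebesgue_xt (cylinder p (sigma * rho) x0 t0) (EFin \o u) <=
         sup_bound p C' rho sigma x0 t0 (fun z => Num.max (u z) 0)%R)%E) /\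
    (forall u : 'rV[R]_n * R -> R,
      DG_minus p delta Omega T C u ->
      locally_bounded_below (time_cylinder Omega T) u /\
      forall (x0 : 'rV[R]_n) (t0 rho sigma : R), 0 < rho -> 0 < sigma < 1 ->
        compactly_contained (cylinder p rho x0 t0) (time_cylinder Omega T) ->
        (- sup_bound p C' rho sigma x0 t0 (fun z => Num.max (- u z) 0)%R <=
         ess_inf_on lebesgue_xt (cylinder p (sigma * rho) x0 t0) (EFin \o u))%E).
Proof.
case: n p hn hp hpn hp2 => [|[|n]] // p _ hp hpn hp2.
have p1 i : 1 < p i by have /andP[] := hp i.
have N0 : 0 < n.+2%:R :> R by rewrite ltr0n.
have Pl : integrability_exponent p < parabolic_exponent p.
  apply: integrability_exponent_lt => [|i].
    rewrite /parabolic_exponent ltr_pdivlMr//.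
    by rewrite ltr_pdivrMr ?addr_gt0// in hp2.
  have /andP[_] := hp i; rewrite /parabolic_exponent => /lt_le_trans; apply.
  by rewrite le_eqVlt; apply/orP; left; apply/eqP; move: N0; move: (n.+2%:R) => N N0; field; rewrite gt_eqF.
exists (degiorgi_constant p C delta_max); first exact: (degiorgi_constant_gt0 p1 hpn _ (ltW hC)).
move=> Omega S delta [oO _ _] _ S0 delta0 deltamax.
have deltaD i : 0 <= delta i <= delta_max by rewrite delta0/= -deltamax; exact: le_family_max.
have est := sup_bound_DG_plus p1 hpn Pl oO (ltW hC) deltaD.
have oD : open (time_cylinder Omega S).
  rewrite openE => -[x t] [/= Ox tS]; exists (Omega, `]0, S[%classic) => //=; split.
    exact: open_nbhs_nbhs.
  by apply: open_nbhs_nbhs; split => //; exact: interval_open.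
have loc v : DG_plus p delta Omega S C v -> forall K, compact K -> K `<=` time_cylinder Omega S ->
    exists M, \forall z \ae lebesgue_xt, K z -> v z <= M.
  (* sigma = 1 / 2 on a small cylinder around each point *)
  move=> DGv K cK KD; apply: (compact_ae_bound cK KD) => -[x t] Dz.
  have [rho rho0 [cc V]] := small_cylinder p1 oD Dz.
  have half : 0 < (2^-1 : R) < 1 by apply/andP; split; lra.
  have [k _ Hk] := est _ _ _ _ _ _ DGv rho0 half cc.
  by exists (cylinder p (2^-1 * rho) x (t + rho / 4)), k.
split=> u DGu.
- split.
    move=> K cK KD; have [M HM] := loc _ DGu K cK KD.
    apply: (@le_lt_trans _ _ M%:E); last exact: ltry.
    apply/ess_supP; apply: (@filterS _ _ (ae_filter_ringOfSetsType lebesgue_xt) _ _ _ HM) => z Hz.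
    by case: ifP => [/set_mem Kz|_]; [rewrite /= lee_fin Hz|exact: leNye].
  move=> x0 t0 rho sigma rho0 s01 cc; have [k -> Hk] := est _ _ _ _ _ _ DGu rho0 s01 cc.
  apply/ess_supP; apply: (@filterS _ _ (ae_filter_ringOfSetsType lebesgue_xt) _ _ _ Hk) => z Hz.
  by case: ifP => [/set_mem Qz|_]; [rewrite /= lee_fin Hz|exact: leNye].
(* the second half is the first one for - u *)
- have DGo := DG_plus_opp DGu; split.
    move=> K cK KD; have [M HM] := loc _ DGo K cK KD.
    apply: (@lt_le_trans _ _ (- M)%:E); first exact: ltNyr.
    apply/ess_infP; apply: (@filterS _ _ (ae_filter_ringOfSetsType lebesgue_xt) _ _ _ HM) => z Hz.
    by case: ifP => [/set_mem Kz|_]; [rewrite /= lee_fin lerNl Hz|exact: leey].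
  move=> x0 t0 rho sigma rho0 s01 cc; have [k -> Hk] := est _ _ _ _ _ _ DGo rho0 s01 cc.
  apply/ess_infP; apply: (@filterS _ _ (ae_filter_ringOfSetsType lebesgue_xt) _ _ _ Hk) => z Hz.
  by case: ifP => [/set_mem Qz|_]; [rewrite /= lee_fin lerNl Hz|exact: leey].
Qed.
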